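(* For every integer $n\ge1$, the operads $\mathcal{T}rias^{\square n}$ and $\mathcal{T}ri\mathcal{D}end^{\blacksquare n}$ (the $n$-fold white square product of $\mathcal{T}rias$ and the $n$-fold black square product of $\mathcal{T}ri\mathcal{D}end$) are Koszul over $\mathbb{Z}$.
   Context: Work over the ring $\mathbb{Z}$. A non-symmetric operad $\{\mathcal{P}'_n\}_{n\ge1}$ is an operad without symmetric group actions; $\Sigma$ associates to it the operad $\mathcal{P}(n)=\mathcal{P}'_n\otimes\mathbb{Z}[\mathbb{S}_n]$ (a regular operad). A binary quadratic regular operad is $\Sigma(\mathcal{F}(V')/(R'))$, with $V'$ a finitely generated free module in arity $2$, $\mathcal{F}(V')$ the free non-symmetric operad, and $R'\subset\mathcal{F}(V')(3)$, where $\mathcal{F}(V')(3)$ is spanned by $\mu\circ_1\nu=\mu(\nu(x,y),z)$ and $\mu\circ_2\nu=\mu(x,\nu(y,z))$. For $\mathcal{P}=\Sigma(\mathcal{F}(V')/(R'))$ and $\mathcal{Q}=\Sigma(\mathcal{F}(W')/(S'))$, $$\mathcal{P}\,\square\,\mathcal{Q}=\Sigma\Big(\mathcal{F}(V'\otimes W')/\big(\Phi^{-1}(R'\otimes\mathcal{F}(W')(3)+\mathcal{F}(V')(3)\otimes S')\big)\Big),\qquad \mathcal{P}\,\blacksquare\,\mathcal{Q}=\Sigma\big(\mathcal{F}(V'\otimes W')/(\Psi(R'\otimes S'))\big),$$ with $\Phi((\mu\otimes\mu')\circ_i(\nu\otimes\nu'))=(\mu\circ_i\nu)\otimes(\mu'\circ_i\nu')$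 and $\Psi((\mu\circ_i\nu)\otimes(\mu'\circ_j\nu'))=\delta_{ij}(-1)^{i-1}(\mu\otimes\mu')\circ_i(\nu\otimes\nu')$. $\mathcal{T}ri\mathcal{D}end$ and $\mathcal{T}rias$ are the Koszul dual regular operads of Loday and Ronco. $\mathcal{T}ri\mathcal{D}end$: operations $\prec,\succ,\cdot$, with $x*y=x\prec y+x\succ y+x\cdot y$ and relations $(x\prec y)\prec z=x\prec(y*z)$, $(x\succ y)\prec z=x\succ(y\prec z)$, $(x*y)\succ z=x\succ(y\succ z)$, $(x\succ y)\cdot z=x\succ(y\cdot z)$, $(x\prec y)\cdot z=x\cdot(y\succ z)$, $(x\cdot y)\prec z=x\cdot(y\prec z)$, $(x\cdot y)\cdot z=x\cdot(y\cdot z)$. $\mathcal{T}rias$: operations $\dashv,\vdash,\perp$ with $(x\dashv y)\dashv z=x\dashv(y\dashv z)=x\dashv(y\vdash z)=x\dashv(y\perp z)$, $(x\vdash y)\dashv z=x\vdash(y\dashv z)$, $(x\dashv y)\vdash z=(x\vdash y)\vdash z=(x\perp y)\vdash z=x\vdash(y\vdash z)$, $(x\perp y)\dashv z=x\perp(y\dashv z)$, $(x\dashv y)\perp z=x\perp(y\vdash z)$, $(x\vdash y)\perp z=x\vdash(y\perp z)$, $(x\perp y)\perp z=x\perp(y\perp z)$. A quadratic operad $\mathcal{P}$ is Koszul if the homology of its bar construction $\mathcal{B}(\mathcal{P})=\mathcal{F}^c(s\overline{\mathcal{P}})$ (cofree connected cooperad on the suspension of the augmentation ideal, differential induced by partial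 compositions) is concentrated in top dimension: in weight $\omega$ (number of generating operations) the homology is concentrated in degree $\omega$ (number of vertices). *)

(* Defs.v *)
From HB Require Import structures.
From mathcomp Require Import all_boot fingroup perm ssralg ssrint.
From mathcomp Require Import generic_quotient ring_quotient.
From mathcomp Require Import zify.
From mathcomp Require Import boolp freeg.

Set Implicit Arguments.
Unset Strict Implicit.
Unset Printing Implicit Defensive.

Import GRing.Theory.
Local Open Scope ring_scope.

(* All operads live in arities >= 1 and are indexed by ARITY MINUS ONE: the   *)
(* component of index n consists of the operations with n + 1 inputs, and the *)
(* inputs are numbered from 0. So partial composition maps indices m and n to *)
(* m + n, the generators of a binary operad sit in index 1, its quadratic     *)
(* relations in index 2, and n is also the number of generating operations    *)
(* (the weight) of an operation of index n of a binary operad.                *)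

Section Lift.
Variables (K : choiceType) (M : lmodType int).
Implicit Types (f g : K -> M) (x y : {freeg K / int}).

Lemma fgliftU f k : fglift f (<< k >> : {freeg K / int}) = f k.
Proof. by rewrite liftU scale1r. Qed.

Lemma fgliftB f x y : fglift f (x - y) = fglift f x - fglift f y.
Proof. exact: lift_is_additive. Qed.

Lemma fglift0 f : fglift f 0 = 0.
Proof. by rewrite -(subrr (0 : {freeg K / int})) fgliftB subrr. Qed.

Lemma fgliftN f x : fglift f (- x) = - fglift f x.
Proof. by rewrite -sub0r fgliftB fglift0 sub0r. Qed.

Lemma fgliftD f x y : fglift f (x + y) = fglift f x + fglift f y.
Proof. by have := fgliftB f x (- y); rewrite fgliftN !opprK. Qed.

Lemma freeg_basis_ind (P : {freeg K / int} -> Prop) :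
  (forall k, P << k >>) -> P 0 -> (forall x y, P x -> P y -> P (x - y)) ->
  forall x, P x.
Proof.
move=> PU P0 PB.
have PN x : P x -> P (- x) by move=> Px; rewrite -sub0r; apply: PB.
have PD x y : P x -> P y -> P (x + y).
  by move=> Px Py; rewrite -[y]opprK; apply/PB/PN.
have Pn k (n : nat) : P (<< k >> *+ n).
  by elim: n => [|n IHn]; rewrite ?mulr0n // mulrS; apply: PD.
move=> x; elim/(@freeg_ind_dom0 int K): x => [//|c k D _ _ PD_]; apply: PD => //.
have <- : << k >> *~ c = << c *g k >> :> {freeg K / int}.
  by rewrite freegU_mulz intz.
by case: c => n; [rewrite -pmulrn | rewrite NegzE mulrNz -pmulrn; apply: PN]; apply: Pn.
Qed.

Lemma fglift_sub f g x : fglift (fun k => f k - g k) x = fglift f x - fglift g x.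
Proof.
elim/freeg_basis_ind: x => [k||x y IHx IHy].
- by rewrite !fgliftU.
- by rewrite !fglift0 subr0.
- by rewrite !fgliftB IHx IHy !opprD addrACA.
Qed.

Lemma fglift_add f g x : fglift (fun k => f k + g k) x = fglift f x + fglift g x.
Proof.
elim/freeg_basis_ind: x => [k||x y IHx IHy].
- by rewrite !fgliftU.
- by rewrite !fglift0 addr0.
- by rewrite !fgliftB IHx IHy opprD addrACA.
Qed.

End Lift.

Section Span.
Variable (M : zmodType) (S : M -> Prop).

Inductive in_span : M -> Prop :=
| in_span_gen x : S x -> in_span x
| in_span0 : in_span 0
| in_spanB x y : in_span x -> in_span y -> in_span (x - y).

Definition span : {pred M} := fun x => `[< in_span x >].

Lemma span_zmod_closed : zmod_closed span.
Proof.
split=> [|x y /asboolP hx /asboolP hy]; first exact/asboolP/in_span0.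
exact/asboolP/in_spanB.
Qed.

HB.instance Definition _ := GRing.isZmodClosed.Build M span span_zmod_closed.

End Span.

Definition recast (P : nat -> zmodType) m n (e : m = n) (x : P m) : P n :=
  ecast k (P k) e x.

Lemma recast0 (P : nat -> zmodType) m n (e : m = n) : recast e (0 : P m) = 0.
Proof. by case: n / e. Qed.

Lemma recastB (P : nat -> zmodType) m n (e : m = n) (x y : P m) :
  recast e (x - y) = recast e x - recast e y.
Proof. by case: n / e. Qed.

Record nsOperad := NsOperad {
  ns_car :> nat -> zmodType;
  ns_unit : ns_car 0;
  ns_comp : forall m n, 'I_m.+1 -> ns_car m -> ns_car n -> ns_car (m + n);
  ns_compDl : forall m n (i : 'I_m.+1) (x y : ns_car m) (z : ns_car n),
    ns_comp i (x + y) z = ns_comp i x z + ns_comp i y z;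
  ns_compDr : forall m n (i : 'I_m.+1) (x : ns_car m) (y z : ns_car n),
    ns_comp i x (y + z) = ns_comp i x y + ns_comp i x z;
  ns_comp1l : forall n (x : ns_car n), ns_comp ord0 ns_unit x = x;
  ns_comp1r : forall m (i : 'I_m.+1) (x : ns_car m),
    recast (addn0 m) (ns_comp i x ns_unit) = x;
  ns_compA : forall m n p (i : 'I_m.+1) (j : 'I_n.+1)
      (x : ns_car m) (y : ns_car n) (z : ns_car p),
    recast (addnA m n p) (ns_comp i x (ns_comp j y z)) =
    ns_comp (inord (i + j)) (ns_comp i x y) z;
  ns_compAC : forall m n p (i k : 'I_m.+1)
      (x : ns_car m) (y : ns_car n) (z : ns_car p), (i < k)%N ->
    recast (addnAC m n p) (ns_comp (inord (k + n)) (ns_comp i x y) z) =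
    ns_comp (inord i) (ns_comp k x z) y
}.

Section FreeNs.
Variable E : choiceType.

Inductive btree := BLeaf | BNode of E & btree & btree.

Fixpoint bt_encode (t : btree) : GenTree.tree E :=
  match t with
  | BLeaf => GenTree.Node 0 [::]
  | BNode e l r => GenTree.Node 0 [:: GenTree.Leaf e; bt_encode l; bt_encode r]
  end.

Fixpoint bt_decode (g : GenTree.tree E) : option btree :=
  match g with
  | GenTree.Node _ [:: GenTree.Leaf e; l; r] =>
      if (bt_decode l, bt_decode r) is (Some l', Some r')
      then Some (BNode e l' r') else None
  | GenTree.Node _ [::] => Some BLeaf
  | _ => None
  end.

Lemma bt_encodeK : pcancel bt_encode bt_decode.
Proof. by elim=> //= e l -> r ->. Qed.

HB.instance Definition _ := Choice.copy btree (pcan_type bt_encodeK).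

Fixpoint bt_size (t : btree) : nat :=
  if t is BNode _ l r then (bt_size l + bt_size r).+1 else 0%N.

(* Leaves are numbered from left to right; bt_size counts the vertices, so a  *)
(* tree t has bt_size t + 1 leaves.                                           *)
Fixpoint bt_graft (t : btree) (i : nat) (s : btree) : btree :=
  match t with
  | BLeaf => s
  | BNode e l r =>
      if (i <= bt_size l)%N then BNode e (bt_graft l i s) r
      else BNode e l (bt_graft r (i - (bt_size l).+1) s)
  end.

Lemma bt_graft_size t i s : bt_size (bt_graft t i s) = (bt_size t + bt_size s)%N.
Proof. elim: t i => //= e l IHl r IHr i; case: ifP => _ /=; rewrite ?IHl ?IHr; lia. Qed.

Lemma bt_graftA t i s j u : (i <= bt_size t)%N -> (j <= bt_size s)%N ->
  bt_graft t i (bt_graft s j u) = bt_graft (bt_graft t i s) (i + j) u.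
Proof.
elim: t i => [|e l IHl r IHr] i /= hi hj.
  by have -> : i = 0%N by lia.
case: ifP => hil /=; rewrite ?bt_graft_size.
  by rewrite (_ : (i + j <= _)%N = true) ?IHl //; lia.
rewrite (_ : (i + j <= _)%N = false) ?IHr //; try lia.
by congr (BNode _ _ (bt_graft _ _ _)); lia.
Qed.

Lemma bt_graftAC t i k s u : (i < k)%N -> (k <= bt_size t)%N ->
  bt_graft (bt_graft t i s) (k + bt_size s) u = bt_graft (bt_graft t k u) i s.
Proof.
elim: t i k => [|e l IHl r IHr] i k /= ik hk; first lia.
case: (leqP i (bt_size l)) => hil; case: (leqP k (bt_size l)) => hkl /=;
  rewrite ?bt_graft_size; try lia.
- rewrite (_ : (k + _ <= _)%N = true); last lia.
  by rewrite (_ : (i <= _)%N = true) ?IHl //; lia.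
- rewrite (_ : (k + _ <= _)%N = false) ?hil; last lia.
  by congr (BNode _ _ (bt_graft _ _ _)); lia.
- rewrite (_ : (k + _ <= _)%N = false); last lia.
  rewrite leqNgt hil /= -IHr; try lia.
  by congr (BNode _ _ (bt_graft _ _ _)); lia.
Qed.

Lemma bt_graft1r t i : bt_graft t i BLeaf = t.
Proof. by elim: t i => //= e l IHl r IHr i; case: ifP; rewrite ?IHl ?IHr. Qed.

Record bt_of n := BtOf { bt_val :> btree; bt_valP : bt_size bt_val == n }.
HB.instance Definition _ n := [isSub for @bt_val n].
HB.instance Definition _ n := [Choice of bt_of n by <:].

Definition free_car (n : nat) : zmodType := {freeg (bt_of n) / int}.

Lemma bt_comp_subproof m n (i : 'I_m.+1) (t : bt_of m) (s : bt_of n) :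
  bt_size (bt_graft t i s) == (m + n)%N.
Proof. by rewrite bt_graft_size (eqP (bt_valP t)) (eqP (bt_valP s)). Qed.

Definition bt_comp m n i t s : bt_of (m + n) :=
  BtOf (@bt_comp_subproof m n i t s).

Definition free_unit : free_car 0 := << BtOf (eqxx (bt_size BLeaf)) >>.

Definition free_comp m n (i : 'I_m.+1) (x : free_car m) (y : free_car n) :
    free_car (m + n) :=
  fglift (fun t => fglift (fun s => << bt_comp i t s >> : {freeg _ / int}) y) x.

Lemma free_compU m n (i : 'I_m.+1) (t : bt_of m) (s : bt_of n) :
  free_comp i << t >> << s >> = << bt_comp i t s >>.
Proof. by rewrite /free_comp !fgliftU. Qed.

Lemma free_compBl m n (i : 'I_m.+1) (x y : free_car m) (z : free_car n) :
  free_comp i (x - y) z = free_comp i x z - free_comp i y z.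
Proof. exact: fgliftB. Qed.

Lemma free_compBr m n (i : 'I_m.+1) (x : free_car m) (y z : free_car n) :
  free_comp i x (y - z) = free_comp i x y - free_comp i x z.
Proof.
rewrite /free_comp -fglift_sub; congr fglift.
by apply/funext => t; rewrite fgliftB.
Qed.

Lemma free_comp0l m n (i : 'I_m.+1) (z : free_car n) :
  free_comp i (0 : free_car m) z = 0.
Proof. by rewrite -{1}(subrr 0) free_compBl subrr. Qed.

Lemma free_comp0r m n (i : 'I_m.+1) (x : free_car m) :
  free_comp i x (0 : free_car n) = 0.
Proof. by rewrite -{1}(subrr 0) free_compBr subrr. Qed.

Lemma free_compDl m n (i : 'I_m.+1) (x y : free_car m) (z : free_car n) :
  free_comp i (x + y) z = free_comp i x z + free_comp i y z.
Proof. exact: fgliftD. Qed.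

Lemma free_compDr m n (i : 'I_m.+1) (x : free_car m) (y z : free_car n) :
  free_comp i x (y + z) = free_comp i x y + free_comp i x z.
Proof.
rewrite /free_comp -fglift_add; congr fglift.
by apply/funext => t; rewrite fgliftD.
Qed.

Lemma recastU m n (e : m = n) (t : bt_of m) (s : bt_of n) :
  t = s :> btree -> recast e (<< t >> : free_car m) = << s >>.
Proof. by case: n / e s => s /val_inj ->. Qed.

Lemma free_comp1l n (x : free_car n) : free_comp ord0 free_unit x = x.
Proof.
elim/freeg_basis_ind: x => [t||x y IHx IHy].
- by rewrite free_compU; congr (<< _ >>); apply: val_inj.
- exact: free_comp0r.
- by rewrite free_compBr IHx IHy.
Qed.

Lemma free_comp1r m (i : 'I_m.+1) (x : free_car m) :
  recast (P := free_car) (addn0 m) (free_comp i x free_unit) = x.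
Proof.
elim/freeg_basis_ind: x => [t||x y IHx IHy].
- by rewrite free_compU; apply: recastU; rewrite /= bt_graft1r.
- by rewrite free_comp0l recast0.
- by rewrite free_compBl recastB IHx IHy.
Qed.

Lemma free_compA m n p (i : 'I_m.+1) (j : 'I_n.+1)
    (x : free_car m) (y : free_car n) (z : free_car p) :
  recast (P := free_car) (addnA m n p) (free_comp i x (free_comp j y z)) =
  free_comp (inord (i + j)) (free_comp i x y) z.
Proof.
have ij : (i + j < (m + n).+1)%N by have := ltn_ord i; have := ltn_ord j; lia.
elim/freeg_basis_ind: x => [t||x x' IHx IHx'].
- elim/freeg_basis_ind: y => [s||y y' IHy IHy'].
  + elim/freeg_basis_ind: z => [u||z z' IHz IHz'].
    * rewrite !free_compU; apply: recastU; rewrite /= inordK // bt_graftA //.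
        by rewrite (eqP (bt_valP t)) -ltnS.
      by rewrite (eqP (bt_valP s)) -ltnS.
    * by rewrite !free_comp0r recast0.
    * by rewrite !free_compBr recastB IHz IHz'.
  + by rewrite !(free_comp0l, free_comp0r) recast0.
  + by rewrite !(free_compBl, free_compBr) recastB IHy IHy'.
- by rewrite !free_comp0l recast0.
- by rewrite !free_compBl recastB IHx IHx'.
Qed.

Lemma free_compAC m n p (i k : 'I_m.+1)
    (x : free_car m) (y : free_car n) (z : free_car p) : (i < k)%N ->
  recast (P := free_car) (addnAC m n p)
    (free_comp (inord (k + n)) (free_comp i x y) z) =
  free_comp (inord i) (free_comp k x z) y.
Proof.
move=> ik; have hk := ltn_ord k.
have kn : (k + n < (m + n).+1)%N by lia.
have ip : (i < (m + p).+1)%N by lia.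
elim/freeg_basis_ind: x => [t||x x' IHx IHx'].
- elim/freeg_basis_ind: y => [s||y y' IHy IHy'].
  + elim/freeg_basis_ind: z => [u||z z' IHz IHz'].
    * rewrite !free_compU; apply: recastU; rewrite /= !inordK //.
      have := @bt_graftAC t i k s u ik; rewrite (eqP (bt_valP s)); apply.
      by rewrite (eqP (bt_valP t)) -ltnS.
    * by rewrite !(free_comp0l, free_comp0r) recast0.
    * by rewrite !(free_compBl, free_compBr) recastB IHz IHz'.
  + by rewrite !(free_comp0l, free_comp0r) recast0.
  + by rewrite !(free_compBl, free_compBr) recastB IHy IHy'.
- by rewrite !free_comp0l recast0.
- by rewrite !free_compBl recastB IHx IHx'.
Qed.

Definition free_ns : nsOperad := @NsOperad free_car free_unit free_comp
  free_compDl free_compDr free_comp1l free_comp1r free_compA free_compAC.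

(* The generating operation of index 1 (that is, binary) attached to e : E.   *)
Definition corolla (e : E) : free_ns 1 :=
  << BtOf (eqxx (bt_size (BNode e BLeaf BLeaf))) >>.

End FreeNs.

Section QuotientNs.
Variables (P : nsOperad) (R : P 2 -> Prop).

(* The operadic ideal (R) generated by elements of arity 3. *)
Inductive in_ideal : forall n, P n -> Prop :=
| in_ideal_gen x : R x -> in_ideal x
| in_ideal0 n : in_ideal (0 : P n)
| in_idealB n (x y : P n) : in_ideal x -> in_ideal y -> in_ideal (x - y)
| in_ideal_compl m n (i : 'I_m.+1) (x : P m) (y : P n) :
    in_ideal x -> in_ideal (ns_comp i x y)
| in_ideal_compr m n (i : 'I_m.+1) (x : P m) (y : P n) :
    in_ideal y -> in_ideal (ns_comp i x y).

Definition ideal n : {pred P n} := fun x => `[< in_ideal x >].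

Lemma ideal_zmod_closed n : zmod_closed (@ideal n).
Proof.
split=> [|x y /asboolP hx /asboolP hy]; first exact/asboolP/in_ideal0.
exact/asboolP/in_idealB.
Qed.

HB.instance Definition _ n :=
  GRing.isZmodClosed.Build (P n) (@ideal n) (@ideal_zmod_closed n).

Definition quot_car (n : nat) : zmodType := Quotient.quot (@ideal n).

Local Open Scope quotient_scope.

Definition quot_comp m n (i : 'I_m.+1) (x : quot_car m) (y : quot_car n) :
  quot_car (m + n) := \pi_(Quotient.quot (@ideal (m + n))) (ns_comp i (repr x) (repr y)).

Lemma quot_piB n (x y : P n) :
  \pi_(Quotient.quot (@ideal n)) (x - y) = \pi_(Quotient.quot (@ideal n)) x - \pi y.
Proof. exact: raddfB. Qed.

Lemma quot_pi0 n (x y : P n) : in_ideal (x - y) -> x = y %[mod (Quotient.quot (@ideal n))].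
Proof. by move=> h; apply/eqP; rewrite -Quotient.idealrBE; apply/asboolP. Qed.

Lemma quot_compE m n (i : 'I_m.+1) (x : P m) (y : P n) :
  quot_comp i (\pi_(Quotient.quot (@ideal m)) x) (\pi_(Quotient.quot (@ideal n)) y) =
  \pi_(Quotient.quot (@ideal (m + n))) (ns_comp i x y).
Proof.
have hx : in_ideal (repr (\pi_(Quotient.quot (@ideal m)) x) - x).
  apply/asboolP; change (repr (\pi_(Quotient.quot (@ideal m)) x) - x \in @ideal m).
  by rewrite Quotient.idealrBE reprK.
have hy : in_ideal (repr (\pi_(Quotient.quot (@ideal n)) y) - y).
  apply/asboolP; change (repr (\pi_(Quotient.quot (@ideal n)) y) - y \in @ideal n).
  by rewrite Quotient.idealrBE reprK.
apply: quot_pi0; set x' := repr _ in hx *; set y' := repr _ in hy *.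
have := in_idealB (in_ideal_compl i y' hx) (in_ideal_compr i (- x) hy).
rewrite -[x' - x]/(x' + - x) ns_compDl.
rewrite -[y' - y]/(y' + - y) ns_compDr opprD addrA addrK => h.
have -> // : - ns_comp i x y = - ns_comp i (- x) (- y).
have e : ns_comp i (- x) (- y) + ns_comp i (- x) y = 0.
  rewrite -ns_compDr addNr; apply: (addrI (ns_comp i (- x) 0)).
  by rewrite -ns_compDr !addr0.
have e' : ns_comp i (- x) y + ns_comp i x y = 0.
  rewrite -ns_compDl addNr; apply: (addrI (ns_comp i 0 y)).
  by rewrite -ns_compDl !addr0.
by rewrite (addr0_eq e) -(addr0_eq e') opprK.
Qed.

Definition quot_unit : quot_car 0 := \pi_(Quotient.quot (@ideal 0)) (ns_unit P).

Lemma quot_piD n (x y : P n) :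
  \pi_(Quotient.quot (@ideal n)) (x + y) = \pi_(Quotient.quot (@ideal n)) x + \pi y.
Proof. exact: raddfD. Qed.

Lemma recast_pi m n (e : m = n) (x : P m) :
  recast (P := quot_car) e (\pi_(Quotient.quot (@ideal m)) x) = \pi_(Quotient.quot (@ideal n)) (recast e x).
Proof. by case: n / e. Qed.

Lemma quot_surj n (x : quot_car n) :
  exists y, x = \pi_(Quotient.quot (@ideal n)) y.
Proof. by exists (repr x); rewrite reprK. Qed.

Lemma quot_compDl m n (i : 'I_m.+1) (x y : quot_car m) (z : quot_car n) :
  quot_comp i (x + y) z = quot_comp i x z + quot_comp i y z.
Proof.
have [[x' ->] [y' ->] [z' ->]] := And3 (quot_surj x) (quot_surj y) (quot_surj z).
by rewrite -quot_piD !quot_compE -quot_piD ns_compDl.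
Qed.

Lemma quot_compDr m n (i : 'I_m.+1) (x : quot_car m) (y z : quot_car n) :
  quot_comp i x (y + z) = quot_comp i x y + quot_comp i x z.
Proof.
have [[x' ->] [y' ->] [z' ->]] := And3 (quot_surj x) (quot_surj y) (quot_surj z).
by rewrite -quot_piD !quot_compE -quot_piD ns_compDr.
Qed.

Lemma quot_comp1l n (x : quot_car n) : quot_comp ord0 quot_unit x = x.
Proof.
by have [x' ->] := quot_surj x; rewrite quot_compE ns_comp1l.
Qed.

Lemma quot_comp1r m (i : 'I_m.+1) (x : quot_car m) :
  recast (P := quot_car) (addn0 m) (quot_comp i x quot_unit) = x.
Proof.
by have [x' ->] := quot_surj x; rewrite quot_compE recast_pi ns_comp1r.
Qed.

Lemma quot_compA m n p (i : 'I_m.+1) (j : 'I_n.+1)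
    (x : quot_car m) (y : quot_car n) (z : quot_car p) :
  recast (P := quot_car) (addnA m n p) (quot_comp i x (quot_comp j y z)) =
  quot_comp (inord (i + j)) (quot_comp i x y) z.
Proof.
have [[x' ->] [y' ->] [z' ->]] := And3 (quot_surj x) (quot_surj y) (quot_surj z).
by rewrite !quot_compE recast_pi ns_compA.
Qed.

Lemma quot_compAC m n p (i k : 'I_m.+1)
    (x : quot_car m) (y : quot_car n) (z : quot_car p) : (i < k)%N ->
  recast (P := quot_car) (addnAC m n p)
    (quot_comp (inord (k + n)) (quot_comp i x y) z) =
  quot_comp (inord i) (quot_comp k x z) y.
Proof.
move=> ik.
have [[x' ->] [y' ->] [z' ->]] := And3 (quot_surj x) (quot_surj y) (quot_surj z).
by rewrite !quot_compE recast_pi (ns_compAC _ _ _ ik).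
Qed.

Definition quot_ns : nsOperad := @NsOperad quot_car quot_unit quot_comp
  quot_compDl quot_compDr quot_comp1l quot_comp1r quot_compA quot_compAC.

End QuotientNs.

(* In x o_i y, with x of index m and y of index n, input j is either an input *)
(* a != i of x (inl a) or an input b of y (inr b).                            *)
Definition slot m n (i : 'I_m.+1) (j : 'I_(m + n).+1) : 'I_m.+1 + 'I_n.+1 :=
  if (j < i)%N then inl (inord j)
  else if (j <= i + n)%N then inr (inord (j - i)) else inl (inord (j - n)).

Definition unslot m n (i : 'I_m.+1) (s : 'I_m.+1 + 'I_n.+1) : 'I_(m + n).+1 :=
  match s with
  | inl a => inord (if (a < i)%N then a : nat else (a + n)%N)
  | inr b => inord (i + b)
  end.

Variant slot_spec m n (i : 'I_m.+1) (j : 'I_(m + n).+1) :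
    'I_m.+1 + 'I_n.+1 -> Type :=
| SlotBelow (a : 'I_m.+1) of (a < i)%N & j = a :> nat : slot_spec i j (inl a)
| SlotInside (b : 'I_n.+1) of j = (i + b)%N :> nat : slot_spec i j (inr b)
| SlotAbove (a : 'I_m.+1) of (i < a)%N & j = (a + n)%N :> nat : slot_spec i j (inl a).

Lemma slotP m n (i : 'I_m.+1) (j : 'I_(m + n).+1) : slot_spec i j (slot i j).
Proof.
have hi := ltn_ord i; have hj := ltn_ord j; rewrite /slot.
case: ifP => ji; first by constructor; rewrite inordK //; lia.
by case: ifP => jin; constructor; rewrite inordK //; lia.
Qed.

Lemma unslotl m n (i a : 'I_m.+1) :
  unslot (n := n) i (inl a) = (if (a < i)%N then a : nat else a + n)%N :> nat.
Proof. by rewrite /= inordK //; have := ltn_ord a; case: ifP; lia. Qed.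

Lemma unslotr m n (i : 'I_m.+1) (b : 'I_n.+1) :
  unslot i (inr b) = (i + b)%N :> nat.
Proof. by rewrite /= inordK //; have := ltn_ord b; have := ltn_ord i; lia. Qed.

Lemma slotK m n (i : 'I_m.+1) : cancel (@slot m n i) (unslot i).
Proof.
move=> j; apply: ord_inj; case: slotP => [a ai ja|b jb|a ai ja].
- by rewrite unslotl ai.
- by rewrite unslotr.
- by rewrite unslotl ltnNge (ltnW ai).
Qed.

Lemma slot_neq m n (i a : 'I_m.+1) (j : 'I_(m + n).+1) :
  slot i j = inl a -> a != i.
Proof.
case: slotP => [b bi _ [<-]|//|b bi _ [<-]]; apply: contraTneq bi => ->;
  by rewrite ltnn.
Qed.

Lemma unslotlK m n (i a : 'I_m.+1) : a != i ->
  slot i (unslot (n := n) i (inl a)) = inl a.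
Proof.
rewrite -val_eqE /= => ai; have := unslotl n i a.
case: slotP => [b bi ->|b ->|b bi ->]; case: ltngtP ai => // ai _ h;
  try (by congr inl; apply: ord_inj; lia);
  have := ltn_ord b; lia.
Qed.

Lemma unslotrK m n (i : 'I_m.+1) (b : 'I_n.+1) : slot i (unslot i (inr b)) = inr b.
Proof.
have := unslotr i b; have := ltn_ord b.
case: slotP => [c ci ->|c ->|c ci ->] hb h; try lia.
by congr inr; apply: ord_inj; lia.
Qed.

(* The composite s o_i t of permutations: the inputs of a composite           *)
(* (x . s) o_i (y . t) are fed to those of x o_(s i) y through s o_i t.       *)
Definition pcomp_fun m n (i : 'I_m.+1) (s : 'S_m.+1) (t : 'S_n.+1)
    (j : 'I_(m + n).+1) : 'I_(m + n).+1 :=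
  unslot (s i)
    (match slot i j with inl a => inl (s a) | inr b => inr (t b) end).

Lemma pcomp_inj m n (i : 'I_m.+1) (s : 'S_m.+1) (t : 'S_n.+1) :
  injective (pcomp_fun i s t).
Proof.
move=> j k; rewrite /pcomp_fun -{2}(slotK i j) -{2}(slotK i k).
case ej: (slot i j) => [a|b]; case ek: (slot i k) => [c|d] /(congr1 (slot (s i)));
  rewrite ?unslotrK ?unslotlK ?(inj_eq perm_inj) ?(slot_neq ej) ?(slot_neq ek) //.
- by case=> /perm_inj ->.
- by case=> /perm_inj ->.
Qed.

Definition pcomp m n (i : 'I_m.+1) (s : 'S_m.+1) (t : 'S_n.+1) : 'S_(m + n).+1 :=
  perm (@pcomp_inj m n i s t).

Lemma pcompl m n (i a : 'I_m.+1) (s : 'S_m.+1) (t : 'S_n.+1) : a != i ->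
  pcomp i s t (unslot i (inl a)) = unslot (s i) (inl (s a)).
Proof. by move=> ai; rewrite permE /pcomp_fun unslotlK. Qed.

Lemma pcompr m n (i : 'I_m.+1) (b : 'I_n.+1) (s : 'S_m.+1) (t : 'S_n.+1) :
  pcomp i s t (unslot i (inr b)) = unslot (s i) (inr (t b)).
Proof. by rewrite permE /pcomp_fun unslotrK. Qed.

Variant slot_view m n (i : 'I_m.+1) (j : 'I_(m + n).+1) : Prop :=
| SlotOuter (a : 'I_m.+1) of a != i & j = unslot i (inl a)
| SlotInner (b : 'I_n.+1) of j = unslot i (inr b).

Lemma slotV m n (i : 'I_m.+1) (j : 'I_(m + n).+1) : slot_view i j.
Proof.
rewrite -(slotK i j); case e: (slot i j) => [a|b]; last exact: SlotInner.
exact: SlotOuter (slot_neq e) erefl.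
Qed.

Lemma pcompM m n (i : 'I_m.+1) (s s' : 'S_m.+1) (t t' : 'S_n.+1) :
  pcomp i (s' * s)%g (t' * t)%g = (pcomp i s' t' * pcomp (s' i) s t)%g.
Proof.
apply/permP => j; rewrite permM; case: (slotV i j) => [a ai ->|b ->].
  by rewrite !pcompl ?(inj_eq perm_inj) // !permM.
by rewrite !pcompr !permM.
Qed.

Lemma pcomp1 m n (i : 'I_m.+1) : pcomp i 1%g (1%g : 'S_n.+1) = 1%g.
Proof.
apply/permP => j; rewrite perm1; case: (slotV i j) => [a ai ->|b ->].
  by rewrite pcompl // !perm1.
by rewrite pcompr !perm1.
Qed.

Definition recast_perm m n (e : m = n) (s : 'S_m.+1) : 'S_n.+1 :=
  ecast k 'S_k.+1 e s.

Lemma recast_permE m n (e : m = n) (s : 'S_m.+1) (j : 'I_m.+1) (k : 'I_n.+1) :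
  j = k :> nat -> recast_perm e s k = s j :> nat.
Proof. by case: n / e k => k /ord_inj ->. Qed.

Lemma pcomp1l n (t : 'S_n.+1) : pcomp ord0 (1%g : 'S_1) t = t.
Proof.
apply/permP => j; case: (slotV ord0 j) => [a|b ->].
  by rewrite [a]ord1 eqxx.
rewrite pcompr; apply: ord_inj; rewrite unslotr perm1 /=.
by rewrite !add0n inord_val.
Qed.

Lemma pcomp1r m (i : 'I_m.+1) (s : 'S_m.+1) :
  recast_perm (addn0 m) (pcomp i s (1%g : 'S_1)) = s.
Proof.
apply/permP => j; apply: ord_inj.
have [->|ji] := eqVneq j i.
  rewrite (@recast_permE _ _ _ _ (unslot i (inr ord0))) ?unslotr ?addn0 //.
  by rewrite pcompr unslotr perm1 addn0.
rewrite (@recast_permE _ _ _ _ (unslot i (inl j))).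
  by rewrite pcompl // unslotl addn0; case: ifP.
by rewrite unslotl addn0; case: ifP.
Qed.

Lemma unslotE m n (i : 'I_m.+1) x (j : 'I_(m + n).+1) :
  unslot i x = j :> nat -> j = unslot i x.
Proof. by move=> e; apply: ord_inj. Qed.

Lemma pcompA m n p (i : 'I_m.+1) (j : 'I_n.+1)
    (s : 'S_m.+1) (t : 'S_n.+1) (u : 'S_p.+1) :
  recast_perm (addnA m n p) (pcomp i s (pcomp j t u)) =
  pcomp (inord (i + j)) (pcomp i s t) u.
Proof.
have hi := ltn_ord i; have hj := ltn_ord j.
have eij : inord (i + j) = unslot i (inr j) :> 'I_(m + n).+1 by [].
have sij : pcomp i s t (inord (i + j)) = unslot (s i) (inr (t j)).
  by rewrite eij pcompr.
apply/permP => k; apply: ord_inj; rewrite /=.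
case: (slotV (inord (i + j)) k) => [k' k'ij ->|c ->].
  rewrite pcompl // unslotl sij unslotr.
  move: k'ij; rewrite eij; case: (slotV i k') => [a ai ->|b ->] k'ij.
    rewrite (@recast_permE _ _ _ _ (unslot i (inl a))).
      rewrite !pcompl // !unslotl.
      have : s a != s i by rewrite (inj_eq perm_inj).
      by rewrite -val_eqE /=; have := ltn_ord (t j); do ?case: ifP; lia.
    rewrite !unslotl unslotr; move: ai; rewrite -val_eqE /=.
    by do ?case: ifP; lia.
  have bj : b != j by apply: contraNneq k'ij => ->.
  rewrite (@recast_permE _ _ _ _ (unslot i (inr (unslot j (inl b))))).
    rewrite pcompr pcompr pcompl // unslotr unslotr unslotl.
    by do ?case: ifP; lia.
  rewrite !(unslotr, unslotl).
  by do ?case: ifP; lia.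
rewrite pcompr sij eij !unslotr.
rewrite (@recast_permE _ _ _ _ (unslot i (inr (unslot j (inr c))))).
  by rewrite !pcompr !unslotr; lia.
by rewrite !unslotr; lia.
Qed.

Lemma pcompAC m n p (i k : 'I_m.+1)
    (s : 'S_m.+1) (t : 'S_n.+1) (u : 'S_p.+1) : (i < k)%N ->
  recast_perm (addnAC m n p) (pcomp (inord (k + n)) (pcomp i s t) u) =
  pcomp (inord i) (pcomp k s u) t.
Proof.
move=> ik; have hi := ltn_ord i; have hk := ltn_ord k.
have ni : k != i by rewrite -val_eqE /=; lia.
have nk : i != k by rewrite eq_sym.
have ek : inord (k + n) = unslot i (inl k) :> 'I_(m + n).+1.
  by apply: ord_inj; rewrite unslotl inordK; do ?case: ifP; lia.
have ei : inord i = unslot k (inl i) :> 'I_(m + p).+1.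
  by apply: ord_inj; rewrite unslotl inordK; do ?case: ifP; lia.
have sk : pcomp i s t (inord (k + n)) = unslot (s i) (inl (s k)).
  by rewrite ek pcompl.
have si : pcomp k s u (inord i) = unslot (s k) (inl (s i)).
  by rewrite ei pcompl.
have ns : (s k == s i :> nat) = false by rewrite (inj_eq (@ord_inj _)) (inj_eq perm_inj) (negPf ni).
apply/permP => q; apply: ord_inj; rewrite /=.
case: (slotV (inord i) q) => [q' qi ->|b ->].
  rewrite pcompl // unslotl si unslotl.
  move: qi; rewrite ei; case: (slotV k q') => [a ak ->|c ->] qi.
    have ai : a != i by apply: contraNneq qi => ->.
    have ak' : unslot (n := n) i (inl a) != inord (k + n).
      apply: contraNneq ak => /(congr1 (slot i)).
      by rewrite ek !unslotlK // => -[->].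
    rewrite (@recast_permE _ _ _ _ (unslot (inord (k + n)) (inl (unslot i (inl a))))).
      rewrite pcompl // sk !pcompl // !unslotl.
      have nsi : (s a == s i :> nat) = false.
        by rewrite (inj_eq (@ord_inj _)) (inj_eq perm_inj) (negPf ai).
      have nsk : (s a == s k :> nat) = false.
        by rewrite (inj_eq (@ord_inj _)) (inj_eq perm_inj) (negPf ak).
      by do ?case: ifP; lia.
    move: ak ai; rewrite ek !unslotl -!val_eqE /=.
    by do ?case: ifP; lia.
  rewrite (@recast_permE _ _ _ _ (unslot (inord (k + n)) (inr c))).
    rewrite !pcompr sk !unslotr !unslotl.
    by have := ltn_ord (u c); do ?case: ifP; lia.
  rewrite ek !(unslotr, unslotl).
  by have := ltn_ord c; do ?case: ifP; lia.
rewrite pcompr si unslotr unslotl.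
have bk : unslot i (inr b) != inord (k + n).
  by apply/eqP => /(congr1 (slot i)); rewrite ek unslotrK unslotlK.
rewrite (@recast_permE _ _ _ _ (unslot (inord (k + n)) (inl (unslot i (inr b))))).
  rewrite pcompl // sk pcompr !(unslotl, unslotr).
  by have := ltn_ord (t b); do ?case: ifP; lia.
rewrite ek ei !(unslotr, unslotl).
by have := ltn_ord b; do ?case: ifP; lia.

Qed.

(* act s x is x . s, the operation whose input j is input s j of x. It is a   *)
(* right action for the composition of functions; the product of 'S_n is      *)
(* written in the opposite order.                                             *)
Record operad := Operad {
  op_car :> nat -> zmodType;
  op_unit : op_car 0;
  op_comp : forall m n, 'I_m.+1 -> op_car m -> op_car n -> op_car (m + n);
  op_act : forall n, 'S_n.+1 -> op_car n -> op_car n;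
  op_compDl : forall m n (i : 'I_m.+1) (x y : op_car m) (z : op_car n),
    op_comp i (x + y) z = op_comp i x z + op_comp i y z;
  op_compDr : forall m n (i : 'I_m.+1) (x : op_car m) (y z : op_car n),
    op_comp i x (y + z) = op_comp i x y + op_comp i x z;
  op_actD : forall n (s : 'S_n.+1) (x y : op_car n),
    op_act s (x + y) = op_act s x + op_act s y;
  op_act1 : forall n (x : op_car n), op_act 1%g x = x;
  op_actM : forall n (s t : 'S_n.+1) (x : op_car n),
    op_act t (op_act s x) = op_act (t * s)%g x;
  op_comp_act : forall m n (i : 'I_m.+1) (s : 'S_m.+1) (t : 'S_n.+1)
      (x : op_car m) (y : op_car n),
    op_comp i (op_act s x) (op_act t y) =
    op_act (pcomp i s t) (op_comp (s i) x y);
  op_comp1l : forall n (x : op_car n), op_comp ord0 op_unit x = x;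
  op_comp1r : forall m (i : 'I_m.+1) (x : op_car m),
    recast (addn0 m) (op_comp i x op_unit) = x;
  op_compA : forall m n p (i : 'I_m.+1) (j : 'I_n.+1)
      (x : op_car m) (y : op_car n) (z : op_car p),
    recast (addnA m n p) (op_comp i x (op_comp j y z)) =
    op_comp (inord (i + j)) (op_comp i x y) z;
  op_compAC : forall m n p (i k : 'I_m.+1)
      (x : op_car m) (y : op_car n) (z : op_car p), (i < k)%N ->
    recast (P := op_car) (addnAC m n p)
      (op_comp (inord (k + n)) (op_comp i x y) z) =
    op_comp (inord i) (op_comp k x z) y
}.

Section Regular.
Variable P : nsOperad.

Definition reg_car (n : nat) : zmodType := {ffun 'S_n.+1 -> P n}.

(* The pure tensor p (x) s stands for the operation whose input j is plugged  *)
(* into input s j of p.                                                       *)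
Definition reg_tens n (p : P n) (s : 'S_n.+1) : reg_car n :=
  [ffun r => if r == s then p else 0].

Definition reg_comp m n (i : 'I_m.+1) (x : reg_car m) (y : reg_car n) :
    reg_car (m + n) :=
  \sum_(s : 'S_m.+1) \sum_(t : 'S_n.+1)
    reg_tens (ns_comp (s i) (x s) (y t)) (pcomp i s t).

Definition reg_act n (t : 'S_n.+1) (x : reg_car n) : reg_car n :=
  \sum_(s : 'S_n.+1) reg_tens (x s) (t * s)%g.

Definition reg_unit : reg_car 0 := reg_tens (ns_unit P) 1%g.

Lemma reg_tens0 n (s : 'S_n.+1) : reg_tens (0 : P n) s = 0.
Proof. by apply/ffunP => r; rewrite !ffunE if_same. Qed.

Lemma reg_tensD n (p q : P n) (s : 'S_n.+1) :
  reg_tens (p + q) s = reg_tens p s + reg_tens q s.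
Proof. by apply/ffunP => r; rewrite !ffunE; case: eqP => _; rewrite ?addr0. Qed.

Lemma reg_tens_ind n (Q : reg_car n -> Prop) :
  (forall p s, Q (reg_tens p s)) -> (forall x y, Q x -> Q y -> Q (x + y)) ->
  forall x, Q x.
Proof.
move=> QT QD x; have -> : x = \sum_(s : 'S_n.+1) reg_tens (x s) s.
  apply/ffunP => r; rewrite sum_ffunE (bigD1 r) //= ffunE eqxx big1 ?addr0 //.
  by move=> s sr; rewrite ffunE eq_sym (negPf sr).
elim/big_ind: _ => //; first by rewrite -(reg_tens0 1%g).
Qed.

Lemma reg_compDl m n (i : 'I_m.+1) (x y : reg_car m) (z : reg_car n) :
  reg_comp i (x + y) z = reg_comp i x z + reg_comp i y z.
Proof.
rewrite /reg_comp -big_split /=; apply: eq_bigr => s _.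
by rewrite -big_split; apply: eq_bigr => t _; rewrite ffunE ns_compDl reg_tensD.
Qed.

Lemma reg_compDr m n (i : 'I_m.+1) (x : reg_car m) (y z : reg_car n) :
  reg_comp i x (y + z) = reg_comp i x y + reg_comp i x z.
Proof.
rewrite /reg_comp -big_split /=; apply: eq_bigr => s _.
by rewrite -big_split; apply: eq_bigr => t _; rewrite ffunE ns_compDr reg_tensD.
Qed.

Lemma reg_actD n (s : 'S_n.+1) (x y : reg_car n) :
  reg_act s (x + y) = reg_act s x + reg_act s y.
Proof.
by rewrite /reg_act -big_split; apply: eq_bigr => t _; rewrite ffunE reg_tensD.
Qed.

Lemma ns_comp0l m n (i : 'I_m.+1) (y : P n) : ns_comp i (0 : P m) y = 0.
Proof.
apply: (addrI (ns_comp i (0 : P m) y)).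
by rewrite -ns_compDl !addr0.
Qed.

Lemma ns_comp0r m n (i : 'I_m.+1) (x : P m) : ns_comp i x (0 : P n) = 0.
Proof.
apply: (addrI (ns_comp i x (0 : P n))).
by rewrite -ns_compDr !addr0.
Qed.

Lemma reg_comp_tens m n (i : 'I_m.+1) (p : P m) (q : P n) s t :
  reg_comp i (reg_tens p s) (reg_tens q t) =
  reg_tens (ns_comp (s i) p q) (pcomp i s t).
Proof.
rewrite /reg_comp (bigD1 s) //= [X in _ + X]big1 ?addr0 => [|s' ss'].
  rewrite (bigD1 t) //= [X in _ + X]big1 ?addr0 => [|t' tt'].
    by rewrite !ffunE !eqxx.
  by rewrite [reg_tens q t t']ffunE (negPf tt') ns_comp0r reg_tens0.
apply: big1 => t' _.
by rewrite [reg_tens p s s']ffunE (negPf ss') ns_comp0l reg_tens0.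
Qed.

Lemma reg_act_tens n (t : 'S_n.+1) (p : P n) s :
  reg_act t (reg_tens p s) = reg_tens p (t * s)%g.
Proof.
rewrite /reg_act (bigD1 s) //= [X in _ + X]big1 ?addr0 => [|s' ss'].
  by rewrite ffunE eqxx.
by rewrite [reg_tens p s s']ffunE (negPf ss') reg_tens0.
Qed.

Lemma recastD (Q : nat -> zmodType) m n (e : m = n) (x y : Q m) :
  recast e (x + y) = recast e x + recast e y.
Proof. by case: n / e. Qed.

Lemma recastK (Q : nat -> zmodType) m n (e : m = n) (e' : n = m) (x : Q m) :
  recast e' (recast e x) = x.
Proof. by case: n / e e' => e; rewrite (eq_irrelevance e erefl). Qed.

Lemma recast_tens m n (e : m = n) (p : P m) s :
  recast (P := reg_car) e (reg_tens p s) =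
  reg_tens (recast e p) (recast_perm e s).
Proof. by case: n / e. Qed.

Lemma reg_act1 n (x : reg_car n) : reg_act 1%g x = x.
Proof.
elim/reg_tens_ind: x => [p s|x y IHx IHy]; first by rewrite reg_act_tens mul1g.
by rewrite reg_actD IHx IHy.
Qed.

Lemma reg_actM n (s t : 'S_n.+1) (x : reg_car n) :
  reg_act t (reg_act s x) = reg_act (t * s)%g x.
Proof.
elim/reg_tens_ind: x => [p u|x y IHx IHy]; first by rewrite !reg_act_tens mulgA.
by rewrite !reg_actD IHx IHy.
Qed.

Lemma reg_comp_act m n (i : 'I_m.+1) (s : 'S_m.+1) (t : 'S_n.+1)
    (x : reg_car m) (y : reg_car n) :
  reg_comp i (reg_act s x) (reg_act t y) =
  reg_act (pcomp i s t) (reg_comp (s i) x y).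
Proof.
elim/reg_tens_ind: x => [p s'|x x' IHx IHx'].
  elim/reg_tens_ind: y => [q t'|y y' IHy IHy'].
    by rewrite !(reg_act_tens, reg_comp_tens) pcompM permM.
  by rewrite !(reg_actD, reg_compDr) IHy IHy'.
by rewrite !(reg_actD, reg_compDl) IHx IHx'.
Qed.

Lemma reg_comp1l n (x : reg_car n) : reg_comp ord0 reg_unit x = x.
Proof.
elim/reg_tens_ind: x => [p s|x y IHx IHy]; last by rewrite reg_compDr IHx IHy.
by rewrite reg_comp_tens perm1 ns_comp1l pcomp1l.
Qed.

Lemma reg_comp1r m (i : 'I_m.+1) (x : reg_car m) :
  recast (P := reg_car) (addn0 m) (reg_comp i x reg_unit) = x.
Proof.
elim/reg_tens_ind: x => [p s|x y IHx IHy].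
  by rewrite reg_comp_tens recast_tens ns_comp1r pcomp1r.
by rewrite reg_compDl recastD IHx IHy.
Qed.

Lemma reg_compA m n p (i : 'I_m.+1) (j : 'I_n.+1)
    (x : reg_car m) (y : reg_car n) (z : reg_car p) :
  recast (P := reg_car) (addnA m n p) (reg_comp i x (reg_comp j y z)) =
  reg_comp (inord (i + j)) (reg_comp i x y) z.
Proof.
elim/reg_tens_ind: x => [a s|x x' IHx IHx'].
  elim/reg_tens_ind: y => [b t|y y' IHy IHy'].
    elim/reg_tens_ind: z => [c u|z z' IHz IHz'].
      rewrite !reg_comp_tens recast_tens ns_compA pcompA.
      congr (reg_tens (ns_comp _ _ _) _); rewrite -[inord (i + j)]/(unslot i (inr j)).
      by rewrite pcompr.
    by rewrite !reg_compDr recastD IHz IHz'.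
  by rewrite !(reg_compDr, reg_compDl) recastD IHy IHy'.
by rewrite !reg_compDl recastD IHx IHx'.
Qed.

Lemma reg_compAC m n p (i k : 'I_m.+1)
    (x : reg_car m) (y : reg_car n) (z : reg_car p) : (i < k)%N ->
  recast (P := reg_car) (addnAC m n p)
    (reg_comp (inord (k + n)) (reg_comp i x y) z) =
  reg_comp (inord i) (reg_comp k x z) y.
Proof.
move=> ik.
have ni : k != i by rewrite -val_eqE /=; lia.
have ek : inord (k + n) = unslot i (inl k) :> 'I_(m + n).+1.
  apply: ord_inj; have hk := ltn_ord k.
  by rewrite unslotl inordK; do ?case: ifP; lia.
have ei : inord i = unslot k (inl i) :> 'I_(m + p).+1.
  apply: ord_inj; have hk := ltn_ord k.
  by rewrite unslotl inordK; do ?case: ifP; lia.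
elim/reg_tens_ind: x => [a s|x x' IHx IHx'].
  elim/reg_tens_ind: y => [b t|y y' IHy IHy'].
    elim/reg_tens_ind: z => [c u|z z' IHz IHz'].
      rewrite !reg_comp_tens recast_tens pcompAC //; congr (reg_tens _ _).
      rewrite ek ei !pcompl //; last by rewrite eq_sym.
      have : s k != s i by rewrite (inj_eq perm_inj).
      rewrite -val_eqE neq_ltn /= => /orP[] sik.
        rewrite /unslot sik ltnNge (ltnW sik) /=.
        by rewrite -(ns_compAC _ _ _ sik) recastK.
      by rewrite /unslot sik ltnNge (ltnW sik) /= ns_compAC.
    by rewrite !(reg_compDr, reg_compDl) recastD IHz IHz'.
  by rewrite !(reg_compDr, reg_compDl) recastD IHy IHy'.
by rewrite !reg_compDl recastD IHx IHx'.
Qed.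

Definition regular_operad : operad := @Operad reg_car reg_unit reg_comp reg_act
  reg_compDl reg_compDr reg_actD reg_act1 reg_actM reg_comp_act
  reg_comp1l reg_comp1r reg_compA reg_compAC.

End Regular.

(* V' is the free module on the finite set of generators; R' is a submodule   *)
(* of F(V')(3).                                                               *)
Record quadratic_data := QuadraticData {
  generators : finType;
  relators : zmodClosed (free_ns generators 2)
}.

Definition quadratic_ns (Q : quadratic_data) : nsOperad :=
  quot_ns (P := free_ns (generators Q)) (fun x => x \in relators Q).

Definition quadratic_operad (Q : quadratic_data) : operad :=
  regular_operad (quadratic_ns Q).

Section Products.
Variables E E' : finType.

(* mu o_1 nu = mu(nu(x, y), z) and mu o_2 nu = mu(x, nu(y, z)). *)
Definition comp1 (E : choiceType) (x y : free_ns E 1) : free_ns E 2 :=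
  ns_comp (m := 1) (n := 1) ord0 x y.
Definition comp2 (E : choiceType) (x y : free_ns E 1) : free_ns E 2 :=
  ns_comp (m := 1) (n := 1) ord_max x y.

(* F(V')(3) (x) F(W')(3), free on the pairs of basis elements *)
Definition tensor3 : zmodType := {freeg (bt_of E 2 * bt_of E' 2)%type / int}.

Definition tens (x : free_ns E 2) (y : free_ns E' 2) : tensor3 :=
  fglift (fun t => fglift (fun u => << (t, u) >> : {freeg _ / int}) y) x.

Fixpoint bt_map (A B : choiceType) (f : A -> B) (t : btree A) : btree B :=
  if t is BNode e l r then BNode (f e) (bt_map f l) (bt_map f r) else BLeaf B.

Lemma bt_map_size (A B : choiceType) (f : A -> B) t : bt_size (bt_map f t) = bt_size t.
Proof. by elim: t => //= e l -> r ->. Qed.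

Lemma bt_map_subproof (A B : choiceType) (f : A -> B) n (t : bt_of A n) :
  bt_size (bt_map f t) == n.
Proof. by rewrite bt_map_size bt_valP. Qed.

Definition bt_of_map (A B : choiceType) (f : A -> B) n (t : bt_of A n) : bt_of B n :=
  BtOf (bt_map_subproof f t).

(* F(V' (x) W')(3) -> F(V')(3) (x) F(W')(3); see Phi_comp. *)
Definition Phi (x : free_ns (E * E')%type 2) : tensor3 :=
  fglift (fun t => << (bt_of_map fst t, bt_of_map snd t) >> : {freeg _ / int}) x.

(* F(V')(3) (x) F(W')(3) -> F(V' (x) W')(3); see Psi_comp. *)
Definition Psi_basis (t : btree E) (u : btree E') : free_ns (E * E')%type 2 :=
  match t, u with
  | BNode m (BNode v BLeaf BLeaf) BLeaf, BNode m' (BNode v' BLeaf BLeaf) BLeaf =>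
      comp1 (corolla (m, m')) (corolla (v, v'))
  | BNode m BLeaf (BNode v BLeaf BLeaf), BNode m' BLeaf (BNode v' BLeaf BLeaf) =>
      - comp2 (corolla (m, m')) (corolla (v, v'))
  | _, _ => 0
  end.

Definition Psi (x : tensor3) : free_ns (E * E')%type 2 :=
  fglift (fun tu : (bt_of E 2 * bt_of E' 2)%type =>
            Psi_basis tu.1 tu.2 : {freeg _ / int}) x.

Lemma Phi_comp (i : 'I_2) m m' v v' :
  Phi (ns_comp (m := 1) (n := 1) i (corolla (m, m')) (corolla (v, v'))) =
  tens (ns_comp (m := 1) (n := 1) i (corolla m) (corolla v))
       (ns_comp (m := 1) (n := 1) i (corolla m') (corolla v')).
Proof.
rewrite /= !free_compU /Phi /tens !fgliftU; congr (<< _ >>).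
by congr pair; apply: val_inj => /=; case: ifP.
Qed.

Lemma Psi_comp (i j : 'I_2) m m' v v' :
  Psi (tens (ns_comp (m := 1) (n := 1) i (corolla m) (corolla v))
            (ns_comp (m := 1) (n := 1) j (corolla m') (corolla v'))) =
  if i == j then
    (ns_comp (m := 1) (n := 1) i (corolla (m, m')) (corolla (v, v'))) *~ (-1) ^+ i
  else 0.
Proof.
rewrite /= !free_compU /Psi /tens !fgliftU /=.
case: i j => [[|[|//]] hi] [[|[|//]] hj] //=.
  rewrite /comp1 /= free_compU expr0 mulr1z; congr (<< _ >>).
  exact: val_inj.
rewrite /comp2 /= free_compU expr1 mulrNz mulr1z; congr (- << _ >>).
exact: val_inj.
Qed.

End Products.

Section WhiteBlack.
Variables P Q : quadratic_data.
Local Notation E := (generators P).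
Local Notation E' := (generators Q).

(* R' (x) F(W')(3) + F(V')(3) (x) S' *)
Definition white_target : zmodClosed (tensor3 E E') :=
  span (fun z => exists x y,
    ((x \in relators P) || (y \in relators Q)) /\ z = tens x y).

Definition white_relators : {pred free_ns (E * E')%type 2} :=
  fun x => Phi x \in white_target.

Lemma white_zmod_closed : zmod_closed white_relators.
Proof.
split=> [|x y hx hy]; rewrite unfold_in /Phi.
  by rewrite fglift0 rpred0.
by rewrite fgliftB rpredB.
Qed.

HB.instance Definition _ :=
  GRing.isZmodClosed.Build (free_ns (E * E')%type 2) white_relators
    white_zmod_closed.

Definition white : quadratic_data :=
  @QuadraticData (E * E')%type white_relators.

(* Psi (R' (x) S') *)
Definition black_relators : zmodClosed (free_ns (E * E')%type 2) :=
  span (fun z => exists x y,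
    [/\ x \in relators P, y \in relators Q & z = Psi (tens x y)]).

Definition black : quadratic_data := @QuadraticData (E * E')%type black_relators.

End WhiteBlack.

(* Meant for n >= 1, and bracketed as P (P (... P)); the value at n = 0 is P. *)
Definition white_power (P : quadratic_data) (n : nat) : quadratic_data :=
  iter n.-1 (white P) P.
Definition black_power (P : quadratic_data) (n : nat) : quadratic_data :=
  iter n.-1 (black P) P.

Section Tri.
Definition tri_op (k : nat) : free_ns 'I_3 1 := corolla (inord k).
Local Notation "a 'o1' b" := (comp1 a b) (at level 45).
Local Notation "a 'o2' b" := (comp2 a b) (at level 45).

Definition TriDend_relations : seq (free_ns 'I_3 2) :=
  let prec := tri_op 0 in let succ := tri_op 1 in let dot := tri_op 2 in
  let star := prec + succ + dot in
  [:: prec o1 prec - prec o2 star;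
      prec o1 succ - succ o2 prec;
      succ o1 star - succ o2 succ;
      dot o1 succ - succ o2 dot;
      dot o1 prec - dot o2 succ;
      prec o1 dot - dot o2 prec;
      dot o1 dot - dot o2 dot].

Definition Trias_relations : seq (free_ns 'I_3 2) :=
  let dashv := tri_op 0 in let vdash := tri_op 1 in let perp := tri_op 2 in
  [:: dashv o1 dashv - dashv o2 dashv;
      dashv o2 dashv - dashv o2 vdash;
      dashv o2 vdash - dashv o2 perp;
      dashv o1 vdash - vdash o2 dashv;
      vdash o1 dashv - vdash o1 vdash;
      vdash o1 vdash - vdash o1 perp;
      vdash o1 perp - vdash o2 vdash;
      dashv o1 perp - perp o2 dashv;
      perp o1 dashv - perp o2 vdash;
      perp o1 vdash - vdash o2 perp;
      perp o1 perp - perp o2 perp].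

Definition TriDend : quadratic_data :=
  @QuadraticData 'I_3 (span (fun x => x \in TriDend_relations)).
Definition Trias : quadratic_data :=
  @QuadraticData 'I_3 (span (fun x => x \in Trias_relations)).

End Tri.

(* The underlying module of the cofree connected cooperad on s Pbar is, in    *)
(* each arity, the direct sum over the isomorphism classes of reduced trees   *)
(* with labelled leaves of the tensor products of the modules s Pbar(in(v)).  *)
(* It is presented here as the free abelian group on planar trees decorated   *)
(* by operations, modulo the subgroup bar_null, which expresses that a tree   *)
(* is additive in each decoration and does not depend on the chosen order of  *)
(* the inputs of its vertices. As every vertex carries a suspension, a change *)
(* of that order produces a Koszul sign; the vertices of a planar tree are    *)
(* taken in depth-first, left to right order, the root coming first.          *)
Inductive dtree (P : nat -> Type) (A : Type) : Type :=
| Leaf of A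
| Node m of P m & ('I_m.+1 -> dtree P A).
Arguments Leaf {P A}.
Arguments Node {P A} m.

HB.instance Definition _ P A := gen_eqMixin (dtree P A).
HB.instance Definition _ P A := gen_choiceMixin (dtree P A).

Section Bar.
Variables (P : operad) (A : Type).
Local Notation dtree := (dtree (fun m => P m) A).
Local Notation chain := {freeg dtree / int}.

Fixpoint leaves (t : dtree) : seq A :=
  match t with
  | Leaf a => [:: a]
  | Node m _ ch => flatten [seq leaves (ch i) | i <- enum 'I_m.+1]
  end.

Fixpoint vertices (t : dtree) : nat :=
  match t with
  | Leaf _ => 0
  | Node m _ ch => (\sum_(i < m.+1) vertices (ch i)).+1%N
  end.

(* The number of generating operations, for an operad generated by binary     *)
(* operations: an operation of index m is made of m generators.               *)
Fixpoint weight (t : dtree) : nat :=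
  match t with
  | Leaf _ => 0
  | Node m _ ch => (m + \sum_(i < m.+1) weight (ch i))%N
  end.

(* All decorations have at least two inputs. When P(1) is spanned by the      *)
(* identity, as for every binary quadratic operad, the augmentation ideal     *)
(* Pbar consists exactly of the operations of arity >= 2.                     *)
Fixpoint reduced (t : dtree) : bool :=
  match t with
  | Leaf _ => true
  | Node m _ ch => (0 < m)%N && [forall i, reduced (ch i)]
  end.

Definition upd m (ch : 'I_m -> dtree) (i : 'I_m) (u : dtree) : 'I_m -> dtree :=
  fun j => if j == i then u else ch j.

(* The sign of permuting the blocks ch 0, ..., ch m by s, each block having   *)
(* degree its number of vertices.                                             *)
Definition koszul_sign m (s : 'S_m.+1) (ch : 'I_m.+1 -> dtree) : int :=
  (-1) ^+ (\sum_(i < m.+1) \sum_(j < m.+1 | (i < j) && (s j < s i))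
             vertices (ch i) * vertices (ch j))%N.

Inductive bar_null : chain -> Prop :=
| bar_null_add m (p q : P m) ch :
    bar_null (<< Node m (p + q) ch >> - << Node m p ch >> - << Node m q ch >>)
| bar_null_act m (s : 'S_m.+1) (p : P m) ch :
    bar_null (<< Node m (op_act s p) ch >> -
              << koszul_sign s ch *g Node m p (fun j => ch (s^-1%g j)) >>)
| bar_null_ctx m (p : P m) ch i x : bar_null x ->
    bar_null (fglift (fun u => << Node m p (upd ch i u) >> : chain) x)
| bar_null0 : bar_null 0
| bar_nullB x y : bar_null x -> bar_null y -> bar_null (x - y).

(* The children of the vertex obtained from p and q when the i-th child of p  *)
(* is a vertex q with children ch'.                                           *)
Definition plug m n (i : 'I_m.+1) (ch : 'I_m.+1 -> dtree) (ch' : 'I_n.+1 -> dtree)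
    (j : 'I_(m + n).+1) : dtree :=
  match slot i j with inl a => ch a | inr b => ch' b end.

Definition contract m (p : P m) (ch : 'I_m.+1 -> dtree) (i : 'I_m.+1) : chain :=
  match ch i with
  | Leaf _ => 0
  | Node n q ch' => << Node (m + n) (op_comp i p q) (plug i ch ch') >>
  end.

(* The sum over the internal edges of t of the trees in which that edge is    *)
(* contracted. If the end of the edge farther from the root has rank b (the   *)
(* root has rank 0), moving the two suspensions together and contracting them *)
(* gives the sign (-1)^b.                                                     *)
Fixpoint bar_d (t : dtree) : chain :=
  match t with
  | Leaf _ => 0
  | Node m p ch =>
      \sum_(i < m.+1) (-1) ^+ (\sum_(j < m.+1 | j < i) vertices (ch j)).+1%N *:
        (contract p ch i +
         fglift (fun u => << Node m p (upd ch i u) >> : chain) (bar_d (ch i)))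
  end.

Definition bar_diff (x : chain) : chain := fglift bar_d x.

End Bar.

(* Representatives of the chains of arity n + 1, weight w and degree k.       *)
Definition bar_chain (P : operad) n w k
    (x : {freeg (dtree (fun m => P m) 'I_n.+1) / int}) : Prop :=
  forall t, t \in dom x ->
    [/\ reduced t, perm_eq (leaves t) (enum 'I_n.+1), weight t = w & vertices t = k].

(* The homology of the bar construction vanishes in arity n + 1, weight w and *)
(* degree k.                                                                  *)
Definition bar_acyclic (P : operad) n w k : Prop :=
  forall x, bar_chain (P := P) (n := n) w k x -> bar_null (bar_diff x) ->
  exists2 y, bar_chain (P := P) (n := n) w k.+1 y & bar_null (x - bar_diff y).

(* Koszulness, for an operad P generated by binary operations. *)
Definition koszul (P : operad) : Prop :=
  forall n w k, k != w -> bar_acyclic P n w k.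

(* Main.v *)
From HB Require Import structures.
From mathcomp Require Import all_boot fingroup perm ssralg ssrint.
From mathcomp Require Import generic_quotient ring_quotient zify boolp freeg.
Require Import Defs.

Set Implicit Arguments.
Unset Strict Implicit.
Unset Printing Implicit Defensive.

Import GRing.Theory.
Local Open Scope ring_scope.

(** The proof is a quadratic Groebner basis (PBW) argument, carried out on
    planar binary trees whose internal edges are marked.

    The operation e of a power has two sets of coordinates, lm e and rm e: the
    coordinates in which its left, respectively its right, input is selected
    (for one factor: left only, right only, both). They cover all coordinates,
    and every covering pair comes from exactly one operation. A composite of
    two operations then has three masks, one for each input. The relators of a
    power of Trias are the combinations of composites whose masks cancel
    ([white_masked]); the relators of a power of TriDend are spanned, for each
    triple S of masks, by the difference of the left composites and the right
    composites with masks S ([dual_rel], [black_masked]). Both descriptions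
    pass through the two products, coordinates of a product being the disjoint
    union of the coordinates of the factors, so the operads of the theorem only
    enter through their masks.

    The bar construction is replaced by a complex of marked binary trees. A
    vertex carries a generator, and its mark is the state of the edge above it:
    uncut (mark p), cut (mark p + 1) or passive. The pieces left by the cut
    edges stand for the operations that decorate a tree of the bar construction;
    relators may be applied along uncut edges ([rel_ideal]), and the
    differential [dd] uncuts the cut edges one by one. As the operads are
    regular, choosing for each decorated tree the orders of the inputs yields
    mutually inverse maps between the bar construction and this complex, up to
    the Koszul signs of these choices ([nc], [sec]). Hence Koszulness follows
    from the exactness of the complex of marked trees in the presence of uncut
    edges ([koszul_cells]): in weight w and degree k there are w - k of them.

    Exactness is the PBW theorem in the form [quadratic_exact]. Call some pairs
    (vertex, child) normal. If each tree with an uncut edge that is not normal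
    is congruent to smaller trees, and if trees with only normal uncut edges are
    independent, then the differential is, up to smaller trees, the one that
    only uncuts normal edges; for the latter, cutting the first normal edge is
    a contracting homotopy.

    For the powers of Trias a pair is normal if the child e' of e is a right
    child and rm e' is included in rm e. Each triple of masks that occurs has
    exactly one normal composite, and evaluating the uncut pieces to their masks
    shows the independence ([value_valid], [white_exact]). For the powers of
    TriDend the normal pairs are the other ones, and independence comes from
    duality: a
    relation between black trees is the coboundary of a cochain of the white
    complex ([black_coboundary]), so it vanishes on the white cycles, and each
    tree whose uncut edges are black-normal is the leading term of a white
    cycle, a consequence of white exactness ([white_cycle], [black_exact]). *)

(** * Free abelian groups and identities in abelian groups *)

HB.instance Definition _ (K : choiceType) (M : lmodType int) (f : K -> M) :=
  GRing.isZmodMorphism.Build {freeg K / int} M (fglift f) (lift_is_additive f).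

Definition sn (M : zmodType) (b : bool) (x : M) : M := if b then - x else x.

Section SignLemmas.
Variable M : zmodType.
Implicit Types (a b : bool) (x y : M).

Lemma sn0 b : sn b (0 : M) = 0.
Proof. by case: b; rewrite /= ?oppr0. Qed.

Lemma snD b x y : sn b (x + y) = sn b x + sn b y.
Proof. by case: b; rewrite //= opprD. Qed.

Lemma snN b x : sn b (- x) = - sn b x.
Proof. by case: b. Qed.

Lemma snB b x y : sn b (x - y) = sn b x - sn b y.
Proof. by rewrite snD snN. Qed.

Lemma sn_sn a b x : sn a (sn b x) = sn (a (+) b) x.
Proof. by case: a b => [] []; rewrite /= ?opprK. Qed.

Lemma snC a b x : sn a (sn b x) = sn b (sn a x).
Proof. by rewrite !sn_sn addbC. Qed.

Lemma raddf_sn (N : zmodType) (f : {additive M -> N}) b x : f (sn b x) = sn b (f x).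
Proof. by case: b; rewrite //= raddfN. Qed.

Lemma in_span_sn (S : M -> Prop) b x : in_span S x -> in_span S (sn b x).
Proof. by case: b => //= h; rewrite -sub0r; apply: in_spanB => //; apply: in_span0. Qed.

Lemma in_spanN (S : M -> Prop) x : in_span S x -> in_span S (- x).
Proof. exact: (@in_span_sn S true). Qed.

Lemma in_spanD (S : M -> Prop) x y : in_span S x -> in_span S y -> in_span S (x + y).
Proof. by move=> hx hy; rewrite -[y]opprK; apply/in_spanB/in_spanN. Qed.

Lemma in_span_sum (S : M -> Prop) (I : Type) (r : seq I) (P : pred I) (F : I -> M) :
  (forall i, P i -> in_span S (F i)) -> in_span S (\sum_(i <- r | P i) F i).
Proof.
move=> h; apply: (big_ind (in_span S)) => //; first exact: in_span0.
by move=> x y; apply: in_spanD.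
Qed.

End SignLemmas.

Lemma scale_sign (M : lmodType int) (k : nat) (x : M) : (-1) ^+ k *: x = sn (odd k) x.
Proof. by rewrite -signr_odd scaler_sign. Qed.

(** Rewriting in abelian groups is done by reflection: both sides become
    formal expressions in the same atoms, with integer coefficients. *)
Section ZmodReflection.

Inductive zexp := ZVar of nat | ZZero | ZAdd of zexp & zexp | ZOpp of zexp.

Fixpoint zval (M : zmodType) (env : seq M) (u : zexp) : M :=
  match u with
  | ZVar i => env`_i
  | ZZero => 0
  | ZAdd u1 u2 => zval env u1 + zval env u2
  | ZOpp u1 => - zval env u1
  end.

Fixpoint zcoef (u : zexp) (i : nat) : int :=
  match u with
  | ZVar j => (j == i)%:Z
  | ZZero => 0
  | ZAdd u1 u2 => zcoef u1 i + zcoef u2 i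
  | ZOpp u1 => - zcoef u1 i
  end.

Lemma zvalE (M : zmodType) (env : seq M) u :
  zval env u = \sum_(i < size env) env`_i *~ zcoef u i.
Proof.
elim: u => [j||u1 h1 u2 h2|u1 h1] /=.
- have [hj|hj] := ltnP j (size env).
    rewrite (bigD1 (Ordinal hj)) //= eqxx mulr1z big1 ?addr0 // => i.
    by rewrite -val_eqE /= eq_sym => /negPf ->.
  rewrite nth_default // big1 // => i _; rewrite [j == i]gtn_eqF //.
  exact: leq_trans (ltn_ord i) hj.
- by rewrite big1.
- by rewrite h1 h2 -big_split; apply: eq_bigr => i _; rewrite mulrzDr.
- by rewrite h1 -sumrN; apply: eq_bigr => i _; rewrite mulrNz.
Qed.

Lemma zval_eq (M : zmodType) (env : seq M) u v :
  all (fun i => zcoef u i == zcoef v i) (iota 0 (size env)) ->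
  zval env u = zval env v.
Proof.
move=> /allP h; rewrite !zvalE; apply: eq_bigr => i _.
by rewrite (eqP (h i _)) // mem_iota add0n ltn_ord.
Qed.

End ZmodReflection.

(* Atoms are compared up to conversion, since the same chain may occur through
   different but convertible algebraic structures. *)
Ltac zsame x y := match goal with _ => let _ := match goal with _ => unify x y end in constr:(true) | _ => constr:(false) end.
Ltac zindex x env :=
  lazymatch env with
  | ?y :: ?env' =>
    lazymatch zsame x y with
    | true => constr:(0%N)
    | false => let i := zindex x env' in constr:(S i)
    end
  end.
Ltac zmember x env :=
  lazymatch env with
  | ?y :: ?env' => lazymatch zsame x y with true => constr:(true) | false => zmember x env' end
  | _ => constr:(false)
  end.
Ltac zatoms t env :=
  lazymatch t with
  | (?a + ?b)%R => let env1 := zatoms a env in zatoms b env1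
  | (- ?a)%R => zatoms a env
  | 0%R => env
  | _ => lazymatch zmember t env with true => env | false => constr:(t :: env) end
  end.
Ltac zreify t env :=
  lazymatch t with
  | (?a + ?b)%R => let u := zreify a env in let v := zreify b env in constr:(ZAdd u v)
  | (- ?a)%R => let u := zreify a env in constr:(ZOpp u)
  | 0%R => constr:(ZZero)
  | _ => let i := zindex t env in constr:(ZVar i)
  end.
Ltac zmod :=
  lazymatch goal with
  | |- @eq ?T ?a ?b =>
    let env0 := constr:(@nil T) in
    let env1 := zatoms a env0 in
    let env := zatoms b env1 in
    let u := zreify a env in
    let v := zreify b env in
    apply: (@zval_eq _ env u v); vm_compute; reflexivity
  end.

(** Subgroups as plain predicates, since the ideals of relations below are
    inductive predicates. *)
Definition subg (M : zmodType) (G : M -> Prop) : Prop :=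
  G 0 /\ forall x y, G x -> G y -> G (x - y).

Section Subg.
Variables (M : zmodType) (G : M -> Prop).
Hypothesis hG : subg G.

Lemma subgB x y : G x -> G y -> G (x - y).
Proof. exact: hG.2. Qed.

Lemma subgN x : G x -> G (- x).
Proof. by move=> hx; rewrite -sub0r; apply: subgB => //; apply: hG.1. Qed.

Lemma subgD x y : G x -> G y -> G (x + y).
Proof. by move=> hx hy; rewrite -[y]opprK; apply/subgB/subgN. Qed.

Lemma subg_sn b x : G x -> G (sn b x).
Proof. by case: b => //; apply: subgN. Qed.

Lemma subg_sum (I : Type) (r : seq I) (P : pred I) (F : I -> M) :
  (forall i, P i -> G (F i)) -> G (\sum_(i <- r | P i) F i).
Proof. by have [G0 _] := hG => h; apply: (big_ind G) => // x y; apply: subgD. Qed.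

Lemma subg_trans y x z : G (x - y) -> G (y - z) -> G (x - z).
Proof. by move=> h1 h2; have := subgD h1 h2; rewrite addrA subrK. Qed.

Lemma subg_sym x y : G (x - y) -> G (y - x).
Proof. by move/subgN; rewrite opprB. Qed.

Lemma subgBB x y x' y' : G (x - x') -> G (y - y') -> G ((x - y) - (x' - y')).
Proof.
by move=> h1 h2; rewrite (_ : _ - _ = (x - x') - (y - y')); [apply: subgB | zmod].
Qed.

Lemma subg_eq x y : G (x - y) -> G y -> G x.
Proof. by move=> h1 h2; have := subgD h1 h2; rewrite subrK. Qed.

End Subg.

Lemma subg_in_span (M : zmodType) (S : M -> Prop) : subg (in_span S).
Proof. by split; [apply: in_span0 | apply: in_spanB]. Qed.

Section SpanOf.
Variable K : choiceType.
Local Notation F := {freeg K / int}.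
Implicit Types (P Q : K -> Prop) (x y : F).

(** The chains supported on P; the presentation as a span gives induction, and
    [span_of_dom] the description by supports. *)
Definition span_of P : F -> Prop := in_span (fun z => exists2 k, P k & z = << k >>).

Lemma span_ofU P k : P k -> span_of P << k >>.
Proof. by move=> h; apply: in_span_gen; exists k. Qed.

Lemma subg_span_of P : subg (span_of P).
Proof. exact: subg_in_span. Qed.

Lemma span_of_lift (M : lmodType int) (G : M -> Prop) P (f : K -> M) x :
  subg G -> (forall k, P k -> G (f k)) -> span_of P x -> G (fglift f x).
Proof.
move=> hG hf; elim=> [_ [k hk ->]||y z _ hy _ hz].
- by rewrite fgliftU; apply: hf.
- by rewrite fglift0; apply: hG.1.
- by rewrite fgliftB; apply: hG.2.
Qed.

Lemma fglift_id x : fglift (fun k => << k >>) x = x.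
Proof.
elim/freeg_basis_ind: x => [k||x y hx hy].
- by rewrite fgliftU.
- by rewrite fglift0.
- by rewrite fgliftB hx hy.
Qed.

Lemma span_of_ind (G : F -> Prop) P x :
  subg G -> (forall k, P k -> G << k >>) -> span_of P x -> G x.
Proof.
by move=> hG hP hx; rewrite -[x]fglift_id; apply: span_of_lift hx.
Qed.

Lemma span_of_sub P Q x : (forall k, P k -> Q k) -> span_of P x -> span_of Q x.
Proof.
by move=> PQ; apply: span_of_ind (subg_span_of Q) _ => k /PQ; apply: span_ofU.
Qed.

Lemma subg_mulz (M : zmodType) (G : M -> Prop) (c : int) (x : M) :
  subg G -> G x -> G (x *~ c).
Proof.
move=> hG hx; have hn (n : nat) : G (x *+ n).
  elim: n => [|n IHn]; first by rewrite mulr0n; apply: hG.1.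
  by rewrite mulrS; apply: subgD.
by case: c => n; rewrite ?NegzE ?mulrNz -pmulrn; [|apply: subgN].
Qed.

Lemma span_of_dom P x : span_of P x <-> forall k, k \in dom x -> P k.
Proof.
split=> [|h].
  apply: (span_of_ind (G := fun x => forall k, k \in dom x -> P k)) => [|k hk j];
    last by rewrite domU1 inE => /eqP ->.
  split=> [k|y z hy hz k /domB]; first by rewrite dom0.
  by rewrite mem_cat => /orP[/hy|/hz].
rewrite -[x]freeg_sumE big_seq; apply: (subg_sum (subg_span_of P)) => k hk.
rewrite (_ : << _ *g k >> = << k >> *~ coeff k x).
  by apply: subg_mulz; [apply: subg_span_of | apply/span_ofU/h].
by rewrite freegU_mulz intz.
Qed.

End SpanOf.

Lemma fglift_in (K : choiceType) (M : lmodType int) (G : M -> Prop) (f : K -> M) x :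
  subg G -> (forall k, G (f k)) -> G (fglift f x).
Proof.
move=> hG hf; elim/freeg_basis_ind: x => [k||x y hx hy].
- by rewrite fgliftU.
- by rewrite fglift0; apply: hG.1.
- by rewrite fgliftB; apply: hG.2.
Qed.

Lemma fglift_eq0 (K : choiceType) (M : lmodType int) (f : K -> M) x :
  (forall k, f k = 0) -> fglift f x = 0.
Proof.
move=> hf; apply: (@fglift_in _ M (fun z => z = 0)) => //.
by split=> // u v -> ->; rewrite subr0.
Qed.

Lemma fglift_sum (K : choiceType) (M : lmodType int) (f : K -> M) (J : Type)
    (r : seq J) (P : pred J) (F : J -> {freeg K / int}) :
  fglift f (\sum_(j <- r | P j) F j) = \sum_(j <- r | P j) fglift f (F j).
Proof. exact: (raddf_sum (fglift f)). Qed.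

Lemma coeff_sum (K : choiceType) (k : K) (J : Type)
    (r : seq J) (P : pred J) (F : J -> {freeg K / int}) :
  coeff k (\sum_(j <- r | P j) F j) = \sum_(j <- r | P j) coeff k (F j).
Proof. exact: (raddf_sum (coeff k)). Qed.

(** * Marked trees *)

Section Cells.
Variables (E A : Type).

(** In [CN s e l r] the number s is the mark of the edge above the vertex e. All
    the complexes use the same trees: for a given p, the mark p is an uncut
    edge, p + 1 a cut edge, and other marks are passive. The white complex is
    the case p = 0 and the black one the case p = 1, which lets a mark 1 be at
    once cut for the former and uncut for the latter. *)
Inductive cell := CL of A | CN of nat & E & cell & cell.

Fixpoint leaf_seq t := match t with CL a => [:: a] | CN _ _ l r => leaf_seq l ++ leaf_seq r end.

Fixpoint cell_size t : nat :=
  match t with CL _ => 0 | CN _ _ l r => (cell_size l + cell_size r).+1 end.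

Fixpoint count_state q t : nat :=
  match t with CL _ => 0 | CN s _ l r => ((s == q) + (count_state q l + count_state q r))%N end.

Definition root_state t := if t is CN s _ _ _ then Some s else None.

Definition set_root q t := if t is CN _ e l r then CN q e l r else t.

HB.instance Definition _ := gen_eqMixin cell.
HB.instance Definition _ := gen_choiceMixin cell.

Lemma size_leaf_seq t : size (leaf_seq t) = (cell_size t).+1.
Proof. by elim: t => //= _ _ l hl r hr; rewrite size_cat hl hr addSn addnS. Qed.

End Cells.
Arguments CL {E A}.
Arguments CN {E A}.

Section Chains.
Variables (E A : Type) (p : nat).
Local Notation cell := (cell E A).
Local Notation chain := {freeg cell / int}.
Implicit Types (s : nat) (e : E) (l r t : cell) (x y z : chain).

(** The bilinear extension of the constructor of marked trees. *)
Definition nd s e x y : chain :=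
  fglift (fun l => fglift (fun r => << CN s e l r >> : chain) y) x.

Lemma ndU s e l r : nd s e << l >> << r >> = << CN s e l r >>.
Proof. by rewrite /nd !fgliftU. Qed.

Lemma ndBl s e x x' y : nd s e (x - x') y = nd s e x y - nd s e x' y.
Proof. exact: raddfB. Qed.

Lemma ndBr s e x y y' : nd s e x (y - y') = nd s e x y - nd s e x y'.
Proof.
by rewrite /nd -fglift_sub; congr fglift; apply/funext => l; rewrite raddfB.
Qed.

Lemma nd_subproofl s e y : zmod_morphism (fun x => nd s e x y).
Proof. by move=> x x'; apply: ndBl. Qed.

Lemma nd_subproofr s e x : zmod_morphism (nd s e x).
Proof. by move=> y y'; apply: ndBr. Qed.

HB.instance Definition _ s e x :=
  GRing.isZmodMorphism.Build chain chain (nd s e x) (@nd_subproofr s e x).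

(** The flipped [nd], for which additivity in the first tree can be registered. *)
Definition ndl s e y x := nd s e x y.
HB.instance Definition _ s e y :=
  GRing.isZmodMorphism.Build chain chain (ndl s e y) (@nd_subproofl s e y).

Lemma nd0l s e y : nd s e 0 y = 0. Proof. exact: (raddf0 (ndl s e y)). Qed.
Lemma nd0r s e x : nd s e x 0 = 0. Proof. exact: raddf0. Qed.
Lemma ndDl s e x x' y : nd s e (x + x') y = nd s e x y + nd s e x' y.
Proof. exact: (raddfD (ndl s e y)). Qed.
Lemma ndDr s e x y y' : nd s e x (y + y') = nd s e x y + nd s e x y'.
Proof. exact: raddfD. Qed.
Lemma ndNl s e x y : nd s e (- x) y = - nd s e x y.
Proof. exact: (raddfN (ndl s e y)). Qed.
Lemma ndNr s e x y : nd s e x (- y) = - nd s e x y. Proof. exact: raddfN. Qed.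
Lemma nd_snl s e b x y : nd s e (sn b x) y = sn b (nd s e x y).
Proof. exact: (raddf_sn (ndl s e y)). Qed.
Lemma nd_snr s e b x y : nd s e x (sn b y) = sn b (nd s e x y).
Proof. exact: raddf_sn. Qed.

Definition hi_odd t := odd (count_state p.+1 t).

(** The sign of passing an odd operator over a tree, whose degree is its number
    of cut edges. *)
Definition tw x := fglift (fun t => sn (hi_odd t) << t >> : chain) x.

Lemma twU t : tw << t >> = sn (hi_odd t) << t >>.
Proof. exact: fgliftU. Qed.

HB.instance Definition _ := GRing.isZmodMorphism.Build chain chain tw (lift_is_additive _).

Lemma tw0 : tw 0 = 0. Proof. exact: raddf0. Qed.
Lemma twB x y : tw (x - y) = tw x - tw y. Proof. exact: raddfB. Qed.
Lemma twD x y : tw (x + y) = tw x + tw y. Proof. exact: raddfD. Qed.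
Lemma tw_sn b x : tw (sn b x) = sn b (tw x). Proof. exact: raddf_sn. Qed.

(** The differential uncuts one cut edge; its sign is the parity of the number
    of cut edges that precede it in the depth-first order. *)
Fixpoint ddc t : chain :=
  match t with
  | CL _ => 0
  | CN s e l r =>
      (if s == p.+1 then << CN p e l r >> else 0) +
      sn (s == p.+1) (nd s e (ddc l) << r >> + nd s e (tw << l >>) (ddc r))
  end.

Definition dd x := fglift ddc x.
HB.instance Definition _ := GRing.isZmodMorphism.Build chain chain dd (lift_is_additive _).

Lemma dd0 : dd 0 = 0. Proof. exact: raddf0. Qed.
Lemma ddB x y : dd (x - y) = dd x - dd y. Proof. exact: raddfB. Qed.
Lemma ddD x y : dd (x + y) = dd x + dd y. Proof. exact: raddfD. Qed.
Lemma dd_sn b x : dd (sn b x) = sn b (dd x). Proof. exact: raddf_sn. Qed.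

Lemma ddU t : dd << t >> = ddc t.
Proof. exact: fgliftU. Qed.

(** Identities that are additive in each of two chains only need to be checked
    on trees. *)
Lemma bi_ind (P : chain -> chain -> Prop) :
  (forall l r, P << l >> << r >>) ->
  (forall x, subg (P x)) -> (forall y, subg (P^~ y)) ->
  forall x y, P x y.
Proof.
move=> PU Pr Pl x y; elim/freeg_basis_ind: x => [l||x x' hx hx'].
- elim/freeg_basis_ind: y => [r||y y' hy hy']; first exact: PU.
    exact: (Pr << l >>).1.
  exact: (Pr << l >>).2.
- exact: (Pl y).1.
- exact: (Pl y).2.
Qed.

Lemma tw_nd s e x y : tw (nd s e x y) = sn (s == p.+1) (nd s e (tw x) (tw y)).
Proof.
move: x y; apply: bi_ind => [l r|x|y].
- rewrite ndU !twU nd_snl nd_snr ndU !sn_sn /hi_odd /=.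
  by rewrite !oddD oddb addbA.
- split=> [|y y' hy hy']; first by rewrite nd0r !tw0 nd0r sn0.
  by rewrite ndBr !twB hy hy' ndBr snB.
- split=> [|x x' hx hx']; first by rewrite nd0l !tw0 nd0l sn0.
  by rewrite ndBl !twB hx hx' ndBl snB.
Qed.

Lemma twK x : tw (tw x) = x.
Proof.
elim/freeg_basis_ind: x => [t||x y hx hy]; rewrite ?tw0 //.
  by rewrite twU tw_sn twU sn_sn addbb.
by rewrite !twB hx hy.
Qed.

Lemma dd_nd s e x y : dd (nd s e x y) =
  (if s == p.+1 then nd p e x y else 0) +
  sn (s == p.+1) (nd s e (dd x) y + nd s e (tw x) (dd y)).
Proof.
move: x y; apply: bi_ind => [l r|x|y].
- by rewrite !ndU !ddU.
- split=> [|y y' hy hy'].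
    by rewrite !(nd0r, dd0) addr0 sn0 addr0 if_same.
  by rewrite !(ndBr, ddB) hy hy'; case: ifP => _ /=; zmod.
- split=> [|x x' hx hx'].
    by rewrite !(dd0, tw0, nd0l) addr0 sn0 addr0 if_same.
  by rewrite !(ndBl, ddB, twB) hx hx'; case: ifP => _ /=; zmod.
Qed.

Lemma tw_dd x : tw (dd x) = - dd (tw x).
Proof.
elim/freeg_basis_ind: x => [t||x y hx hy]; first last.
- by rewrite ddB !twB hx hy ddB; zmod.
- by rewrite tw0 dd0 tw0 oppr0.
elim: t => [a|s e l hl r hr]; first by rewrite twU dd_sn !ddU tw0 sn0 oppr0.
rewrite -ndU tw_nd dd_nd dd_sn dd_nd !(twD, tw_sn) !tw_nd.
rewrite hl hr !twK.
have -> : tw (if s == p.+1 then nd p e << l >> << r >> else 0) =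
    if s == p.+1 then nd p e (tw << l >>) (tw << r >>) else 0.
  by case: ifP => _; rewrite ?tw0 // tw_nd eqn_leq ltnn andbF.
rewrite ndNl ndNr.
by case: ifP => _ /=; zmod.
Qed.

Lemma ddK x : dd (dd x) = 0.
Proof.
elim/freeg_basis_ind: x => [t||x y hx hy]; first last.
- by rewrite !ddB hx hy; zmod.
- by rewrite !dd0.
elim: t => [a|s e l hl r hr]; first by rewrite ddU dd0.
rewrite -ndU dd_nd !(ddD, dd_sn) !dd_nd hl hr nd0l nd0r tw_dd.
have -> : dd (if s == p.+1 then nd p e << l >> << r >> else 0) =
    if s == p.+1 then nd p e (dd << l >>) << r >> + nd p e (tw << l >>) (dd << r >>) else 0.
  case: ifP => _; rewrite ?dd0 // dd_nd eqn_leq ltnn andbF /=; zmod.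
rewrite ?ndNl.
by case: ifP => _ /=; zmod.
Qed.

End Chains.

(** * The quadratic PBW criterion *)

Section PBW.
Variables (E A : Type) (p : nat) (nrm : bool -> E -> E -> bool).
Local Notation cell := (cell E A).
Local Notation chain := {freeg cell / int}.
Local Notation ctx := (option (bool * E)).
Local Notation hi := p.+1.
Local Notation tw := (@tw E A p).
Local Notation dd := (@dd E A p).
Local Notation nd := (@nd E A).
Implicit Types (s : nat) (e : E) (l r t : cell) (x y z : chain) (o : ctx).

(** The context o of a subtree records the generator of the vertex above it,
    and whether the subtree is a right child. An edge without a vertex above it
    is never normal. *)
Definition nrmo o e' := if o is Some (b, e) then nrm b e e' else false.

(** These are the normal trees, the monomials of the PBW basis. *)
Fixpoint valid_in o t :=
  if t is CN s e l r then
    [&& (s == p) ==> nrmo o e, valid_in (Some (false, e)) l & valid_in (Some (true, e)) r]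
  else true.

(** The active edges are the normal ones that the differential or its homotopy
    may touch, cut or not. *)
Definition acts o s e := ((s == p) || (s == hi)) && nrmo o e.

Fixpoint has_active o t :=
  if t is CN s e l r then
    [|| acts o s e, has_active (Some (false, e)) l | has_active (Some (true, e)) r]
  else false.

Fixpoint forget t : cell :=
  if t is CN s e l r then CN (if s == hi then p else s) e (forget l) (forget r) else t.

(** The homotopy cuts the first active edge if it is uncut, and vanishes if it
    is already cut. *)
Fixpoint htpc o t : chain :=
  if t is CN s e l r then
    if acts o s e then (if s == p then << CN hi e l r >> else 0)
    else sn (s == hi)
      (if has_active (Some (false, e)) l then nd s e (htpc (Some (false, e)) l) << r >>
       else nd s e (tw << l >>) (htpc (Some (true, e)) r))
  else 0.

(** The leading part of the differential: only normal edges are uncut. *)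
Fixpoint d0c o t : chain :=
  if t is CN s e l r then
    (if (s == hi) && nrmo o e then << CN p e l r >> else 0) +
    sn (s == hi) (nd s e (d0c (Some (false, e)) l) << r >> +
                  nd s e (tw << l >>) (d0c (Some (true, e)) r))
  else 0.

Definition htp o x := fglift (htpc o) x.
Definition d0 o x := fglift (d0c o) x.

Lemma htpU o t : htp o << t >> = htpc o t. Proof. exact: fgliftU. Qed.
Lemma htp0 o : htp o 0 = 0. Proof. exact: fglift0. Qed.
Lemma htpB o x y : htp o (x - y) = htp o x - htp o y. Proof. exact: fgliftB. Qed.
Lemma htpN o x : htp o (- x) = - htp o x. Proof. exact: fgliftN. Qed.
Lemma htpD o x y : htp o (x + y) = htp o x + htp o y. Proof. exact: fgliftD. Qed.
Lemma htp_sn o b x : htp o (sn b x) = sn b (htp o x).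
Proof. by case: b; rewrite //= htpN. Qed.
Lemma d0U o t : d0 o << t >> = d0c o t. Proof. exact: fgliftU. Qed.
Lemma d00 o : d0 o 0 = 0. Proof. exact: fglift0. Qed.
Lemma d0B o x y : d0 o (x - y) = d0 o x - d0 o y. Proof. exact: fgliftB. Qed.
Lemma d0N o x : d0 o (- x) = - d0 o x. Proof. exact: fgliftN. Qed.
Lemma d0_sn o b x : d0 o (sn b x) = sn b (d0 o x).
Proof. by case: b; rewrite //= d0N. Qed.

Lemma d0_nd o s e x y : d0 o (nd s e x y) =
  (if (s == hi) && nrmo o e then nd p e x y else 0) +
  sn (s == hi) (nd s e (d0 (Some (false, e)) x) y + nd s e (tw x) (d0 (Some (true, e)) y)).
Proof.
move: x y; apply: bi_ind => [l r|x|y].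
- by rewrite !ndU !d0U.
- split=> [|y y' hy hy'].
    by rewrite !(nd0r, d00) addr0 sn0 addr0 if_same.
  by rewrite !(ndBr, d0B) hy hy'; case: ifP => _ /=; case: (s == hi) => /=; zmod.
- split=> [|x x' hx hx'].
    by rewrite !(d00, tw0, nd0l) addr0 sn0 addr0 if_same.
  by rewrite !(ndBl, d0B, twB) hx hx'; case: ifP => _ /=; case: (s == hi) => /=; zmod.
Qed.

Lemma htp_nd_act o s e x y : acts o s e ->
  htp o (nd s e x y) = if s == p then nd hi e x y else 0.
Proof.
move=> a; move: x y; apply: bi_ind => [l r|x|y].
- by rewrite !ndU htpU /= a.
- split=> [|y y' hy hy']; first by rewrite !(nd0r, htp0) if_same.
  by rewrite !(ndBr, htpB) hy hy'; case: ifP => _; rewrite ?subr0.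
- split=> [|x x' hx hx']; first by rewrite !(nd0l, htp0) if_same.
  by rewrite !(ndBl, htpB) hx hx'; case: ifP => _; rewrite ?subr0.
Qed.

Lemma htp_ndl o s e x y : ~~ acts o s e -> span_of (has_active (Some (false, e))) x ->
  htp o (nd s e x y) = sn (s == hi) (nd s e (htp (Some (false, e)) x) y).
Proof.
move=> a; apply: (span_of_ind (G := fun x => htp o (nd s e x y) = sn (s == hi) (nd s e (htp (Some (false, e)) x) y))) => [|l hl].
  split=> [|x1 x2 h1 h2]; first by rewrite !(nd0l, htp0) sn0.
  by rewrite !(ndBl, htpB) h1 h2 snB.
elim/freeg_basis_ind: y => [r||y y' hy hy'].
- by rewrite ndU !htpU /= (negPf a) hl.
- by rewrite !nd0r htp0 sn0.
- by rewrite !ndBr htpB hy hy' snB.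
Qed.

Lemma htp_ndr o s e x y : ~~ acts o s e ->
  span_of (fun l => ~~ has_active (Some (false, e)) l) x ->
  htp o (nd s e x y) = sn (s == hi) (nd s e (tw x) (htp (Some (true, e)) y)).
Proof.
move=> a; apply: (span_of_ind (G := fun x => htp o (nd s e x y) = sn (s == hi) (nd s e (tw x) (htp (Some (true, e)) y)))) => [|l hl].
  split=> [|x1 x2 h1 h2]; first by rewrite !(nd0l, htp0, tw0) sn0.
  by rewrite !(ndBl, htpB, twB) h1 h2 snB.
elim/freeg_basis_ind: y => [r||y y' hy hy'].
- by rewrite ndU !htpU /= (negPf a) (negPf hl).
- by rewrite !nd0r !htp0 nd0r sn0.
- by rewrite !ndBr !htpB hy hy' ndBr snB.
Qed.

Lemma span_of_tw (P : cell -> Prop) x : span_of P x -> span_of P (tw x).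
Proof.
apply: (span_of_lift (subg_span_of P)) => t ht.
by apply: (subg_sn (subg_span_of P)); apply: span_ofU.
Qed.

Lemma span_of_nd (P Q R : cell -> Prop) s e x y :
  (forall l r, P l -> Q r -> R (CN s e l r)) ->
  span_of P x -> span_of Q y -> span_of R (nd s e x y).
Proof.
move=> PQR hx hy; move: hx.
apply: (span_of_lift (subg_span_of R)) => l hl; move: hy.
apply: (span_of_lift (subg_span_of R)) => r hr.
by apply: span_ofU; apply: PQR.
Qed.

Lemma eq_span_of t : span_of (eq t) << t >>.
Proof. exact: span_ofU. Qed.

Lemma hi_p : (p == hi) = false.
Proof. by rewrite ltn_eqF. Qed.
Lemma p_hi : (hi == p) = false.
Proof. by rewrite gtn_eqF. Qed.

(** All operators move between trees of the same underlying shape, and change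
    the number of uncut edges by one: c is the successor, on the one side or
    the other. *)
Definition same_tree (c : nat -> nat) t t' :=
  forget t' = forget t /\ count_state p t' = c (count_state p t).

Lemma has_active_forget o t : has_active o (forget t) = has_active o t.
Proof.
elim: t o => //= s e l hl r hr o; rewrite hl hr; congr (_ || _).
rewrite /acts; case: (eqVneq s hi) => [->|/negPf ->]; last by rewrite orbF.
by rewrite eqxx orbT.
Qed.

Lemma same_tree_active c o t t' : same_tree c t t' -> has_active o t' = has_active o t.
Proof. by move=> [h _]; rewrite -has_active_forget h has_active_forget. Qed.

Lemma dd_same t : span_of (same_tree S t) (dd << t >>).
Proof.
elim: t => [a|s e l hl r hr]; first by rewrite ddU; apply: in_span0.
rewrite -ndU dd_nd; apply: subgD; first exact: subg_span_of.
  case: (eqVneq s hi) => [->|_]; last exact: in_span0.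
  rewrite ndU; apply: span_ofU; split=> /=.
    by rewrite hi_p eqxx.
  by rewrite eqxx p_hi.
apply: (subg_sn (subg_span_of _)); apply: subgD; first exact: subg_span_of.
  apply: (span_of_nd _ hl (eq_span_of r)) => l' _ [h1 h2] <-; split=> /=; first by rewrite h1.
  by rewrite h2; lia.
apply: (span_of_nd _ (span_of_tw (eq_span_of l)) hr) => _ r' <- [h1 h2]; split=> /=; first by rewrite h1.
by rewrite h2; lia.
Qed.

Lemma d0_same o t : span_of (same_tree S t) (d0 o << t >>).
Proof.
elim: t o => [a|s e l hl r hr] o; first by rewrite d0U; apply: in_span0.
rewrite -ndU d0_nd; apply: subgD; first exact: subg_span_of.
  case: (eqVneq s hi) => [->|_] /=; last exact: in_span0.
  case: ifP => _; last exact: in_span0.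
  rewrite ndU; apply: span_ofU; split=> /=.
    by rewrite hi_p eqxx.
  by rewrite eqxx p_hi.
apply: (subg_sn (subg_span_of _)); apply: subgD; first exact: subg_span_of.
  apply: (span_of_nd _ (hl _) (eq_span_of r)) => l' _ [h1 h2] <-; split=> /=; first by rewrite h1.
  by rewrite h2; lia.
apply: (span_of_nd _ (span_of_tw (eq_span_of l)) (hr _)) => _ r' <- [h1 h2]; split=> /=; first by rewrite h1.
by rewrite h2; lia.
Qed.

Lemma d0_inactive o t : ~~ has_active o t -> d0 o << t >> = 0.
Proof.
elim: t o => [a|s e l hl r hr] o; first by rewrite d0U.
rewrite /= !negb_or => /and3P[na nl nr].
rewrite -ndU d0_nd hl // hr // nd0l nd0r addr0 sn0 addr0.
by case: ifP => // /andP[/eqP s1 n]; rewrite /acts s1 eqxx orbT n in na.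
Qed.

Lemma tw_htp o x : tw (htp o x) = - htp o (tw x).
Proof.
elim/freeg_basis_ind: x => [t||x y hx hy]; first last.
- by rewrite twB !htpB twB hx hy; zmod.
- by rewrite tw0 htp0 tw0 oppr0.
elim: t o => [a|s e l hl r hr] o; first by rewrite twU htp_sn htpU /= tw0 oppr0.
case: (boolP (acts o s e)) => a.
  rewrite -ndU htp_nd_act // tw_nd htp_sn htp_nd_act //.
  case: (eqVneq s p) => [->|_]; last by rewrite tw0 sn0 oppr0.
  by rewrite tw_nd eqxx hi_p.
case: (boolP (has_active (Some (false, e)) l)) => al.
  rewrite -ndU htp_ndl // ?tw_sn ?tw_nd ?htp_sn ?htp_ndl //.
  - by rewrite hl ndNl; case: (s == hi); rewrite /= ?opprK.
  - exact/span_of_tw/span_ofU.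
  - exact: span_ofU.
rewrite -ndU htp_ndr // ?tw_sn ?tw_nd ?htp_sn ?htp_ndr //.
- by rewrite hr ndNr; case: (s == hi); rewrite /= ?opprK.
- exact/span_of_tw/span_ofU.
- exact: span_ofU.
Qed.

(** Toggling the first active edge pairs the trees off. The uncutting of any
    later edge anticommutes with it, and an edge that precedes the first active
    one is inactive, hence not seen by [d0]. *)
Lemma homotopy o t : has_active o t ->
  d0 o (htp o << t >>) + htp o (d0 o << t >>) = << t >>.
Proof.
elim: t o => [//|s e l hl r hr] o; rewrite /= -ndU.
have hd := d0_same _ l.
case: (boolP (acts o s e)) => a /=.
  move=> _; have n : nrmo o e by case/andP: a.
  rewrite htp_nd_act // d0_nd htpD htp_sn htpD !htp_nd_act // n andbT.
  case: (eqVneq s p) => [->|sp].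
    rewrite hi_p htp0 /= d0_nd eqxx n /=; zmod.
  case/andP: a; rewrite (negPf sp) /= => /eqP -> _.
  rewrite eqxx d00 htp_nd_act ?eqxx; last by rewrite /acts eqxx n.
  by rewrite /= addr0 oppr0 addr0 add0r.
have q : (s == hi) && nrmo o e = false.
  by apply: contraNF a => /andP[/eqP e1 e2]; rewrite /acts e1 e2 eqxx orbT.
case: (boolP (has_active (Some (false, e)) l)) => al /=.
  move=> _; have sl : span_of (has_active (Some (false, e))) << l >> by apply: span_ofU.
  have sd : span_of (has_active (Some (false, e))) (d0 (Some (false, e)) << l >>).
    by apply: span_of_sub (hd _) => t' /(same_tree_active (Some (false, e))) ->.
  rewrite htp_ndl // d0_sn !d0_nd q !add0r htp_sn htpD !htp_ndl //; last exact: span_of_tw.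
  rewrite -[in nd s e << l >> _](hl _ al) ndDl tw_htp ndNl.
  by case: (s == hi) => /=; zmod.
move=> ar; have sl : span_of (fun t => ~~ has_active (Some (false, e)) t) << l >> by apply: span_ofU.
rewrite htp_ndr // d0_sn !d0_nd q !add0r d0_inactive // nd0l add0r htp_sn htp_ndr //; last exact: span_of_tw.
rewrite !twK (_ : d0 _ (tw << l >>) = 0); last by rewrite twU d0_sn d0_inactive // sn0.
by rewrite nd0l add0r -[in RHS](hr _ ar) ndDr; case: (s == hi) => /=; zmod.
Qed.

(** Uncutting an edge that is not normal makes a tree that is not normal. *)
Lemma dd_d0 o t : valid_in o t ->
  span_of (fun t' => same_tree S t t' /\ ~~ valid_in o t') (dd << t >> - d0 o << t >>).
Proof.
elim: t o => [a|s e l hl r hr] o /=; first by rewrite ddU d0U subrr => _; apply: in_span0.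
case/and3P=> v0 vl vr; rewrite -ndU dd_nd d0_nd.
rewrite (_ : _ - _ = (if (s == hi) && ~~ nrmo o e then << CN p e l r >> else 0) +
  sn (s == hi) (nd s e (dd << l >> - d0 (Some (false, e)) << l >>) << r >> +
                nd s e (tw << l >>) (dd << r >> - d0 (Some (true, e)) << r >>))); last first.
  rewrite ndBl ndBr ndU; case: (s == hi); case: (nrmo o e) => /=; zmod.
apply: subgD; first exact: subg_span_of.
  case: (eqVneq s hi) => [->|_] /=; last exact: in_span0.
  case: ifP => [n|_]; last exact: in_span0.
  apply: span_ofU; split; last by rewrite /= eqxx (negPf n).
  by split=> /=; [rewrite hi_p eqxx | rewrite eqxx p_hi].
apply: (subg_sn (subg_span_of _)); apply: subgD; first exact: subg_span_of.
  apply: (span_of_nd _ (hl _ vl) (eq_span_of r)) => l' _ [[h1 h2] h3] <-; split.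
    by split=> /=; [rewrite h1 | rewrite h2; lia].
  by rewrite /= (negPf h3) andbF.
apply: (span_of_nd _ (span_of_tw (eq_span_of l)) (hr _ vr)) => _ r' <- [[h1 h2] h3]; split.
  by split=> /=; [rewrite h1 | rewrite h2; lia].
by rewrite /= (negPf h3) !andbF.
Qed.

Lemma d0_valid o t : valid_in o t ->
  span_of (fun t' => same_tree S t t' /\ valid_in o t') (d0 o << t >>).
Proof.
elim: t o => [a|s e l hl r hr] o /=; first by rewrite d0U => _; apply: in_span0.
case/and3P=> v0 vl vr; rewrite -ndU d0_nd; apply: subgD; first exact: subg_span_of.
  case: (eqVneq s hi) => [->|_] /=; last exact: in_span0.
  case: ifP => [n|_]; last exact: in_span0.
  rewrite ndU; apply: span_ofU; split; last by rewrite /= eqxx n vl.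
  by split=> /=; [rewrite hi_p eqxx | rewrite eqxx p_hi].
apply: (subg_sn (subg_span_of _)); apply: subgD; first exact: subg_span_of.
  apply: (span_of_nd _ (hl _ vl) (eq_span_of r)) => l' _ [[h1 h2] h3] <-; split.
    by split=> /=; [rewrite h1 | rewrite h2; lia].
  by rewrite /= v0 h3.
apply: (span_of_nd _ (span_of_tw (eq_span_of l)) (hr _ vr)) => _ r' <- [[h1 h2] h3]; split.
  by split=> /=; [rewrite h1 | rewrite h2; lia].
by rewrite /= v0 vl.
Qed.

Lemma htp_valid o t : valid_in o t ->
  span_of (fun t' => [/\ same_tree S t' t, valid_in o t' & has_active o t']) (htp o << t >>).
Proof.
elim: t o => [a|s e l hl r hr] o /=; first by rewrite htpU => _; apply: in_span0.
case/and3P=> v0 vl vr; rewrite htpU /=; case: ifP => [a|na].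
  have n : nrmo o e by case/andP: a.
  case: (eqVneq s p) => [->|_]; last exact: in_span0.
  apply: span_ofU; split=> /=.
  - by split=> /=; [rewrite eqxx hi_p | rewrite eqxx p_hi].
  - by rewrite p_hi vl.
  - by rewrite /acts eqxx orbT n.
apply: (subg_sn (subg_span_of _)); case: ifP => al.
  rewrite -htpU; apply: (span_of_nd _ (hl _ vl) (eq_span_of r)) => l' _ [[h1 h2] h3 h4] <-; split.
  - by split=> /=; [rewrite h1 | rewrite h2; lia].
  - by rewrite /= v0 h3.
  - by rewrite /= h4 orbT.
rewrite -htpU; apply: (span_of_nd _ (span_of_tw (eq_span_of l)) (hr _ vr)) => _ r' <- [[h1 h2] h3 h4]; split.
- by split=> /=; [rewrite h1 | rewrite h2; lia].
- by rewrite /= v0 vl h3.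
- by rewrite /= h4 !orbT.
Qed.

(** This is where the number of uncut edges enters: in a normal tree an uncut
    edge is active. *)
Lemma valid_active o t : valid_in o t -> (0 < count_state p t)%N -> has_active o t.
Proof.
elim: t o => //= s e l hl r hr o /and3P[v0 vl vr].
rewrite /acts; case: (eqVneq s p) v0 => [-> /= ->//|_ _] /=.
rewrite add0n addn_gt0 => /orP[h|h]; first by rewrite hl ?orbT.
by rewrite (hr _ vr h) !orbT.
Qed.

(** In the hypotheses, K is the subgroup of relations, U the class of trees
    under consideration and mu the rank that decreases under rewriting. *)
Section Criterion.
Variables (K : chain -> Prop) (U : cell -> Prop) (mu : cell -> nat).
Hypothesis K_subg : subg K.
Hypothesis K_dd : forall x, K x -> K (dd x).
Hypothesis U_forget : forall t t', forget t = forget t' -> U t -> U t'.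
Hypothesis mu_forget : forall t t', forget t = forget t' -> mu t = mu t'.
Hypothesis rewriting : forall t, U t -> ~~ valid_in None t ->
  exists2 x, span_of (fun t' => [/\ U t', count_state p t' = count_state p t & (mu t' < mu t)%N]) x &
    K (<< t >> - x).
Hypothesis independent : forall x,
  span_of (fun t => U t /\ valid_in None t) x -> K x -> x = 0.

Definition normal_cell N j t :=
  [/\ U t, valid_in None t, count_state p t = j & (mu t < N)%N].

Lemma reducible_subg (G : chain -> Prop) : subg G ->
  subg (fun x => exists2 z, G z & K (x - z)).
Proof.
move=> hG; split=> [|x y [x' hx hx'] [y' hy hy']].
  by exists 0; rewrite ?subr0; [apply: hG.1 | apply: K_subg.1].
by exists (x' - y'); [apply: subgB | apply: subgBB].
Qed.

Lemma reducible_span (P : cell -> Prop) (G : chain -> Prop) x :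
  subg G -> span_of P x -> (forall t, P t -> exists2 z, G z & K (<< t >> - z)) ->
  exists2 z, G z & K (x - z).
Proof. by move=> hG hx h; apply: (span_of_ind (reducible_subg hG) h hx). Qed.

Lemma normal_cell_sub N N' j t : (N <= N')%N -> normal_cell N j t -> normal_cell N' j t.
Proof. by move=> h [h1 h2 h3 h4]; split=> //; apply: leq_trans h4 h. Qed.

(** Rewriting terminates since the rank decreases. The bound on the rank that
    [normal_cell] carries is what the induction of [normal_exact] consumes. *)
Lemma reduce_cell t : U t ->
  exists2 z, span_of (normal_cell (mu t).+1 (count_state p t)) z & K (<< t >> - z).
Proof.
have [n] := ubnP (mu t); elim: n t => // n IHn t hn hU.
case: (boolP (valid_in None t)) => v.
  by exists << t >>; [apply: span_ofU | rewrite subrr; apply: K_subg.1].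
have [x hx hxK] := rewriting hU v.
have [z hz hzK] : exists2 z, span_of (normal_cell (mu t).+1 (count_state p t)) z & K (x - z).
  apply: (reducible_span (subg_span_of _) hx).
  move=> t' [h1 h2 h3]; have [|z hz hzK] := IHn t' _ h1; first by lia.
  exists z => //; apply: span_of_sub hz => u; rewrite h2; apply: normal_cell_sub.
  exact: ltnW.
by exists z => //; apply: subg_trans hxK hzK.
Qed.

(** Compared with [reduce_cell], a tree that is not normal loses rank. *)
Lemma reduce_bad N j x :
  span_of (fun t => [/\ U t, ~~ valid_in None t, count_state p t = j & (mu t < N.+1)%N]) x ->
  exists2 z, span_of (normal_cell N j) z & K (x - z).
Proof.
move=> hx0; apply: (reducible_span (subg_span_of _) hx0) => {hx0}.
move=> t [hU v hj hN]; have [x' hx hxK] := rewriting hU v.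
have [z hz hzK] : exists2 z, span_of (normal_cell N j) z & K (x' - z).
  apply: (reducible_span (subg_span_of _) hx).
  move=> t' [h1 h2 h3]; have [z hz hzK] := reduce_cell h1.
  exists z => //; apply: span_of_sub hz => u; rewrite h2 hj; apply: normal_cell_sub; lia.
by exists z => //; apply: subg_trans hxK hzK.
Qed.

Lemma reduce_chain j x :
  span_of (fun t => U t /\ count_state p t = j) x ->
  exists2 z, span_of (fun t => exists N, normal_cell N j t) z & K (x - z).
Proof.
move=> hx0; apply: (reducible_span (subg_span_of _) hx0) => {hx0}.
move=> t [hU <-]; have [z hz hzK] := reduce_cell hU; exists z => //.
by apply: span_of_sub hz => u hu; exists (mu t).+1.
Qed.

Lemma span_of_bound j z : span_of (fun t => exists N, normal_cell N j t) z ->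
  exists N, span_of (normal_cell N j) z.
Proof.
elim=> [_ [t [N hN] ->]||x y _ [N hx] _ [N' hy]].
- by exists N; apply: span_ofU.
- by exists 0%N; apply: in_span0.
- exists (maxn N N'); apply: in_spanB.
    by apply: span_of_sub hx => t; apply/normal_cell_sub/leq_maxl.
  by apply: span_of_sub hy => t; apply/normal_cell_sub/leq_maxr.
Qed.

Lemma same_tree_U c t t' : same_tree c t t' -> U t -> U t'.
Proof. by move=> [h _]; apply: U_forget. Qed.

Lemma same_tree_mu c t t' : same_tree c t t' -> mu t' = mu t.
Proof. by move=> [h _]; apply: mu_forget. Qed.

(** Filter by the rank. Modulo relations, dd and d0 agree up to lower rank, so
    that x and dd (htp x) differ by a chain of lower rank. This uses that d0 x
    itself has lower rank: x being a cycle modulo relations, d0 x is congruent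
    to a normal chain of lower rank, and by independence it is equal to it. *)
Lemma normal_exact N j x : span_of (normal_cell N j.+1) x -> K (dd x) ->
  exists2 y, span_of (fun t => normal_cell N j t /\ has_active None t) y & K (x - dd y).
Proof.
elim: N x => [|N IHN] x hx hK.
  exists 0; rewrite ?dd0 ?subr0; first exact: in_span0.
  apply: span_of_ind hx => [|t []] //; exact: K_subg.
have hh : span_of (fun t => normal_cell N.+1 j t /\ has_active None t) (htp None x).
  apply: span_of_lift hx; first exact: subg_span_of.
  move=> t [h1 h2 h3 h4]; rewrite -htpU.
  apply: span_of_sub (htp_valid h2) => t' [st v' a']; split=> //.
  case: (st) => sf sc; split=> //.
  - exact: U_forget h1.
  - by move: h3; rewrite sc => -[].
  - by rewrite -(mu_forget sf).
have hom : d0 None (htp None x) + htp None (d0 None x) = x.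
  apply: (span_of_ind (G := fun x => d0 None (htp None x) + htp None (d0 None x) = x)) hx.
    split=> [|u w hu hw]; first by rewrite d00 htp0 d00 addr0.
    by rewrite !(d0B, htpB) -[in RHS]hu -[in RHS]hw; zmod.
  by move=> t [_ h2 h3 _]; apply: homotopy; apply: valid_active => //; rewrite h3.
have d1E (k M : nat) w : span_of (normal_cell M.+1 k) w ->
    exists2 z, span_of (normal_cell M k.+1) z & K (dd w - d0 None w - z).
  move=> hw; apply: reduce_bad.
  apply: (span_of_ind (G := fun w => span_of _ (dd w - d0 None w))) hw.
    split=> [|u v hu hv]; first by rewrite dd0 d00 subr0; apply: in_span0.
    rewrite (_ : _ - _ = (dd u - d0 None u) - (dd v - d0 None v)); first exact: in_spanB.
    by rewrite ddB d0B; zmod.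
  move=> t [h1 h2 h3 h4]; apply: span_of_sub (dd_d0 h2) => t' [st nv]; split=> //.
  - exact: same_tree_U st h1.
  - by case: st => _ ->; rewrite h3.
  - by rewrite (same_tree_mu st).
have [z1 hz1 hz1K] := d1E _ _ _ hx.
have d0E : d0 None x = - z1.
  apply/eqP; rewrite -subr_eq0 opprK; apply/eqP; apply: independent; last first.
    by have := subgB K_subg hK hz1K; rewrite (_ : _ - _ = d0 None x + z1) //; zmod.
  apply: in_spanD; last by apply: span_of_sub hz1 => t [].
  apply: span_of_lift hx; first exact: subg_span_of.
  move=> t [h1 h2 _ _]; rewrite -d0U.
  by apply: span_of_sub (d0_valid h2) => t' [/same_tree_U hU ?]; split=> //; apply: hU.
have [z2 hz2 hz2K] := d1E _ _ (htp None x) (span_of_sub (fun t h => proj1 h) hh).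
pose x1 := htp None (d0 None x) - z2.
have hx1 : span_of (normal_cell N j.+1) x1.
  apply: in_spanB => //; rewrite d0E htpN; apply: in_spanN.
  apply: span_of_lift hz1; first exact: subg_span_of.
  move=> t [h1 h2 h3 h4]; rewrite -htpU.
  apply: span_of_sub (htp_valid h2) => t' [st v' a'].
  case: (st) => sf sc; split=> //.
  - exact: U_forget h1.
  - by move: h3; rewrite sc => -[].
  - by rewrite -(mu_forget sf).
have kx1 : K (x - dd (htp None x) - x1).
  rewrite (_ : x - _ - _ = - (dd (htp None x) - d0 None (htp None x) - z2)).
    exact: subgN.
  by rewrite -[in LHS]hom /x1 hom; move: hom; set a := d0 _ (htp _ _); set b := htp _ (d0 _ _) => <-; zmod.
have [|y1 hy1 hy1K] := IHN _ hx1.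
  rewrite (_ : dd x1 = dd x - dd (x - dd (htp None x) - x1)); last by rewrite !ddB ddK; zmod.
  by apply: subgB => //; apply: K_dd.
exists (htp None x + y1).
  apply: in_spanD => //; apply: span_of_sub hy1 => t [h1 h2]; split=> //.
  exact: normal_cell_sub h1.
rewrite ddD (_ : _ - _ = (x - dd (htp None x) - x1) + (x1 - dd y1)); last by zmod.
exact: subgD.
Qed.

Theorem quadratic_exact j x : span_of (fun t => U t /\ count_state p t = j.+1) x ->
  K (dd x) ->
  exists2 y, span_of (fun t => U t /\ count_state p t = j) y & K (x - dd y).
Proof.
move=> /reduce_chain[z /span_of_bound[N hz] hzK] hK.
have [|y hy hyK] := normal_exact hz.
  rewrite (_ : dd z = dd x - dd (x - z)); last by rewrite ddB; zmod.
  by apply: subgB => //; apply: K_dd.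
exists y; last exact: subg_trans hzK hyK.
by apply: span_of_sub hy => t [[]].
Qed.

End Criterion.
End PBW.

(** * Relations between marked trees *)

Section Relations.
Variables (E : choiceType) (A : Type) (p : nat) (R : free_ns E 2 -> Prop).
Local Notation cell := (cell E A).
Local Notation chain := {freeg cell / int}.
Local Notation hi := p.+1.
Local Notation tw := (@tw E A p).
Local Notation dd := (@dd E A p).
Implicit Types (x y z : chain).

(** A composite of two generators is placed in a marked tree: the edge between
    its vertices is uncut, s is the mark above it, and x, y, z are grafted on
    its three inputs. *)
Definition graft3 s (t : btree E) x y z : chain :=
  match t with
  | BNode e (BNode e' _ _) BLeaf => nd s e (nd p e' x y) z
  | BNode e BLeaf (BNode e' _ _) => nd s e x (nd p e' y z)
  | _ => 0
  end.

Definition graft_rel s (u : free_ns E 2) x y z : chain :=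
  fglift (fun t : bt_of E 2 => graft3 s t x y z) u.

(** Marks above and around a relator are arbitrary; on trees whose internal edges
    are all uncut this is the operadic ideal generated by R. *)
Inductive rel_ideal : chain -> Prop :=
| rel_gen s u a b c : R u -> rel_ideal (graft_rel s u << a >> << b >> << c >>)
| rel_ndl s e x r : rel_ideal x -> rel_ideal (nd s e x << r >>)
| rel_ndr s e l y : rel_ideal y -> rel_ideal (nd s e << l >> y)
| rel0 : rel_ideal 0
| relB x y : rel_ideal x -> rel_ideal y -> rel_ideal (x - y).

Lemma rel_subg : subg rel_ideal.
Proof. by split; [apply: rel0 | apply: relB]. Qed.

Lemma rel_nd_l s e x y : rel_ideal x -> rel_ideal (nd s e x y).
Proof.
move=> hx; elim/freeg_basis_ind: y => [r||y y' hy hy']; first exact: rel_ndl.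
- by rewrite nd0r; apply: rel0.
- by rewrite ndBr; apply: relB.
Qed.

Lemma rel_nd_r s e x y : rel_ideal y -> rel_ideal (nd s e x y).
Proof.
move=> hy; elim/freeg_basis_ind: x => [l||x x' hx hx']; first exact: rel_ndr.
- by rewrite nd0l; apply: rel0.
- by rewrite ndBl; apply: relB.
Qed.

Lemma graft3B1 s t x x' y z : graft3 s t (x - x') y z = graft3 s t x y z - graft3 s t x' y z.
Proof.
case: t => [|e [|e' l r] [|e'' l' r']] /=; rewrite ?subr0 //.
  by rewrite ndBl.
by rewrite !ndBl.
Qed.
Lemma graft3B2 s t x y y' z : graft3 s t x (y - y') z = graft3 s t x y z - graft3 s t x y' z.
Proof.
case: t => [|e [|e' l r] [|e'' l' r']] /=; rewrite ?subr0 //.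
  by rewrite ndBl ndBr.
by rewrite !ndBr ndBl.
Qed.
Lemma graft3B3 s t x y z z' : graft3 s t x y (z - z') = graft3 s t x y z - graft3 s t x y z'.
Proof.
case: t => [|e [|e' l r] [|e'' l' r']] /=; rewrite ?subr0 //.
  by rewrite !ndBr.
by rewrite ndBr.
Qed.

Lemma graft_relB1 s u x x' y z : graft_rel s u (x - x') y z = graft_rel s u x y z - graft_rel s u x' y z.
Proof. by rewrite -fglift_sub; congr fglift; apply/funext => t; rewrite graft3B1. Qed.
Lemma graft_relB2 s u x y y' z : graft_rel s u x (y - y') z = graft_rel s u x y z - graft_rel s u x y' z.
Proof. by rewrite -fglift_sub; congr fglift; apply/funext => t; rewrite graft3B2. Qed.
Lemma graft_relB3 s u x y z z' : graft_rel s u x y (z - z') = graft_rel s u x y z - graft_rel s u x y z'.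
Proof. by rewrite -fglift_sub; congr fglift; apply/funext => t; rewrite graft3B3. Qed.

Lemma rel_graft s u x y z : R u -> rel_ideal (graft_rel s u x y z).
Proof.
move=> hu; elim/freeg_basis_ind: x => [a||x x' hx hx'].
- elim/freeg_basis_ind: y => [b||y y' hy hy'].
  + elim/freeg_basis_ind: z => [c||z z' hz hz']; first exact: rel_gen.
      by rewrite -(subrr 0) graft_relB3 subrr; apply: rel0.
    by rewrite graft_relB3; apply: relB.
  + by rewrite -(subrr 0) graft_relB2 subrr; apply: rel0.
  + by rewrite graft_relB2; apply: relB.
- by rewrite -(subrr 0) graft_relB1 subrr; apply: rel0.
- by rewrite graft_relB1; apply: relB.
Qed.

Variant bt2_spec : btree E -> Prop :=
| Bt2Left e e' : bt2_spec (BNode e (BNode e' (BLeaf E) (BLeaf E)) (BLeaf E))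
| Bt2Right e e' : bt2_spec (BNode e (BLeaf E) (BNode e' (BLeaf E) (BLeaf E))).

Lemma bt2P (t : bt_of E 2) : bt2_spec t.
Proof.
case: t => t /=; case: t => [|e [|e1 [|? ? ?] [|? ? ?]] [|e2 [|? ? ?] [|? ? ?]]] //= h;
  first [constructor | by exfalso; move: h; lia].
Qed.

Lemma fglift_map (K1 : choiceType) (M N : lmodType int) (g : {additive M -> N}) (f : K1 -> M) u :
  g (fglift f u) = fglift (fun k => g (f k)) u.
Proof.
elim/freeg_basis_ind: u => [k||u v hu hv].
- by rewrite !fgliftU.
- by rewrite !fglift0 raddf0.
- by rewrite !fgliftB raddfB hu hv.
Qed.

Lemma fglift_sn (K1 : choiceType) (M : lmodType int) (f : K1 -> M) b u :
  fglift (fun k => sn b (f k)) u = sn b (fglift f u).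
Proof.
case: b => //=; elim/freeg_basis_ind: u => [k||u v hu hv].
- by rewrite !fgliftU.
- by rewrite !fglift0 oppr0.
- by rewrite !fgliftB hu hv; zmod.
Qed.

Lemma tw_graft s u x y z :
  tw (graft_rel s u x y z) = sn (s == hi) (graft_rel s u (tw x) (tw y) (tw z)).
Proof.
rewrite (fglift_map tw) -fglift_sn; congr fglift; apply/funext => t.
by case: (bt2P t) => e e' /=; rewrite !tw_nd hi_p.
Qed.

(** The edge inside a relator is uncut, so the differential never meets it. *)
Lemma dd_graft s u x y z : dd (graft_rel s u x y z) =
  (if s == hi then graft_rel p u x y z else 0) +
  sn (s == hi) (graft_rel s u (dd x) y z + graft_rel s u (tw x) (dd y) z +
                graft_rel s u (tw x) (tw y) (dd z)).
Proof.
rewrite (fglift_map dd) -!fglift_add -fglift_sn.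
rewrite (_ : (if _ then _ else 0) = fglift (fun t : bt_of E 2 => if s == hi then graft3 p t x y z else 0) u).
  rewrite -fglift_add; congr fglift; apply/funext => t.
  case: (bt2P t) => e e' /=; rewrite !(dd_nd, tw_nd) hi_p /= ?add0r.
    by congr (_ + sn _ _); rewrite ndDl.
  by congr (_ + sn _ _); rewrite ndDr addrA.
case: ifP => // _; elim/freeg_basis_ind: u => [k||u v hu hv]; rewrite ?fgliftU ?fglift0 //.
by rewrite fgliftB -hu -hv subr0.
Qed.

Lemma rel_tw x : rel_ideal x -> rel_ideal (tw x).
Proof.
elim=> {x} [s u a b c hu|s e x r _ hx|s e l y _ hy||x y _ hx _ hy].
- by rewrite tw_graft; apply: (subg_sn rel_subg); apply: rel_graft.
- by rewrite tw_nd; apply: (subg_sn rel_subg); apply: rel_nd_l.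
- by rewrite tw_nd; apply: (subg_sn rel_subg); apply: rel_nd_r.
- by rewrite tw0; apply: rel0.
- by rewrite twB; apply: relB.
Qed.

Lemma rel_dd x : rel_ideal x -> rel_ideal (dd x).
Proof.
have relD := subgD rel_subg.
elim=> {x} [s u a b c hu|s e x r hx hdx|s e l y hy hdy||x y _ hx _ hy].
- rewrite dd_graft; apply: (relD).
    by case: ifP => _; [apply: rel_graft | apply: rel0].
  apply: (subg_sn rel_subg); apply: (relD); last exact: rel_graft.
  by apply: (relD); apply: rel_graft.
- rewrite dd_nd; apply: (relD).
    by case: ifP => _; [apply: rel_ndl | apply: rel0].
  apply: (subg_sn rel_subg); apply: (relD); first exact: rel_ndl.
  by apply/rel_nd_l/rel_tw.
- rewrite dd_nd; apply: (relD).
    by case: ifP => _; [apply: rel_ndr | apply: rel0].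
  apply: (subg_sn rel_subg); apply: (relD); first exact: rel_nd_r.
  exact: rel_nd_r.
- by rewrite dd0; apply: rel0.
- by rewrite ddB; apply: relB.
Qed.

End Relations.

(** * Masks *)

Section Masks.
Variables (E I : finType) (lm rm : E -> {set I}) (mk : {set I} -> {set I} -> E).
Hypothesis lm_rm : forall e, lm e :|: rm e = setT.
Hypothesis lm_mk : forall L R, L :|: R = setT -> lm (mk L R) = L.
Hypothesis rm_mk : forall L R, L :|: R = setT -> rm (mk L R) = R.
Hypothesis mk_eta : forall e, mk (lm e) (rm e) = e.

Local Notation masks := ({set I} * {set I} * {set I})%type.

(** A coordinate that the composite passes to its first operation is passed on
    to an input of the second one. *)
Definition left_masks e e' : masks := (lm e :&: lm e', lm e :&: rm e', rm e).
Definition right_masks e e' : masks := (lm e, rm e :&: lm e', rm e :&: rm e').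

Definition tree_masks (t : btree E) : masks :=
  match t with
  | BNode e (BNode e' _ _) BLeaf => left_masks e e'
  | BNode e BLeaf (BNode e' _ _) => right_masks e e'
  | _ => (set0, set0, set0)
  end.

Definition masks_of (x : free_ns E 2) : {freeg masks / int} :=
  fglift (fun t : bt_of E 2 => << tree_masks t >> : {freeg masks / int}) x.

(** The pairs that are normal for the white operads; b tells a right child from
    a left child. *)
Definition standard (b : bool) e e' := b && (rm e' \subset rm e).

(** The only normal composite with masks S. On the coordinates that do not reach
    the child, its left mask is full and its right mask empty, the choice that
    makes rm of the child as small as possible. *)
Definition std_root (S : masks) : E := mk S.1.1 (S.1.2 :|: S.2).
Definition std_child (S : masks) : E := mk (S.1.2 :|: ~: (S.1.2 :|: S.2)) S.2.

Lemma left_masksT e e' : let S := left_masks e e' in S.1.1 :|: (S.1.2 :|: S.2) = setT.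
Proof. by rewrite /= setUA -setIUr lm_rm setIT lm_rm. Qed.

Lemma right_masksT e e' : let S := right_masks e e' in S.1.1 :|: (S.1.2 :|: S.2) = setT.
Proof. by rewrite /= -setIUr lm_rm setIT lm_rm. Qed.

Lemma std_childT (S : masks) : (S.1.2 :|: ~: (S.1.2 :|: S.2)) :|: S.2 = setT.
Proof. by rewrite setUAC setUCr. Qed.

Lemma std_masks (S : masks) : S.1.1 :|: (S.1.2 :|: S.2) = setT ->
  right_masks (std_root S) (std_child S) = S.
Proof.
case: S => [[s1 s2] s3] /= h; rewrite /right_masks /std_root /std_child /=.
rewrite lm_mk // rm_mk // lm_mk ?(std_childT (s1, s2, s3)) // rm_mk ?(std_childT (s1, s2, s3)) //.
by congr (_, _, _); apply/setP => i; rewrite !inE; case: (i \in s2); case: (i \in s3).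
Qed.

Lemma std_standard (S : masks) : S.1.1 :|: (S.1.2 :|: S.2) = setT ->
  standard true (std_root S) (std_child S).
Proof. by move=> h; rewrite /standard /= !rm_mk ?std_childT // subsetUr. Qed.

(** The masks of a right comb determine its root, and its child inside the right
    mask of the root; what is left is the part of the right mask of the
    child outside that of the root, which is empty exactly for the standard
    comb. *)
Lemma right_masks_inj e1 e1' e2 e2' : right_masks e1 e1' = right_masks e2 e2' ->
  standard true e1 e1' -> e1 = e2 /\ (if standard true e2 e2' then e1' = e2' else
    (#|rm e1'| < #|rm e2'|)%N).
Proof.
move=> [hl h2 h3]; rewrite /standard /= => s1.
have hr : rm e1 = rm e2.
  by rewrite -[LHS]setIT -(lm_rm e1') setIUr h2 h3 -setIUr lm_rm setIT.
have h3' : rm e1' = rm e1 :&: rm e2' by rewrite hr -h3; apply/esym/setIidPr.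
split; first by rewrite -(mk_eta e1) -(mk_eta e2) hl hr.
case: ifP => s2.
  have e3 : rm e1' = rm e2' by rewrite h3' hr; apply/setIidPr.
  rewrite -(mk_eta e1') -(mk_eta e2') e3; congr (mk _ _).
  have hC e : forall i, (i \in lm e) || (i \in rm e).
    by move=> i; move: (lm_rm e) => /setP/(_ i); rewrite !inE.
  apply/setP => i; move: h2 => /setP/(_ i); rewrite !inE hr.
  have := hC e1' i; have := hC e2' i; rewrite e3.
  case: (boolP (i \in rm e2')) => [|_]; last by rewrite !orbF => -> ->.
  by move/(subsetP s2) ->.
apply: proper_card; rewrite properE h3' subsetIr /=.
by apply: contraFN s2 => /subsetP h; apply/subsetP => i /h; rewrite inE hr => /andP[].
Qed.

Section Trees.
Variables (A : Type) (a0 : A).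
Local Notation cell := (cell E A).
Local Notation chain := {freeg cell / int}.
Implicit Types (t l r : cell) (x y : chain).

(** ** The order on marked trees *)

(** Replacing a left comb by a right comb decreases the sum of the sizes of the
    left subtrees; replacing a right comb by the standard one keeps it and
    decreases the total size of the right masks. *)
Fixpoint left_size t : nat :=
  if t is CN _ _ l r then (cell_size l + (left_size l + left_size r))%N else 0.
Fixpoint rm_size t : nat :=
  if t is CN _ e l r then (#|rm e| + (rm_size l + rm_size r))%N else 0.

Definition lex_lt t' t : bool :=
  (left_size t' < left_size t)%N || (left_size t' == left_size t) && (rm_size t' < rm_size t)%N.

(** What every rewriting step preserves. *)
Definition same_marks t t' : Prop :=
  [/\ leaf_seq t' = leaf_seq t, root_state t' = root_state t &
      forall q, count_state q t' = count_state q t].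

Lemma same_marks_size t t' : same_marks t t' -> cell_size t' = cell_size t.
Proof. by move=> [h _ _]; have := size_leaf_seq t; rewrite -h size_leaf_seq => -[]. Qed.

(** The lexicographic order as one number, for trees of a given size: rm_size is
    at most #|I| * cell_size. *)
Definition cell_rank t : nat := (left_size t * (#|I| * cell_size t).+1 + rm_size t)%N.

Lemma rm_size_le t : (rm_size t <= #|I| * cell_size t)%N.
Proof.
elim: t => //= _ e l hl r hr; rewrite mulnS mulnDr.
by apply: leq_add; [apply: max_card | apply: leq_add].
Qed.

Lemma left_size_le t : (left_size t <= cell_size t * cell_size t)%N.
Proof.
elim: t => //= _ e l; set a := left_size l => hl r; set b := left_size r => hr.
have := leq0n (cell_size l * cell_size r); lia.
Qed.

(** The black rewriting increases the rank; an upper bound turns the rank around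
    for it. *)
Definition rank_bound w : nat := (w * w * (#|I| * w).+1 + #|I| * w)%N.

Lemma cell_rank_le t : (cell_rank t <= rank_bound (cell_size t))%N.
Proof. by rewrite leq_add ?rm_size_le // leq_mul2r left_size_le orbT. Qed.

Lemma cell_rank_lt t t' : cell_size t' = cell_size t -> lex_lt t' t -> (cell_rank t' < cell_rank t)%N.
Proof.
move=> h /orP[|/andP[/eqP h1 h2]]; rewrite /cell_rank h; last by rewrite h1 ltn_add2l.
have := rm_size_le t'; rewrite h => h1 h2.
have : (left_size t' * (#|I| * cell_size t).+1 + (#|I| * cell_size t).+1 <= left_size t * (#|I| * cell_size t).+1)%N.
  by rewrite -mulSnr leq_mul2r h2 orbT.
by lia.
Qed.

Lemma forget_size p t : cell_size (forget p t) = cell_size t.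
Proof. by elim: t => //= _ e l -> r ->. Qed.

Lemma forget_leaf_seq p t : leaf_seq (forget p t) = leaf_seq t.
Proof. by elim: t => //= _ e l -> r ->. Qed.

Lemma forget_left_size p t : left_size (forget p t) = left_size t.
Proof. by elim: t => //= _ e l -> r ->; rewrite forget_size. Qed.

Lemma forget_rm_size p t : rm_size (forget p t) = rm_size t.
Proof. by elim: t => //= _ e l -> r ->. Qed.

Lemma forget_rank p t : cell_rank (forget p t) = cell_rank t.
Proof. by rewrite /cell_rank forget_size forget_left_size forget_rm_size. Qed.

Lemma rank_forget p t t' : forget p t = forget p t' -> cell_rank t = cell_rank t'.
Proof. by move=> h; rewrite -(forget_rank p) h forget_rank. Qed.

Lemma forget_count p q t : q != p -> q != p.+1 -> count_state q (forget p t) = count_state q t.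
Proof.
move=> qp qp1; elim: t => //= s e l -> r ->; congr (_ + _)%N.
by case: (eqVneq s p.+1) => [->|//]; rewrite eq_sym (negPf qp) eq_sym (negPf qp1).
Qed.

Lemma forget_root p t : root_state (forget p t) =
  if root_state t is Some s then Some (if s == p.+1 then p else s) else None.
Proof. by case: t. Qed.

(** A piece of the complex that is stable under the operators for p and under
    rewriting: the marks p and p + 1 may be exchanged, everything else that
    these operations preserve is prescribed, by t0 or by the condition L on
    the leaves. *)
Definition cell_class p (L : seq A -> Prop) t0 t : Prop :=
  [/\ L (leaf_seq t), root_state t = root_state t0 &
    forall q, q != p -> q != p.+1 -> count_state q t = count_state q t0].

(** The root edge takes no part in the differential. *)
Definition inert p t := (root_state t != Some p) && (root_state t != Some p.+1).

Lemma cell_class_forget p L t0 t t' : inert p t0 -> forget p t = forget p t' ->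
  cell_class p L t0 t -> cell_class p L t0 t'.
Proof.
move=> /andP[i1 i2] h [h1 h2 h3]; split.
- by rewrite -(forget_leaf_seq p) -h forget_leaf_seq.
- move: (congr1 (@root_state E A) h); rewrite !forget_root h2.
  move: i1 i2; case: (root_state t0) => [s|]; last by case: (root_state t').
  case: (root_state t') => [s'|//] /eqP i1 /eqP i2.
  by case: eqP => [e|_]; [rewrite e in i2 | case: eqP => _ [e]; [rewrite e in i1 | rewrite e]].
- by move=> q qp qp1; rewrite -(forget_count t' qp qp1) -h forget_count // h3.
Qed.

Lemma same_marks_class p L t0 t t' : same_marks t t' -> cell_class p L t0 t -> cell_class p L t0 t'.
Proof. by move=> [h1 h2 h3] [h4 h5 h6]; split; rewrite ?h1 ?h2 // => q qp qp1; rewrite h3 h6. Qed.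

Lemma same_marks_l s e l l' r : same_marks l l' -> same_marks (CN s e l r) (CN s e l' r).
Proof. by move=> [h1 h2 h3]; split=> //= [|q]; rewrite ?h1 ?h3. Qed.

Lemma same_marks_r s e l r r' : same_marks r r' -> same_marks (CN s e l r) (CN s e l r').
Proof. by move=> [h1 h2 h3]; split=> //= [|q]; rewrite ?h1 ?h3. Qed.

Lemma lex_lt_l s e l l' r : cell_size l' = cell_size l -> lex_lt l' l -> lex_lt (CN s e l' r) (CN s e l r).
Proof. by rewrite /lex_lt /= => ->; lia. Qed.

Lemma lex_lt_r s e l r r' : lex_lt r' r -> lex_lt (CN s e l r') (CN s e l r).
Proof. by rewrite /lex_lt /=; lia. Qed.

(** ** The white products *)

Section White.
Variable R : free_ns E 2 -> Prop.
Hypothesis R_masks : forall u, R u -> masks_of u = 0.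
Hypothesis R_same : forall t t' : bt_of E 2, tree_masks t = tree_masks t' -> R (<< t >> - << t' >>).
Local Notation K := (rel_ideal (A := A) 0 R).

(** A piece of a marked tree delimited by cut edges is evaluated to the list of
    its inputs, each one with its mask and the tree that hangs from it. *)
Definition restrict (L : {set I}) (ms : seq ({set I} * cell)) :=
  [seq (L :&: mk.1, mk.2) | mk <- ms].

Definition union_masks (ms : seq ({set I} * cell)) : {set I} :=
  foldr (fun mk U => mk.1 :|: U) set0 ms.

(** The standard right comb whose leaves carry the masks ms, after M has been
   added to the first mask. *)
Fixpoint comb s (M : {set I}) (ms : seq ({set I} * cell)) : cell :=
  match ms with
  | [::] => CL a0
  | (m, k) :: ms' =>
      if ms' is [::] then k else
      CN s (mk (m :|: M) (union_masks ms')) k (comb 0 (~: union_masks ms') ms')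
  end.

(** Below a cut edge a piece is complete: it is replaced by its normal form and
    becomes a single input of the piece above it. *)
Definition close s ms := if s == 0%N then ms else [:: (setT, comb s set0 ms)].

Fixpoint value t : seq ({set I} * cell) :=
  match t with
  | CL a => [:: (setT, CL a)]
  | CN s e l r => close s (restrict (lm e) (value l) ++ restrict (rm e) (value r))
  end.

Lemma restrict_restrict L L' ms : restrict L (restrict L' ms) = restrict (L :&: L') ms.
Proof. by elim: ms => //= -[m k] ms ->; rewrite setIA. Qed.

(** Since the value of a composite only depends on its masks, [values] vanishes
    on relations; since a normal tree can be read off from its value, it
    separates normal trees. *)
Definition values x : {freeg (seq ({set I} * cell)) / int} :=
  fglift (fun t => << value t >> : {freeg (seq ({set I} * cell)) / int}) x.

Definition value3 s (X Y Z : seq ({set I} * cell)) (S : masks) :=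
  close s (restrict S.1.1 X ++ restrict S.1.2 Y ++ restrict S.2 Z).

Lemma values_graft s u a b c :
  values (graft_rel 0 s u << a >> << b >> << c >>) =
  fglift (fun S => << value3 s (value a) (value b) (value c) S >> : {freeg _ / int}) (masks_of u).
Proof.
elim/freeg_basis_ind: u => [t||u v hu hv].
- rewrite /graft_rel /masks_of !fgliftU; case: (bt2P t) => e e' /=.
    rewrite !ndU /values fgliftU /= /value3 /= {1}/close /= /restrict map_cat -!/(restrict _ _).
    by rewrite !restrict_restrict -catA.
  rewrite !ndU /values fgliftU /= /value3 /= {1}/close /= /restrict map_cat -!/(restrict _ _).
  by rewrite !restrict_restrict.
- by rewrite /graft_rel /values /masks_of !fglift0.
- by rewrite /graft_rel /values /masks_of !fgliftB; move: hu hv; rewrite /values /masks_of => <- <-.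
Qed.

Lemma values_ndl s e x r : values (nd s e x << r >>) =
  fglift (fun X => << close s (restrict (lm e) X ++ restrict (rm e) (value r)) >> : {freeg _ / int}) (values x).
Proof.
elim/freeg_basis_ind: x => [l||x y hx hy].
- by rewrite ndU /values !fgliftU.
- by rewrite nd0l /values !fglift0.
- by rewrite ndBl /values !fgliftB; move: hx hy; rewrite /values => <- <-.
Qed.

Lemma values_ndr s e l x : values (nd s e << l >> x) =
  fglift (fun X => << close s (restrict (lm e) (value l) ++ restrict (rm e) X) >> : {freeg _ / int}) (values x).
Proof.
elim/freeg_basis_ind: x => [r||x y hx hy].
- by rewrite ndU /values !fgliftU.
- by rewrite nd0r /values !fglift0.
- by rewrite ndBr /values !fgliftB; move: hx hy; rewrite /values => <- <-.
Qed.

Lemma values_rel x : K x -> values x = 0.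
Proof.
elim=> {x} [s u a b c hu|s e x r _ hx|s e l x _ hx||x y _ hx _ hy].
- by rewrite values_graft R_masks // fglift0.
- by rewrite values_ndl hx fglift0.
- by rewrite values_ndr hx fglift0.
- exact: fglift0.
- by rewrite /values fgliftB; move: hx hy; rewrite /values => -> ->; rewrite subr0.
Qed.

(** A normal tree is its own value. The second part is the inductive step inside
    a piece: through a standard edge below e, the inputs of the right child
    keep their masks, whose union is rm e, and the comb on them gives back the
    child. The complement of rm e is added to the first mask because the
    standard child has full left mask outside of rm e. *)
Lemma value_valid t :
  (root_state t != Some 0%N -> forall o, valid_in 0 standard o t -> value t = [:: (setT, t)]) /\
  (forall e, valid_in 0 standard (Some (true, e)) t ->
    let y := restrict (rm e) (value t) in
    [/\ union_masks y = rm e, y <> [::] & comb 0 (~: rm e) y = t]).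
Proof.
have single e t' : let y := restrict (rm e) [:: (setT, t')] in
    [/\ union_masks y = rm e, y <> [::] & comb 0 (~: rm e) y = t'].
  by rewrite /= setIT setU0.
elim: t => [a|s e l [IHl _] r [_ IHr]]; first by split=> [//|e _]; apply: single.
have main o : valid_in 0 standard o (CN s e l r) ->
    value (CN s e l r) = close s ((lm e, l) :: restrict (rm e) (value r)).
  move=> /= /and3P[_ vl _]; rewrite (IHl _ _ vl) /= ?setIT //.
  by case: l vl {IHl} => //= s' e' l' r'; case: s'.
have first_part : s != 0%N -> forall o, valid_in 0 standard o (CN s e l r) ->
    value (CN s e l r) = [:: (setT, CN s e l r)].
  move=> s0 o v; rewrite (main _ v) /close (negPf s0); case/and3P: (v) => _ _ vr.
  have [h1 h2 h3] := IHr _ vr; rewrite /= setU0.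
  by case E1: (restrict _ _) h2 => [//|mk1 ms] _; rewrite -E1 h1 h3 mk_eta.
split=> [/= s0|e1 v]; first by apply: first_part; apply: contraNneq s0 => ->.
case: (eqVneq s 0%N) (v) => [s0 v0|s0 _]; last by rewrite (first_part s0 _ v); apply: single.
rewrite (main _ v) s0 /close /=; case/and3P: v0 => /= h0 _ vr.
have [h1 h2 h3] := IHr _ vr; rewrite s0 /= in h0.
rewrite restrict_restrict (setIidPr h0) h1; split=> //.
- apply/setP => i; move/subsetP: h0 => /(_ i); move: (lm_rm e) => /setP/(_ i); rewrite !inE.
  by case: (i \in lm e) => /=; case: (i \in rm e); rewrite ?andbT ?orbT ?andbF ?orbF //= => _ ->.
- case E1: (restrict _ _) h2 => [//|mk1 ms] _; rewrite -E1 h3.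
  congr (CN _ _ _ _); rewrite -[RHS]mk_eta; congr (mk _ _).
  apply/setP => i; move/subsetP: h0 => /(_ i); move: (lm_rm e) => /setP/(_ i); rewrite !inE.
  case: (i \in lm e) => /=; case: (i \in rm e); case: (i \in rm e1) => //= _ h; by have := h isT.
Qed.

Lemma white_independent x :
  span_of (fun t => root_state t != Some 0%N /\ valid_in 0 standard None t) x -> K x -> x = 0.
Proof.
move=> hx /values_rel h.
pose back (X : seq ({set I} * cell)) : chain := if X is [:: (_, t)] then << t >> else 0.
suff <- : fglift back (values x) = x by rewrite h fglift0.
apply: (span_of_ind (G := fun x => fglift back (values x) = x)) hx.
  split=> [|y z hy hz]; first by rewrite /values !fglift0.
  by rewrite /values !fgliftB; move: hy hz; rewrite /values => -> ->.
move=> t [r v]; rewrite /values !fgliftU.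
by have [h1 _] := value_valid t; rewrite (h1 r _ v).
Qed.

Definition bt2l e e' : bt_of E 2 :=
  @BtOf E 2 (BNode e (BNode e' (BLeaf E) (BLeaf E)) (BLeaf E)) (eqxx 2%N).
Definition bt2r e e' : bt_of E 2 :=
  @BtOf E 2 (BNode e (BLeaf E) (BNode e' (BLeaf E) (BLeaf E))) (eqxx 2%N).

Lemma rel_same s (t t' : bt_of E 2) a b c : tree_masks t = tree_masks t' ->
  K (graft3 0 s t << a >> << b >> << c >> - graft3 0 s t' << a >> << b >> << c >>).
Proof.
move=> /R_same/(rel_gen 0 s a b c); rewrite /graft_rel fgliftB !fgliftU; exact.
Qed.

(** A tree that is not normal has an uncut edge of a left child, or one that is
    not standard; the two vertices there are replaced by the standard comb with
    the same masks. *)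
Lemma white_step o t : ~~ valid_in 0 standard o t ->
  (root_state t == Some 0%N -> valid_in 0 standard o t || (if t is CN _ e _ _ then nrmo standard o e else true)) ->
  exists2 t', same_marks t t' /\ lex_lt t' t & K (<< t >> - << t' >>).
Proof.
elim: t o => //= s e l IHl r IHr o nv h0.
have {h0} h0 : (s == 0%N) ==> nrmo standard o e.
  by apply/implyP => /eqP s0; move: h0 nv; rewrite s0 eqxx => /(_ isT)/orP[->|].
move: nv; rewrite h0 /= => nv.
have hl : (exists e' a b, l = CN 0 e' a b) \/ root_state l != Some 0%N.
  by case: (l) => [a|[|s'] e' a b]; [right | left; exists e', a, b | right].
case: hl => [[e' [a [b El]]]|nl].
  rewrite El; pose S := left_masks e e'.
  exists (CN s (std_root S) a (CN 0 (std_child S) b r)); last first.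
    have := @rel_same s (bt2l e e') (bt2r (std_root S) (std_child S)) a b r.
    by rewrite /= !ndU; apply; rewrite std_masks //; apply: left_masksT.
  split; last by rewrite /lex_lt /=; lia.
  by split=> [||q] /=; rewrite ?catA //; lia.
have hr : (exists e' b c, r = CN 0 e' b c /\ ~~ standard true e e') \/
    (root_state r == Some 0%N -> if r is CN _ e' _ _ then standard true e e' else true).
- case: (r) => [a|[|s'] e' b c]; [by right| |by right].
  by case: (boolP (standard true e e')) => hs; [right | left; exists e', b, c].
case: hr => [[e' [b [c [Er ns]]]]|nr].
  rewrite Er; pose S := right_masks e e'.
  have ST : S.1.1 :|: (S.1.2 :|: S.2) = setT by apply: right_masksT.
  have [h1] := right_masks_inj (std_masks ST) (std_standard ST).
  rewrite (negPf ns) => h2.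
  exists (CN s (std_root S) l (CN 0 (std_child S) b c)); last first.
    have := @rel_same s (bt2r e e') (bt2r (std_root S) (std_child S)) l b c.
    by rewrite /= !ndU; apply; rewrite std_masks.
  split; last by rewrite /lex_lt /= h1; lia.
  by split=> [||q].
case: (boolP (valid_in 0 standard (Some (false, e)) l)) nv => vl /= nv.
  have [|t' [h1 h2] h3] := IHr _ nv.
    by move=> /nr; case: (r) => //= *; apply/orP; right.
  exists (CN s e l t'); first by split; [apply: same_marks_r | apply: lex_lt_r].
  by rewrite -!ndU -ndBr; apply: rel_nd_r.
have [|t' [h1 h2] h3] := IHl _ vl; first by rewrite (negPf nl).
exists (CN s e t' r).
  by split; [apply: same_marks_l | apply: lex_lt_l => //; apply: same_marks_size].
by rewrite -!ndU -ndBl; apply: rel_nd_l.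
Qed.

Lemma white_rewriting L t0 t : inert 0 t0 -> cell_class 0 L t0 t -> ~~ valid_in 0 standard None t ->
  exists2 x, span_of (fun t' => [/\ cell_class 0 L t0 t', count_state 0 t' = count_state 0 t &
    (cell_rank t' < cell_rank t)%N]) x & K (<< t >> - x).
Proof.
move=> /andP[i0 _] hc nv; have [|t' [h1 h2] h3] := white_step nv.
  by case: hc => _ -> _; rewrite (negPf i0).
exists << t' >> => //; apply: span_ofU; split.
- exact: same_marks_class h1 hc.
- by case: h1.
- by apply: cell_rank_lt h2; apply: same_marks_size.
Qed.

Lemma white_class_independent L t0 x : inert 0 t0 ->
  span_of (fun t => cell_class 0 L t0 t /\ valid_in 0 standard None t) x -> K x -> x = 0.
Proof.
move=> /andP[i0 _] hx; apply: white_independent; apply: span_of_sub hx => t [[_ -> _] v].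
by rewrite i0.
Qed.

Theorem white_exact L t0 j x : inert 0 t0 ->
  span_of (fun t => cell_class 0 L t0 t /\ count_state 0 t = j.+1) x -> K (dd 0 x) ->
  exists2 y, span_of (fun t => cell_class 0 L t0 t /\ count_state 0 t = j) y & K (x - dd 0 y).
Proof.
move=> i0; apply: (@quadratic_exact E A 0 standard K (cell_class 0 L t0) cell_rank).
- exact: rel_subg.
- exact: rel_dd.
- by move=> t t'; apply: cell_class_forget.
- exact: rank_forget.
- by move=> t; apply: white_rewriting.
- by move=> z; apply: white_class_independent.
Qed.

(** The tree t is a leading term. All its cut edges are abnormal, so its boundary
    is congruent to a cycle of normal trees of smaller rank; by exactness that
    cycle is the boundary of some y, and y is supported on trees with active
    edges, so t is not among them. *)
Lemma white_cycle t : inert 0 t -> count_state 0 t = 0%N -> ~~ has_active 0 standard None t ->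
  exists2 y, span_of (fun c => [/\ cell_class 0 (fun=> True) t c, count_state 0 c = 0%N &
    has_active 0 standard None c]) y & K (dd 0 (<< t >> - y)).
Proof.
move=> i0 c0 na.
have cf t1 t2 : forget 0 t1 = forget 0 t2 -> cell_class 0 (fun=> True) t t1 -> cell_class 0 (fun=> True) t t2.
  exact: cell_class_forget.
have v : valid_in 0 standard None t.
  elim: (t) c0 None => //= s e l hl r hr h o.
  by case: s h => [|s] /= h; [lia | rewrite hl ?hr //; lia].
have h1 : cell_class 0 (fun=> True) t t by [].
have [|z1 hz1 hK1] := @reduce_bad E A 0 standard K (cell_class 0 (fun=> True) t) cell_rank (@rel_subg E A 0 R)
    (fun t1 => @white_rewriting (fun=> True) t t1 i0) (cell_rank t) 1 (dd 0 << t >>).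
  have := dd_d0 v; rewrite d0_inactive // subr0; apply: span_of_sub => t' [[h2 h3] h4].
  split=> //; first by apply: cf h1.
    by rewrite h3 c0.
  by rewrite (rank_forget h2).
have [|y hy hK] := normal_exact (@rel_subg E A 0 R) (@rel_dd E A 0 R) cf (@rank_forget 0)
    (fun t1 => @white_rewriting (fun=> True) t t1 i0) (fun z => @white_class_independent (fun=> True) t z i0) hz1.
  rewrite (_ : dd 0 z1 = - dd 0 (dd 0 << t >> - z1)); last by rewrite ddB ddK; zmod.
  by apply: (subgN (@rel_subg E A 0 R)); apply: rel_dd.
exists y; first by apply: span_of_sub hy => c [[]].
rewrite ddB (_ : _ - _ = (dd 0 << t >> - z1) + (z1 - dd 0 y)); last by zmod.
exact: (subgD (@rel_subg E A 0 R)).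
Qed.

End White.
End Trees.
End Masks.

(** * The black products *)

Section Black.
Variables (E I : finType) (lm rm : E -> {set I}) (mk : {set I} -> {set I} -> E).
Hypothesis lm_rm : forall e, lm e :|: rm e = setT.
Hypothesis lm_mk : forall L R, L :|: R = setT -> lm (mk L R) = L.
Hypothesis rm_mk : forall L R, L :|: R = setT -> rm (mk L R) = R.
Hypothesis mk_eta : forall e, mk (lm e) (rm e) = e.
Variables (A : Type) (a0 : A).
Local Notation masks := ({set I} * {set I} * {set I})%type.
Local Notation cell := (cell E A).
Local Notation chain := {freeg cell / int}.
Local Notation standard := (standard rm).
Local Notation left_masks := (left_masks lm rm).
Local Notation right_masks := (right_masks lm rm).
Implicit Types (t l r c : cell) (x y : chain).

(** The orthogonal of the white relators for the pairing of composites with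
    sign - on the right combs: the white relators are the combinations that
    vanish on all masks, so their orthogonal has one generator for each triple
    of masks. *)
Definition dual_rel (S : masks) : free_ns E 2 :=
  \sum_(ee : E * E | left_masks ee.1 ee.2 == S) << bt2l ee.1 ee.2 >> -
  \sum_(ee : E * E | right_masks ee.1 ee.2 == S) << bt2r ee.1 ee.2 >>.

Variable R : free_ns E 2 -> Prop.
Hypothesis R_dual : forall u, R u -> in_span (fun v => exists S, v = dual_rel S) u.
Hypothesis dual_R : forall S, R (dual_rel S).

(* In the white complex (p = 0) the marks 0 and 1 are uncut and cut; in the black
   one (p = 1), the marks 1 and 2. *)
Local Notation KW := (rel_ideal (A := A) 0 (fun u => masks_of lm rm u = 0)).
Local Notation KB := (rel_ideal (A := A) 1 R).

Definition eval_at (chi : cell -> int) : chain -> int^o := fglift (chi : cell -> int^o).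

Lemma eval_atU chi t : eval_at chi << t >> = chi t.
Proof. exact: fgliftU. Qed.
Lemma eval_at0 chi : eval_at chi 0 = 0. Proof. exact: fglift0. Qed.
Lemma eval_atB chi x y : eval_at chi (x - y) = eval_at chi x - eval_at chi y.
Proof. exact: fgliftB. Qed.
HB.instance Definition _ chi := GRing.isZmodMorphism.Build chain int^o (eval_at chi) (@eval_atB chi).
Lemma eval_atD chi x y : eval_at chi (x + y) = eval_at chi x + eval_at chi y.
Proof. exact: raddfD. Qed.
Lemma eval_at_sn chi b x : eval_at chi (sn b x) = sn b (eval_at chi x).
Proof. exact: raddf_sn. Qed.

Lemma subg_eq0 (M : zmodType) : subg (fun z : M => z = 0).
Proof. by split=> // x y -> ->; rewrite subr0. Qed.

Lemma eval_at_out (P : cell -> Prop) chi x : (forall t, P t -> chi t = 0) -> span_of P x -> eval_at chi x = 0.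
Proof. by move=> h; apply: (span_of_lift (@subg_eq0 int^o)). Qed.

Lemma cell_eqE s e l r s' e' l' r' :
  (CN s e l r == CN s' e' l' r' :> cell) = [&& s == s', e == e', l == l' & r == r'].
Proof.
by apply/eqP/and4P => [[-> -> -> ->]|[/eqP-> /eqP-> /eqP-> /eqP->]].
Qed.

Lemma coeff_ndl s e l r s' e' x r' :
  coeff (CN s e l r) (nd s' e' x << r' >>) =
  if [&& s == s', e == e' & r == r'] then coeff l x else 0 :> int.
Proof.
elim/freeg_basis_ind: x => [l'||x y hx hy].
- rewrite ndU !coeffU !mul1r cell_eqE ![_ == s]eq_sym ![_ == e]eq_sym [r' == r]eq_sym.
  by case: (s == s'); case: (e == e'); case: (r == r'); rewrite /= ?andbT ?andbF.
- by rewrite nd0l !coeff0 if_same.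
- by rewrite ndBl !coeffB hx hy; case: ifP => _; rewrite ?subr0.
Qed.

Lemma coeff_ndr s e l r s' e' x l' :
  coeff (CN s e l r) (nd s' e' << l' >> x) =
  if [&& s == s', e == e' & l == l'] then coeff r x else 0 :> int.
Proof.
elim/freeg_basis_ind: x => [r'||x y hx hy].
- rewrite ndU !coeffU !mul1r cell_eqE ![_ == s]eq_sym ![_ == e]eq_sym [l' == l]eq_sym.
  by case: (s == s'); case: (e == e'); case: (l == l'); rewrite /= ?andbT ?andbF.
- by rewrite nd0r !coeff0 if_same.
- by rewrite ndBr !coeffB hx hy; case: ifP => _; rewrite ?subr0.
Qed.

Lemma coeff_CL a s e x y : coeff (CL a) (nd s e x y) = 0 :> int.
Proof.
move: x y; apply: bi_ind => [l r|x|y].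
- by rewrite ndU coeffU; case: eqP => //; rewrite mulr0.
- by split=> [|y y' hy hy']; rewrite ?nd0r ?coeff0 // ndBr coeffB hy hy'.
- by split=> [|x x' hx hx']; rewrite ?nd0l ?coeff0 // ndBl coeffB hx hx'.
Qed.

(** ** Functionals on white cycles *)

(** Without marks 0 a tree is completely cut for the white complex, hence a free
    cell of it: relations need an uncut edge. *)
Definition no0 t := count_state 0 t == 0%N.

(** The root edge is not counted, since it cannot be the inner edge of a relator
    of the white complex. *)
Definition inner0 t := if t is CN _ _ l r then (count_state 0 l + count_state 0 r)%N else 0%N.

Lemma no0_node s e l r : no0 (CN s e l r) = [&& s != 0%N, no0 l & no0 r].
Proof. by rewrite /no0 /=; case: s => [|s] /=; lia. Qed.

Lemma KW_inner x : KW x -> span_of (fun c => (0 < inner0 c)%N) x.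
Proof.
elim=> {x} [s u a b c _|s e x r _ hx|s e l x _ hx||x y _ hx _ hy].
- rewrite /graft_rel; apply: (@fglift_in _ _ (span_of _)) => [|t]; first exact: subg_span_of.
  case: (bt2P t) => e e' /=; rewrite !ndU;
    by apply: span_ofU => /=; lia.
- apply: (span_of_nd _ hx (@span_ofU _ (eq r) r erefl)) => l' _ /= h <-.
  by case: l' h => //= s' e' l' r'; lia.
- apply: (span_of_nd _ (@span_ofU _ (eq l) l erefl) hx) => _ r' /= <- h.
  by case: r' h => //= s' e' l' r'; lia.
- exact: in_span0.
- exact: in_spanB.
Qed.

Lemma dd0_lo t : span_of (fun c => (0 < count_state 0 c)%N) (dd 0 << t >>).
Proof. by apply: span_of_sub (dd_same 0 t) => c [_ ->]. Qed.

(** The sign that compares the dual of the white differential with the black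
    relators. In the coboundary of a class of composites, the two edges of a
    left and a right comb are preceded by different numbers of cut edges; eps
    absorbs the difference, so that only the sign in [dual_rel] is left. *)
Fixpoint eps t : bool :=
  if t is CN _ _ l r then hi_odd 0 l (+) (eps l (+) eps r) else false.

(** A cochain chi of the quotient by the white relations, whose coboundary on
    completely cut trees is kappa, up to the sign eps. The second condition
    makes chi vanish on trees with uncut root edge, so that it survives a
    grafting below another vertex. *)
Definition coboundary (chi : cell -> int) (kappa : chain) : Prop :=
  [/\ forall x, KW x -> eval_at chi x = 0,
      forall e l r, chi (CN 0 e l r) = 0 &
      forall c, no0 c -> eval_at chi (dd 0 << c >>) = sn (eps c) (coeff c kappa)].

Lemma eval_zero x : eval_at (fun=> 0) x = 0.
Proof. exact: fglift_eq0. Qed.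

Lemma coboundary_trivial kappa : (forall c, no0 c -> coeff c kappa = 0 :> int) ->
  coboundary (fun=> 0) kappa.
Proof.
move=> h; split=> // [x|c] hc; rewrite eval_zero ?h //.
exact/esym/(@sn0 int^o).
Qed.

Lemma coboundaryB chi kappa chi' kappa' : coboundary chi kappa -> coboundary chi' kappa' ->
  coboundary (fun t => chi t - chi' t) (kappa - kappa').
Proof.
move=> [h1 h2 h3] [k1 k2 k3].
have E1 x : eval_at (fun t => chi t - chi' t) x = eval_at chi x - eval_at chi' x.
  exact: (fglift_sub (chi : cell -> int^o) chi').
split=> [x hx|e l r|c hc]; rewrite ?E1.
- by rewrite h1 // k1 // subr0.
- by rewrite h2 k2 subr0.
- by rewrite h3 // k3 // coeffB snB.
Qed.

(** The cochain chi on the left subtree of a vertex s, e whose right subtree is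
    r. *)
Definition on_left s e r (b : bool) (chi : cell -> int) c : int :=
  if c is CN s' e' l' r' then
    if [&& s' == s, e' == e & r' == r] then sn (b (+) hi_odd 0 l') (chi l') else 0
  else 0.

Lemma eval_on_left s e r b chi s' e' x r' :
  eval_at (on_left s e r b chi) (nd s' e' x << r' >>) =
  if [&& s' == s, e' == e & r' == r] then sn b (eval_at chi (tw 0 x)) else 0.
Proof.
elim/freeg_basis_ind: x => [l||x y hx hy].
- rewrite ndU twU eval_at_sn !eval_atU /=; case: ifP => _ //.
  by rewrite sn_sn.
- by rewrite nd0l tw0 !eval_at0 sn0 if_same.
- by rewrite ndBl !eval_atB hx hy twB eval_atB; case: ifP => _; rewrite ?snB ?subr0.
Qed.

Lemma eval_on_left_r s e r b chi s' e' l x : no0 r -> span_of (fun c => (0 < count_state 0 c)%N) x ->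
  eval_at (on_left s e r b chi) (nd s' e' << l >> x) = 0.
Proof.
move=> hr hx; apply: (@eval_at_out (fun c => if c is CN _ _ _ r' then (0 < count_state 0 r')%N else false)).
  case=> //= s1 e1 l1 r1 h; case: and3P => // -[_ _ /eqP e2].
  by move: hr h; rewrite e2 /no0 => /eqP ->.
by apply: (span_of_nd _ (eq_span_of l) hx) => l' r' _ h.
Qed.

(** The mirror image of [on_left]; here chi moves past the left subtree, which
    is fixed, so the sign is a constant. *)
Definition on_right s e l (b : bool) (chi : cell -> int) c : int :=
  if c is CN s' e' l' r' then
    if [&& s' == s, e' == e & l' == l] then sn b (chi r') else 0
  else 0.

Lemma eval_on_right s e l b chi s' e' x l' :
  eval_at (on_right s e l b chi) (nd s' e' << l' >> x) =
  if [&& s' == s, e' == e & l' == l] then sn b (eval_at chi x) else 0.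
Proof.
elim/freeg_basis_ind: x => [r||x y hx hy].
- by rewrite ndU !eval_atU.
- by rewrite nd0r !eval_at0 sn0 if_same.
- by rewrite ndBr !eval_atB hx hy; case: ifP => _; rewrite ?snB ?subr0.
Qed.

Lemma eval_on_right_l s e l b chi s' e' r x : no0 l -> span_of (fun c => (0 < count_state 0 c)%N) x ->
  eval_at (on_right s e l b chi) (nd s' e' x << r >>) = 0.
Proof.
move=> hl hx; apply: (@eval_at_out (fun c => if c is CN _ _ l' _ then (0 < count_state 0 l')%N else false)).
  case=> //= s1 e1 l1 r1 h; case: and3P => // -[_ _ /eqP e2].
  by move: hl h; rewrite e2 /no0 => /eqP ->.
by apply: (span_of_nd _ hx (eq_span_of r)) => l' r' h _.
Qed.

Lemma inner0_le c : (0 < inner0 c)%N -> (0 < count_state 0 c)%N.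
Proof. by case: c => //= s e l r; lia. Qed.

Lemma KW_lo x : KW x -> span_of (fun c => (0 < count_state 0 c)%N) x.
Proof. by move/KW_inner; apply: span_of_sub => c; apply: inner0_le. Qed.

Lemma coboundary_ndl s e r chi kappa : coboundary chi kappa ->
  exists chi', coboundary chi' (nd s e kappa << r >>).
Proof.
move=> [h1 h2 h3]; case: (boolP ((s != 0%N) && no0 r)) => [/andP[s0 hr]|hn]; last first.
  exists (fun=> 0); apply: coboundary_trivial => -[a|s' e' l' r'] hc; rewrite ?coeff_CL //.
  rewrite coeff_ndl; case: and3P => // -[/eqP e1 _ /eqP e2].
  by move: hc; rewrite no0_node e1 e2 => /and3P[s0 _ hr]; rewrite s0 hr in hn.
(* The sign is forced by the last condition of [coboundary]. *)
exists (on_left s e r (~~ ((s == 1%N) (+) eps r)) chi); split.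
- move=> x; elim=> {x} [s' u a b c hu|s' e' x r' hx _|s' e' l x hx _||x y _ hx _ hy].
  + rewrite /graft_rel (fglift_map (eval_at _)); apply: fglift_eq0 => t.
    case: (bt2P t) => e1 e2 /=; rewrite !ndU eval_atU /=.
      by case: ifP => // _; rewrite h2 sn0.
    case: and3P => // -[_ _ /eqP e3]; by move: hr; rewrite -e3 no0_node.
  + by rewrite eval_on_left h1 ?sn0 ?if_same //; apply: rel_tw.
  + by rewrite eval_on_left_r //; apply: KW_lo.
  + exact: eval_at0.
  + by rewrite eval_atB hx hy subr0.
- by move=> e' l' r' /=; rewrite eq_sym (negPf s0).
- case=> [a|s' e' l' r'] hc; first by rewrite ddU eval_at0 coeff_CL sn0.
  rewrite -ndU dd_nd eval_atD eval_at_sn eval_atD eval_on_left.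
  rewrite twU nd_snl eval_at_sn eval_on_left_r ?sn0 ?addr0; [|by []|exact: dd0_lo].
  rewrite (_ : eval_at _ (if _ then _ else 0) = 0) ?add0r; last first.
    by case: ifP => _; rewrite ?eval_at0 // ndU eval_atU /= eq_sym (negPf s0).
  rewrite coeff_ndl; case: and3P => [[/eqP -> /eqP -> /eqP ->]|_]; last by rewrite !sn0.
  move: hc; rewrite no0_node => /and3P[_ hl _].
  rewrite tw_dd raddfN /= twU dd_sn eval_at_sn h3 // -[- _]/(sn true _) !sn_sn /=.
  congr (sn _ _); case: (s == 1%N); case: (eps r); case: (eps l'); by case: (hi_odd 0 l').
Qed.

Lemma coboundary_ndr s e l chi kappa : coboundary chi kappa ->
  exists chi', coboundary chi' (nd s e << l >> kappa).
Proof.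
move=> [h1 h2 h3]; case: (boolP ((s != 0%N) && no0 l)) => [/andP[s0 hl]|hn]; last first.
  exists (fun=> 0); apply: coboundary_trivial => -[a|s' e' l' r'] hc; rewrite ?coeff_CL //.
  rewrite coeff_ndr; case: and3P => // -[/eqP e1 _ /eqP e2].
  by move: hc; rewrite no0_node e1 e2 => /and3P[s0 hl _]; rewrite s0 hl in hn.
(* The sign is forced by the last condition of [coboundary]. *)
exists (on_right s e l ((s == 1%N) (+) eps l) chi); split.
- move=> x; elim=> {x} [s' u a b c hu|s' e' x r' hx _|s' e' l' x hx _||x y _ hx _ hy].
  + rewrite /graft_rel (fglift_map (eval_at _)); apply: fglift_eq0 => t.
    case: (bt2P t) => e1 e2 /=; rewrite !ndU eval_atU /=; last first.
      by case: ifP => // _; rewrite h2 sn0.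
    case: and3P => // -[_ _ /eqP e3]; by move: hl; rewrite -e3 no0_node.
  + by rewrite eval_on_right_l //; apply: KW_lo.
  + by rewrite eval_on_right h1 ?sn0 ?if_same.
  + exact: eval_at0.
  + by rewrite eval_atB hx hy subr0.
- by move=> e' l' r' /=; rewrite eq_sym (negPf s0).
- case=> [a|s' e' l' r'] hc; first by rewrite ddU eval_at0 coeff_CL sn0.
  rewrite -ndU dd_nd eval_atD eval_at_sn eval_atD eval_on_right_l ?add0r; [|by []|exact: dd0_lo].
  rewrite twU nd_snl eval_at_sn eval_on_right.
  rewrite (_ : eval_at _ (if _ then _ else 0) = 0) ?add0r; last first.
    by case: ifP => _; rewrite ?eval_at0 // ndU eval_atU /= eq_sym (negPf s0).
  rewrite coeff_ndr; case: and3P => [[/eqP -> /eqP -> /eqP ->]|_]; last by rewrite !sn0.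
  move: hc; rewrite no0_node => /and3P[_ _ hr].
  rewrite h3 // !sn_sn /=.
  congr (sn _ _); case: (s == 1%N); case: (eps l); case: (eps r'); by case: (hi_odd 0 l).
Qed.

Lemma coeff_out (P : cell -> Prop) c x : span_of P x -> ~ P c -> coeff c x = 0 :> int.
Proof.
move=> /span_of_dom h nP; apply: coeff_outdom; apply/negP => /h; exact: nP.
Qed.

Lemma graft_dual q s S a b c : graft_rel q s (dual_rel S) << a >> << b >> << c >> =
  \sum_(ee : E * E | left_masks ee.1 ee.2 == S) << CN s ee.1 (CN q ee.2 a b) c >> -
  \sum_(ee : E * E | right_masks ee.1 ee.2 == S) << CN s ee.1 a (CN q ee.2 b c) >> :> chain.
Proof.
rewrite /graft_rel /dual_rel fgliftB !fglift_sum.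
by apply: (f_equal2 (fun u v : chain => u - v)); apply: eq_bigr => -[e e'] _; rewrite fgliftU /= !ndU.
Qed.

Section Generator.
Variables (s : nat) (S : masks) (a b c : cell) (w : int).

(** The indicator, with weight w, of a class of trees with a single uncut edge:
    they only differ in the composite along this edge, which has masks S. *)
Definition at_left t : int :=
  if t is CN s' e (CN 0 e' a' b') c' then
    if [&& s' == s, a' == a, b' == b, c' == c & left_masks e e' == S] then w else 0
  else 0.
Definition at_right t : int :=
  if t is CN s' e a' (CN 0 e' b' c') then
    if [&& s' == s, a' == a, b' == b, c' == c & right_masks e e' == S] then w else 0
  else 0.
Definition at_class t := at_left t + at_right t.

Hypotheses (s0 : s != 0%N) (ha : no0 a) (hb : no0 b) (hc : no0 c).

Lemma no0_neq0 e l r t : no0 t -> (CN 0 e l r == t) = false.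
Proof. by move=> ht; apply: contraTF ht => /eqP <-; rewrite no0_node. Qed.

Lemma at_classl s' e e' a' b' c' : at_class (CN s' e (CN 0 e' a' b') c') =
  if [&& s' == s, a' == a, b' == b, c' == c & left_masks e e' == S] then w else 0.
Proof.
rewrite /at_class /=; case: c' => [a1|[|s1] e1 l1 r1]; rewrite ?addr0 //.
by rewrite !(no0_neq0 _ _ _ ha) !(no0_neq0 _ _ _ hc) /= !andbF addr0.
Qed.

Lemma at_classr s' e e' a' b' c' : at_class (CN s' e a' (CN 0 e' b' c')) =
  if [&& s' == s, a' == a, b' == b, c' == c & right_masks e e' == S] then w else 0.
Proof.
rewrite /at_class /=; case: a' => [a1|[|s1] e1 l1 r1]; rewrite ?add0r //.
by rewrite !(no0_neq0 _ _ _ ha) !(no0_neq0 _ _ _ hc) /= !andbF add0r.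
Qed.

Lemma no0_inner t : no0 t -> inner0 t = 0%N.
Proof. by case: t => // s' e l r; rewrite no0_node /no0 => /and3P[_ /eqP /= -> /eqP ->]. Qed.

Lemma at_class_inner s' e l r : (0 < inner0 l)%N || (0 < inner0 r)%N -> at_class (CN s' e l r) = 0.
Proof.
have ia := no0_inner ha; have ib := no0_inner hb; have ic := no0_inner hc.
move: (ha) (hb) (hc); rewrite /no0 => /eqP ja /eqP jb /eqP jc h.
rewrite /at_class (_ : at_left _ = 0) ?add0r.
  case: r h => [//|[|//] e1 l1 r1] /= h; case: and5P => // -[_ /eqP e2 /eqP e3 /eqP e4 _].
  by move: h; rewrite e2 e3 e4 ia jb jc.
case: l h => [//|[|//] e1 l1 r1] /= h; case: and5P => // -[_ /eqP e2 /eqP e3 /eqP e4 _].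
by move: h; rewrite e2 e3 e4 ic ja jb.
Qed.

Lemma at_class_rel x : KW x -> eval_at at_class x = 0.
Proof.
elim=> {x} [s' u a' b' c' hu|s' e x r hx _|s' e l x hx _||x y _ hx _ hy].
- rewrite /graft_rel (fglift_map (eval_at _)).
  transitivity (fglift (fun S' => (if [&& s' == s, a' == a, b' == b, c' == c & S' == S] then w else 0) : int^o) (masks_of lm rm u)); last by rewrite hu fglift0.
  elim/freeg_basis_ind: u {hu} => [t||u v hu hv].
  + rewrite /masks_of !fgliftU; case: (bt2P t) => e e' /=; rewrite !ndU eval_atU.
      by rewrite at_classl.
    by rewrite at_classr.
  + by rewrite /masks_of !fglift0.
  + by rewrite /masks_of !fgliftB hu hv.
- apply: (@eval_at_out (fun t => if t is CN _ _ l r then (0 < inner0 l)%N || (0 < inner0 r)%N else true)).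
    by case=> // s1 e1 l1 r1; apply: at_class_inner.
  by apply: (span_of_nd _ (KW_inner hx) (eq_span_of r)) => l' r' /= -> _.
- apply: (@eval_at_out (fun t => if t is CN _ _ l r then (0 < inner0 l)%N || (0 < inner0 r)%N else true)).
    by case=> // s1 e1 l1 r1; apply: at_class_inner.
  by apply: (span_of_nd _ (eq_span_of l) (KW_inner hx)) => l' r' _ /= ->; rewrite orbT.
- exact: eval_at0.
- by rewrite eval_atB hx hy subr0.
Qed.

Definition left_hit t := if t is CN s' e (CN 1 e' a' b') c' then
  [&& s' == s, a' == a, b' == b, c' == c & left_masks e e' == S] else false.
Definition right_hit t := if t is CN s' e a' (CN 1 e' b' c') then
  [&& s' == s, a' == a, b' == b, c' == c & right_masks e e' == S] else false.

Lemma eval_dd_left s' e l r : s' != 0%N -> no0 l -> no0 r ->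
  eval_at at_class (nd s' e (dd 0 << l >>) << r >>) = if left_hit (CN s' e l r) then w else 0.
Proof.
move=> s'0; case: l => [a'|s1 e1 l1 r1] hl hr; first by rewrite ddU nd0l eval_at0.
move: hl; rewrite no0_node => /and3P[s10 hl1 hr1].
rewrite -[in LHS]ndU dd_nd ndDl eval_atD nd_snl eval_at_sn.
rewrite [X in sn _ X](_ : _ = 0) ?sn0 ?addr0; last first.
  apply: (@eval_at_out (fun t => if t is CN _ _ (CN s2 _ _ _) r2 then (s2 != 0%N) && no0 r2 else false)).
    case=> // s2 e2 [|[|s3] e3 l3 r3] //= r2 h2.
    rewrite /at_class /= add0r; case: r2 h2 => [//|[|//] e4 l4 r4].
    by rewrite no0_node.
  apply: (@span_of_nd E A (fun t => if t is CN s2 _ _ _ then s2 != 0%N else false) (eq r)); last exact: eq_span_of.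
    by move=> [|s2 e2 l2 r2] // r' /= -> <-.
  apply: in_spanD; first by apply: (@span_of_nd E A (fun=> True) (fun=> True)) => //; apply/span_of_dom.
  by apply: (@span_of_nd E A (fun=> True) (fun=> True)) => //; apply/span_of_dom.
case: s1 s10 => [//|[|s1]] _ /=; last by rewrite nd0l eval_at0.
by rewrite !ndU eval_atU at_classl.
Qed.

Lemma eval_dd_right s' e l r : s' != 0%N -> no0 l -> no0 r ->
  eval_at at_class (nd s' e << l >> (dd 0 << r >>)) = if right_hit (CN s' e l r) then w else 0.
Proof.
move=> s'0 hl; case: r => [a'|s1 e1 l1 r1] hr; first by rewrite ddU nd0r eval_at0.
move: hr; rewrite no0_node => /and3P[s10 hl1 hr1].
rewrite -[in LHS]ndU dd_nd ndDr eval_atD nd_snr eval_at_sn.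
rewrite [X in sn _ X](_ : _ = 0) ?sn0 ?addr0; last first.
  apply: (@eval_at_out (fun t => if t is CN _ _ l2 (CN s2 _ _ _) then (s2 != 0%N) && no0 l2 else false)).
    case=> // s2 e2 l2 [|[|s3] e3 l3 r3] //= h2.
    rewrite /at_class /= addr0; case: l2 h2 => [//|[|//] e4 l4 r4].
    by rewrite no0_node.
  apply: (@span_of_nd E A (eq l) (fun t => if t is CN s2 _ _ _ then s2 != 0%N else false)); first last.
  - apply: in_spanD; first by apply: (@span_of_nd E A (fun=> True) (fun=> True)) => //; apply/span_of_dom.
    by apply: (@span_of_nd E A (fun=> True) (fun=> True)) => //; apply/span_of_dom.
  - exact: eq_span_of.
  - by move=> l' [|s2 e2 l2 r2] //= <- ->.
case: s1 s10 => [//|[|s1]] _ /=; last by rewrite nd0r eval_at0.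
by rewrite !ndU eval_atU at_classr.
Qed.

Lemma coeff_graft_dual t :
  coeff t (graft_rel 1 s (dual_rel S) << a >> << b >> << c >>) = (left_hit t)%:R - (right_hit t)%:R :> int.
Proof.
rewrite graft_dual coeffB !coeff_sum; apply: (f_equal2 (fun u v : int => u - v)).
- under eq_bigr do rewrite coeffU mul1r.
  case: (boolP (left_hit t)) => [|nh].
    case: t => // s' e [//|[//|[|//]] e' a' b'] c' /=.
    case/and5P=> /eqP-> /eqP-> /eqP-> /eqP-> h; rewrite (bigD1 (e, e')) //= eqxx big1 ?addr0 //.
    move=> -[e1 e1'] /andP[_]; rewrite xpair_eqE /= !cell_eqE !eqxx /= !andbT.
    by move=> /negPf ->.
  apply: big1 => -[e e'] /= h; case: eqP => // te; rewrite -te /= !eqxx /= in nh.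
  by rewrite h in nh.
- under eq_bigr do rewrite coeffU mul1r.
  case: (boolP (right_hit t)) => [|nh].
    case: t => // s' e a' [//|[//|[|//]] e' b' c'] /=.
    case/and5P=> /eqP-> /eqP-> /eqP-> /eqP-> h; rewrite (bigD1 (e, e')) //= eqxx big1 ?addr0 //.
    move=> -[e1 e1'] /andP[_]; rewrite xpair_eqE /= !cell_eqE !eqxx /= !andbT.
    by move=> /negPf ->.
  apply: big1 => -[e e'] /= h; case: eqP => // te; rewrite -te /= !eqxx /= in nh.
  by rewrite h in nh.
Qed.

End Generator.

(** Uncutting an edge of a completely cut tree lands in the class of S exactly
    when the composite along this edge has masks S, so the coboundary of the
    indicator of the class consists of the terms of the relator of S. *)
Lemma coboundary_gen s S a b c :
  exists chi, coboundary chi (graft_rel 1 s (dual_rel S) << a >> << b >> << c >>).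
Proof.
case: (boolP [&& s != 0%N, no0 a, no0 b & no0 c]) => [/and4P[s0 ha hb hc]|hn]; last first.
  exists (fun=> 0); apply: coboundary_trivial => t ht; apply: (@coeff_out (fun t => ~~ no0 t)) => //; last by rewrite ht.
  rewrite graft_dual; apply: in_spanB; apply: in_span_sum => ee _; apply: span_ofU;
    apply: contra hn; rewrite !no0_node;
    by case: (s != 0%N); case: (no0 a); case: (no0 b); case: (no0 c).
(* The weight that gives the term of a left comb the sign eps; the term of a
   right comb then gets the opposite sign. *)
pose w : int := sn (~~ ((s == 1%N) (+) eps a (+) eps b (+) eps c (+) hi_odd 0 b)) 1.
exists (at_class s S a b c w); split.
- by move=> x hx; apply: at_class_rel.
- move=> e l r; rewrite /at_class /= ![0%N == s]eq_sym (negPf s0) /=.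
  by case: l => [?|[|?] ? ? ?]; case: r => [?|[|?] ? ? ?].
- case=> [a1|s' e l r]; first by rewrite ddU eval_at0 coeff_graft_dual.
  move=> hcl; move: (hcl); rewrite no0_node => /and3P[s'0 hl hr].
  rewrite -[in LHS]ndU dd_nd eval_atD eval_at_sn eval_atD twU nd_snl eval_at_sn.
  rewrite eval_dd_left // eval_dd_right // coeff_graft_dual.
  rewrite (_ : eval_at _ (if _ then _ else 0) = 0) ?add0r; last first.
    case: ifP => _; rewrite ?eval_at0 // ndU eval_atU /at_class /= ![0%N == s]eq_sym (negPf s0) /=.
    by case: (l) => [?|[|?] ? ? ?]; case: (r) => [?|[|?] ? ? ?].
  have hL : left_hit s S a b c (CN s' e l r) -> sn (s' == 1%N) w = sn (eps (CN s' e l r)) 1.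
    case: (l) => // -[|[|?]] // e' a' b' /= /and5P[/eqP-> /eqP-> /eqP-> /eqP-> _].
    rewrite /w /hi_odd /= !oddD !sn_sn; case: (s == 1%N); case: (eps a); case: (eps b); case: (eps c);
      by case: (odd (count_state 1 a)); case: (odd (count_state 1 b)).
  have hR : right_hit s S a b c (CN s' e l r) ->
      sn (s' == 1%N) (sn (hi_odd 0 l) w) = - sn (eps (CN s' e l r)) 1.
    rewrite /right_hit; case: (r) => // -[|[|?]] // e' b' c' /= /and5P[/eqP-> /eqP-> /eqP-> /eqP-> _].
    rewrite /w /hi_odd /= !sn_sn; case: (s == 1%N); case: (eps a); case: (eps b); case: (eps c);
      by case: (odd (count_state 1 a)); case: (odd (count_state 1 b)).
  rewrite snD snB; apply: f_equal2.
    by case: ifP => [/hL ->|_]; rewrite ?sn0.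
  by case: ifP => [/hR ->|_]; rewrite ?sn0 ?oppr0.
Qed.

Lemma black_coboundary kappa : KB kappa -> exists chi, coboundary chi kappa.
Proof.
elim=> {kappa} [s u a b c hu|s e x r _ [chi h]|s e l x _ [chi h]||x y _ [chi h] _ [chi' h']].
- elim: (R_dual hu) => {u hu} [_ [S ->]||u v _ [chi h] _ [chi' h']].
  + exact: coboundary_gen.
  + by exists (fun=> 0); apply: coboundary_trivial => t _; rewrite /graft_rel fglift0 coeff0.
  + exists (fun t => chi t - chi' t); rewrite /graft_rel fgliftB; exact: coboundaryB.
- exact: coboundary_ndl h.
- exact: coboundary_ndr h.
- by exists (fun=> 0); apply: coboundary_trivial => t _; rewrite coeff0.
- by exists (fun t => chi t - chi' t); apply: coboundaryB.
Qed.

(** ** Normal forms *)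

(** The normal pairs for the black operads: those that are not for the white
    ones, as always for a quadratic dual. *)
Definition anti b e e' := ~~ standard b e e'.

Lemma anti_inactive o t : no0 t -> valid_in 1 anti o t -> ~~ has_active 0 standard o t.
Proof.
elim: t o => //= s e l hl r hr o; rewrite no0_node => /and3P[s0 nl nr] /and3P[v vl vr].
rewrite (negPf (hl _ nl vl)) (negPf (hr _ nr vr)) !orbF /acts (negPf s0) /=.
case: eqP v => //= _; case: o {vl vr} => [[b e1]|] //=.
Qed.

(** Pair a relation x with the white cycle whose leading term is a normal tree T
    in the support of x. The result is 0, since x is a coboundary; but the other
    terms of the cycle have white-active edges, and a tree with such an edge is
    not black-normal. So the coefficient of T in x vanishes. *)
Lemma black_independent L t0 x : inert 1 t0 -> no0 t0 ->
  span_of (fun t => cell_class 1 L t0 t /\ valid_in 1 anti None t) x -> KB x -> x = 0.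
Proof.
move=> i1 z0 /span_of_dom hx hK.
have cl0 t : cell_class 1 L t0 t -> no0 t.
  by move=> [_ _ h]; rewrite /no0 h.
apply/eqP; rewrite -dom_eq0; case E1: (dom x) => [//|T ts].
have hT : T \in dom x by rewrite E1 mem_head.
have [cT vT] := hx _ hT; have nT := cl0 _ cT.
have iT : inert 0 T.
  move: i1 nT; rewrite /inert; case: cT => _ <- _; case: (T) => //= s e l r.
  by rewrite /no0 /=; case: s => [|[|s]].
have same (t t' : bt_of E 2) : tree_masks lm rm t = tree_masks lm rm t' ->
    masks_of lm rm (<< t >> - << t' >>) = 0.
  by move=> h; rewrite /masks_of fgliftB !fgliftU h subrr.
have [y hy hyK] := @white_cycle E I lm rm mk lm_rm lm_mk rm_mk mk_eta A a0
    (fun u => masks_of lm rm u = 0) (fun u h => h) same T iT (eqP nT) (anti_inactive nT vT).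
have [chi [h1 _ h3]] := black_coboundary hK.
pose pair z : int^o := fglift (fun c => sn (eps c) (coeff c x) : int^o) z.
have pairE z : span_of no0 z -> pair z = eval_at chi (dd 0 z).
  apply: (span_of_ind (G := fun z => pair z = eval_at chi (dd 0 z))) => [|t ht].
    split=> [|u v hu hv]; first by rewrite dd0 eval_at0 /pair fglift0.
    by rewrite ddB eval_atB -hu -hv /pair fgliftB.
  by rewrite /pair fgliftU h3.
have : pair (<< T >> - y) = 0.
  rewrite pairE ?h1 //; apply: in_spanB; first exact: span_ofU.
  by apply: span_of_sub hy => t [_ h _]; rewrite /no0 h.
rewrite /pair fgliftB fgliftU (_ : fglift _ y = 0); last first.
  apply: (span_of_lift (@subg_eq0 int^o)) hy => t [ct nt at_].
  rewrite coeff_outdom ?sn0 //; apply/negP => /hx[_ vt].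
  by move: (anti_inactive (introT eqP nt) vt); rewrite at_.
rewrite subr0 => h; move: hT; rewrite mem_dom.
by case: (eps T) h => /= [/eqP|->//]; rewrite oppr_eq0 => ->.
Qed.

(** The standard comb with masks S is rewritten by the relator of S; the other
    composites with these masks come later in the white order. *)
Lemma black_step o t : ~~ valid_in 1 anti o t ->
  (root_state t == Some 1%N -> valid_in 1 anti o t || (if t is CN _ e _ _ then nrmo anti o e else true)) ->
  exists2 x, span_of (fun t' => same_marks t t' /\ lex_lt rm t t') x & KB (<< t >> - x).
Proof.
elim: t o => //= s e l IHl r IHr o nv h0.
have {h0} h0 : (s == 1%N) ==> nrmo anti o e.
  by apply/implyP => /eqP s0; move: h0 nv; rewrite s0 eqxx => /(_ isT)/orP[->|].
move: nv; rewrite h0 /= => nv.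
have hr : (exists e' b c, r = CN 1 e' b c /\ standard true e e') \/
    (root_state r == Some 1%N -> if r is CN _ e' _ _ then anti true e e' else true).
- case: (r) => [a|[|[|s']] e' b c]; [by right|by right| |by right].
  by case: (boolP (standard true e e')) => hs; [left; exists e', b, c | right].
case: hr => [[e' [b [c [Er st]]]]|nr].
  rewrite Er; pose S := right_masks e e'.
  exists (<< CN s e l (CN 1 e' b c) >> + graft_rel 1 s (dual_rel S) << l >> << b >> << c >>); last first.
    rewrite opprD addrA subrr add0r; apply: (subgN (@rel_subg E A 1 R)); exact: rel_gen.
  rewrite graft_dual (bigD1 (e, e') (F := fun ee => << CN s ee.1 l (CN 1 ee.2 b c) >>)) ?eqxx //=.
  set z := << _ >>; rewrite (_ : z + _ = \sum_(ee : E * E | left_masks ee.1 ee.2 == S) << CN s ee.1 (CN 1 ee.2 l b) c >> -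
    \sum_(ee : E * E | (right_masks ee.1 ee.2 == S) && (ee != (e, e'))) << CN s ee.1 l (CN 1 ee.2 b c) >>); last by zmod.
  apply: in_spanB; apply: in_span_sum => -[e1 e1'] /=.
    move=> _; apply: span_ofU; split; last by rewrite /lex_lt /=; lia.
    by split=> [||q] /=; rewrite ?catA //; lia.
  case/andP=> /eqP hS ne; apply: span_ofU.
  have [h1] := right_masks_inj lm_rm mk_eta (esym hS) st.
  case: ifP => [_ h2|_ h2]; first by rewrite -h1 -h2 eqxx in ne.
  by split; [split | rewrite /lex_lt /= -h1; lia].
case: (boolP (valid_in 1 anti (Some (false, e)) l)) nv => vl /= nv.
  have [|x hx hK] := IHr _ nv.
    by move=> /nr; case: (r) => //= *; apply/orP; right.
  exists (nd s e << l >> x); last by rewrite -ndU -ndBr; apply: rel_nd_r.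
  apply: (span_of_nd _ (eq_span_of l) hx) => _ r' <- [h1 h2].
  by split; [apply: same_marks_r | apply: lex_lt_r].
have [|x hx hK] := IHl _ vl.
  by case: (l) => //= s' e' a b _; rewrite orbT.
exists (nd s e x << r >>); last by rewrite -ndU -ndBl; apply: rel_nd_l.
apply: (span_of_nd _ hx (eq_span_of r)) => l' _ [h1 h2] <-.
split; first exact: same_marks_l.
by apply: lex_lt_l => //; rewrite (same_marks_size h1).
Qed.

Definition dual_rank t := (rank_bound I (cell_size t) - cell_rank rm t)%N.

Theorem black_exact L t0 j x : inert 1 t0 -> no0 t0 ->
  span_of (fun t => cell_class 1 L t0 t /\ count_state 1 t = j.+1) x -> KB (dd 1 x) ->
  exists2 y, span_of (fun t => cell_class 1 L t0 t /\ count_state 1 t = j) y & KB (x - dd 1 y).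
Proof.
move=> i1 z0; apply: (@quadratic_exact E A 1 anti KB (cell_class 1 L t0) dual_rank).
- exact: rel_subg.
- exact: rel_dd.
- by move=> t t'; apply: cell_class_forget.
- move=> t t' h; rewrite /dual_rank (rank_forget rm h).
  by rewrite -(forget_size 1 t) h forget_size.
- move=> t ct nv; have [|z hz hK] := black_step nv.
    by case: ct => _ -> _; move: i1 => /andP[/negPf -> _].
  exists z => //; apply: span_of_sub hz => t' [h1 h2]; split.
  + exact: same_marks_class h1 ct.
  + by case: h1.
  + have e1 := same_marks_size h1; have := cell_rank_lt (esym e1) h2.
    by have := cell_rank_le rm t'; rewrite /dual_rank e1; lia.
- by move=> z; apply: black_independent.
Qed.

End Black.

(** * Assembling a marked tree from blocks *)

Section Assembly.
Variables (E : choiceType) (A : Type) (p : nat) (R : free_ns E 2 -> Prop).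
Local Notation cell := (cell E A).
Local Notation chain := {freeg cell / int}.
Local Notation hi := p.+1.
Local Notation tw := (@tw E A p).
Local Notation dd := (@dd E A p).
Local Notation K := (@rel_ideal E A p R).
Implicit Types (t u : btree E) (f g : nat -> chain).

(** The marked tree whose root piece is t, uncut inside and with mark s above its
    root, and whose inputs carry the chains f k, f (k + 1), and so on. *)
Fixpoint asm s t k f : chain :=
  match t with
  | BLeaf => f k
  | BNode e l r => nd s e (asm p l k f) (asm p r (k + (bt_size l).+1)%N f)
  end.

Definition updf f (j : nat) (x : chain) : nat -> chain := fun i => if i == j then x else f i.

Lemma asm_ext s t k f g : (forall i, (k <= i <= k + bt_size t)%N -> f i = g i) ->
  asm s t k f = asm s t k g.
Proof.
elim: t s k => [|e l hl r hr] s k /= h; first by apply: h; rewrite addn0 leqnn.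
by congr (nd _ _ _ _); [apply: hl | apply: hr] => i hi; apply: h; lia.
Qed.

Lemma asm_shift s t k d f : asm s t (d + k)%N f = asm s t k (fun i => f (d + i)%N).
Proof.
by elim: t s k => [|e l hl r hr] s k //=; rewrite hl -hr addnA.
Qed.

Lemma asm_graft s t i u k f : (i <= bt_size t)%N ->
  asm s (bt_graft t i u) k f =
  asm s t k (fun j => if (j < k + i)%N then f j else if j == (k + i)%N then
    asm (if bt_size t == 0%N then s else p) u (k + i)%N f else f (j + bt_size u)%N).
Proof.
elim: t s i k => [|e l hl r hr] s i k /= hi.
  by move: hi; rewrite leqn0 => /eqP ->; rewrite addn0 ltnn eqxx.
case: ifP => hil /=.
  rewrite hl // bt_graft_size; congr (nd _ _ _ _).
    by apply: asm_ext => j hj; case: ifP => // _; case: ifP => // _; rewrite if_same.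
  transitivity (asm p r (k + (bt_size l).+1)%N (fun j => f (j + bt_size u)%N)).
    rewrite (_ : (k + (bt_size l + bt_size u).+1)%N = (bt_size u + (k + (bt_size l).+1))%N); last by lia.
    by rewrite asm_shift; apply: asm_ext => j _; rewrite addnC.
  by apply: asm_ext => j hj; rewrite !ifN //; lia.
rewrite hr; last by lia.
congr (nd _ _ _ _).
  by apply: asm_ext => j hj; rewrite ifT //; lia.
have -> : (k + (bt_size l).+1 + (i - (bt_size l).+1) = k + i)%N by lia.
by apply: asm_ext => j hj; rewrite if_same.
Qed.

Lemma asm_updB s t k f j x y : (k <= j <= k + bt_size t)%N ->
  asm s t k (updf f j (x - y)) = asm s t k (updf f j x) - asm s t k (updf f j y).
Proof.
elim: t s k => [|e l hl r hr] s k /= hj; first by rewrite /updf (_ : k == j) //; lia.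
have out t' k' x' y' : ~~ (k' <= j <= k' + bt_size t')%N -> asm p t' k' (updf f j x') = asm p t' k' (updf f j y').
  by move=> h; apply: asm_ext => i hi; rewrite /updf ifN ?ifN //; lia.
case: (leqP j (k + bt_size l)) => hjl.
  rewrite hl; last by lia.
  rewrite ndBl; congr (nd _ _ _ _ - nd _ _ _ _); apply: out; lia.
rewrite hr; last by lia.
rewrite ndBr; congr (nd _ _ _ _ - nd _ _ _ _); apply: out; lia.
Qed.

Lemma asm_upd0 s t k f j : (k <= j <= k + bt_size t)%N -> asm s t k (updf f j 0) = 0.
Proof. by move=> h; rewrite -[0 in LHS](subrr 0) asm_updB // subrr. Qed.

Lemma asm_congr s t k f g : (forall i, (k <= i <= k + bt_size t)%N -> K (f i - g i)) ->
  K (asm s t k f - asm s t k g).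
Proof.
elim: t s k => [|e l hl r hr] s k /= h; first by apply: h; rewrite addn0 leqnn.
rewrite (_ : _ - _ = nd s e (asm p l k f - asm p l k g) (asm p r (k + (bt_size l).+1)%N f) +
  nd s e (asm p l k g) (asm p r (k + (bt_size l).+1)%N f - asm p r (k + (bt_size l).+1)%N g)); last first.
  by rewrite ndBl ndBr; zmod.
apply: (subgD (rel_subg A p R)).
  by apply: rel_nd_l; apply: hl => i hi; apply: h; lia.
by apply: rel_nd_r; apply: hr => i hi; apply: h; lia.
Qed.

Lemma asm_updK s t k f j x : (k <= j <= k + bt_size t)%N -> K x -> K (asm s t k (updf f j x)).
Proof.
move=> hj hx; rewrite -[asm _ _ _ _]subr0 -(asm_upd0 s f hj); apply: asm_congr => i _.
by rewrite /updf; case: eqP => _; rewrite ?subr0 ?subrr //; apply: rel0.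
Qed.

Definition asml n s k f (x : free_car E n) : chain :=
  fglift (fun t : bt_of E n => asm s t k f) x.

Lemma asmlB n s k f (x y : free_car E n) : asml s k f (x - y) = asml s k f x - asml s k f y.
Proof. exact: fgliftB. Qed.
Lemma asml0 n s k f : asml s k f (0 : free_car E n) = 0.
Proof. exact: fglift0. Qed.
Lemma asmlU n s k f (t : bt_of E n) : asml s k f (<< t >> : free_car E n) = asm s t k f.
Proof. exact: fgliftU. Qed.

Lemma asml_graft m n s k f (i : 'I_m.+1) (x : free_car E m) (y : free_car E n) :
  asml s k f (free_comp i x y) =
  asml s k (fun j => if (j < k + i)%N then f j else if j == (k + i)%N then
    asml (if m == 0%N then s else p) (k + i)%N f y else f (j + n)%N) x.
Proof.
elim/freeg_basis_ind: x => [t||x x' hx hx'].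
- elim/freeg_basis_ind: y => [u||y y' hy hy'].
  + rewrite free_compU !asmlU asm_graft ?(eqP (bt_valP t)) -1?ltnS //.
    by rewrite (eqP (bt_valP u)).
  + rewrite free_comp0r asml0 asmlU asml0; apply/esym.
    rewrite -[RHS](asm_upd0 s (t := t) (k := k) (fun j => if (j < k + i)%N then f j else f (j + n)%N) (j := (k + i)%N)).
      by apply: asm_ext => j _; rewrite /updf; case: ltngtP.
    by rewrite (eqP (bt_valP t)); have := ltn_ord i; lia.
  + rewrite free_compBr asmlB hy hy' !asmlU asmlB.
    have hj : (k <= k + i <= k + bt_size t)%N by rewrite (eqP (bt_valP t)); have := ltn_ord i; lia.
    pose g j := if (j < k + i)%N then f j else f (j + n)%N.
    have gE x : asm s t k (fun j => if (j < k + i)%N then f j else if j == (k + i)%N then x else f (j + n)%N) =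
        asm s t k (updf g (k + i)%N x).
      by apply: asm_ext => j _; rewrite /updf /g; case: ltngtP.
    by rewrite !gE asm_updB.
- by rewrite free_comp0l !asml0.
- by rewrite free_compBl !asmlB hx hx'.
Qed.

Lemma asml_updK n s k f j (x : free_car E n) y : (k <= j <= k + n)%N -> K y ->
  K (asml s k (updf f j y) x).
Proof.
move=> hj hy; elim/freeg_basis_ind: x => [t||x x' hx hx'].
- by rewrite asmlU; apply: asm_updK; rewrite ?(eqP (bt_valP t)).
- by rewrite asml0; apply: rel0.
- by rewrite asmlB; apply: relB.
Qed.

Lemma asml_updB n s k f j (z : free_car E n) x y : (k <= j <= k + n)%N ->
  asml s k (updf f j (x - y)) z = asml s k (updf f j x) z - asml s k (updf f j y) z.
Proof.
move=> hj; elim/freeg_basis_ind: z => [t||z z' hz hz'].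
- by rewrite !asmlU asm_updB ?(eqP (bt_valP t)).
- by rewrite !asml0 subr0.
- by rewrite !asmlB hz hz'; zmod.
Qed.

Lemma asml_upd0 n s k f j (z : free_car E n) : (k <= j <= k + n)%N -> asml s k (updf f j 0) z = 0.
Proof. by move=> h; rewrite -[0 in LHS](subrr 0) asml_updB // subrr. Qed.

Lemma asml_updN n s k f j (z : free_car E n) x : (k <= j <= k + n)%N ->
  asml s k (updf f j (- x)) z = - asml s k (updf f j x) z.
Proof. by move=> h; rewrite -sub0r asml_updB // asml_upd0 // sub0r. Qed.

Lemma asml_updD n s k f j (z : free_car E n) x y : (k <= j <= k + n)%N ->
  asml s k (updf f j (x + y)) z = asml s k (updf f j x) z + asml s k (updf f j y) z.
Proof. by move=> h; rewrite -[y]opprK asml_updB // asml_updN // !opprK. Qed.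

Lemma asml_upd_sn n s k f j (z : free_car E n) b x : (k <= j <= k + n)%N ->
  asml s k (updf f j (sn b x)) z = sn b (asml s k (updf f j x) z).
Proof. by move=> h; case: b => //=; rewrite asml_updN. Qed.

Lemma asml_upd_sum n s k f j (z : free_car E n) (I : Type) (r : seq I) (h : I -> chain) :
  (k <= j <= k + n)%N ->
  asml s k (updf f j (\sum_(i <- r) h i)) z = \sum_(i <- r) asml s k (updf f j (h i)) z.
Proof.
by move=> hj; elim: r => [|i r IH]; rewrite ?big_nil ?asml_upd0 // !big_cons asml_updD // IH.
Qed.

Lemma asml_ext n s k f g (x : free_car E n) : (forall i, (k <= i <= k + n)%N -> f i = g i) ->
  asml s k f x = asml s k g x.
Proof.
move=> h; congr fglift; apply/funext => t; apply: asm_ext => i.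
by rewrite (eqP (bt_valP t)); apply: h.
Qed.

Lemma asml_shift n s k d f (x : free_car E n) : asml s (d + k)%N f x = asml s k (fun i => f (d + i)%N) x.
Proof. by congr fglift; apply/funext => t; apply: asm_shift. Qed.

(** Elements of the operadic ideal act by relations, hence pieces may be taken in
    the quotient operad. *)
Lemma asml_ideal n (x : free_ns E n) : in_ideal R x -> forall s k f, K (asml s k f x).
Proof.
elim=> {n x} [x hx|n|n x y _ hx _ hy|m n i x y _ hx|m n i x y _ hy] s k f.
- rewrite (_ : asml _ _ _ _ = graft_rel p s x (f k) (f (k + 1)%N) (f (k + 2)%N)).
    exact: rel_graft.
  congr fglift; apply/funext => t; case: (bt2P t) => e e' /=; do ?congr (nd _ _ _ _); congr f; lia.
- by rewrite asml0; apply: rel0.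
- by rewrite asmlB; apply: relB.
- by rewrite asml_graft.
- rewrite asml_graft; set y' := asml _ _ _ y.
  rewrite (@asml_ext _ _ _ _ (updf (fun j => if (j < k + i)%N then f j else f (j + n)%N) (k + i)%N y')).
    by apply: asml_updK; [have := ltn_ord i; lia | apply: hy].
  by move=> j _; rewrite /updf; case: ltngtP.
Qed.

(** ** The differential on an assembled tree *)

Lemma tw_asm s t k f : tw (asm s t k f) =
  sn ((s == hi) && (bt_size t != 0%N)) (asm s t k (fun i => tw (f i))).
Proof.
elim: t s k => [|e l hl r hr] s k /=; first by rewrite andbF.
by rewrite tw_nd hl hr hi_p andbT.
Qed.

(** The summand of the Leibniz rule that differentiates the tree at input j. *)
Definition dder f j : nat -> chain :=
  fun i => if (i < j)%N then tw (f i) else if i == j then dd (f i) else f i.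

Lemma dd_asm_inner t k f :
  dd (asm p t k f) = \sum_(j < (bt_size t).+1) asm p t k (dder f (k + j)%N).
Proof.
elim: t k => [|e l hl r hr] k /=.
  by rewrite big_ord1 addn0 /dder ltnn eqxx.
rewrite dd_nd hi_p add0r /= hl hr -addSn -addnS big_split_ord /=; congr (_ + _).
  rewrite -/(ndl p e _ _) raddf_sum /=; apply: eq_bigr => j _; rewrite /ndl; congr (nd _ _ _ _).
  by apply: asm_ext => i hi; have hj := ltn_ord j; rewrite /dder !ifN //; lia.
rewrite raddf_sum /=; apply: eq_bigr => j _; congr (nd _ _ _ _).
  rewrite tw_asm hi_p /=; apply: asm_ext => i hi.
  by rewrite /dder ifT //; lia.
by apply: asm_ext => i hi; rewrite addnA.
Qed.

Lemma dd_asm s t k f : (0 < bt_size t)%N -> dd (asm s t k f) =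
  (if s == hi then asm p t k f else 0) +
  sn (s == hi) (\sum_(j < (bt_size t).+1) asm s t k (dder f (k + j)%N)).
Proof.
case: t => //= e l r _; rewrite dd_nd; congr (_ + sn _ _).
rewrite !dd_asm_inner -addSn -addnS big_split_ord /=; congr (_ + _).
  rewrite -/(ndl s e _ _) raddf_sum /=; apply: eq_bigr => j _; rewrite /ndl; congr (nd _ _ _ _).
  by apply: asm_ext => i hi; have hj := ltn_ord j; rewrite /dder !ifN //; lia.
rewrite raddf_sum /=; apply: eq_bigr => j _; congr (nd _ _ _ _).
  rewrite tw_asm hi_p /=; apply: asm_ext => i hi.
  by rewrite /dder ifT //; lia.
by apply: asm_ext => i hi; rewrite addnA.
Qed.

Lemma asm_sn s t k f (c : nat -> bool) :
  asm s t k (fun i => sn (c i) (f i)) =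
  sn (odd (\sum_(i < (bt_size t).+1) c (k + i)%N)) (asm s t k f).
Proof.
elim: t s k => [|e l hl r hr] s k /=; first by rewrite big_ord1 addn0 oddb.
rewrite hl hr nd_snl nd_snr sn_sn; congr (sn _ _).
rewrite -addSn -addnS big_split_ord /= oddD; congr (_ (+) odd _).
by apply: eq_bigr => i _; rewrite addnA.
Qed.

End Assembly.

(** * Koszul signs *)

Section KoszulSigns.
Local Open Scope nat_scope.

(** The number of inversions of s, each weighted by the product of the degrees of
    the two blocks: the exponent of a Koszul sign. *)
Definition kinv m (s : 'S_m.+1) (V : 'I_m.+1 -> nat) : nat :=
  \sum_(i < m.+1) \sum_(j < m.+1 | (i < j) && (s j < s i)) V i * V j.

Lemma kinvE m (s : 'S_m.+1) V :
  kinv s V = \sum_(i < m.+1) \sum_(j < m.+1) ((i < j) && (s j < s i)) * (V i * V j).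
Proof.
apply: eq_bigr => i _; rewrite big_mkcond; apply: eq_bigr => j _.
by case: ifP; rewrite ?mul1n ?mul0n.
Qed.

Lemma kinv1 m (V : 'I_m.+1 -> nat) : kinv 1%g V = 0.
Proof.
rewrite kinvE big1 // => i _; rewrite big1 // => j _; rewrite !perm1.
by case: ltngtP.
Qed.

Lemma eq_kinv m (s : 'S_m.+1) V W : V =1 W -> kinv s V = kinv s W.
Proof.
by move=> e; apply: eq_bigr => i _; apply: eq_bigr => j _; rewrite !e.
Qed.

Lemma double_sum (I : finType) (F : I -> nat) : (\sum_i F i).*2 = \sum_i (F i).*2.
Proof. by rewrite -muln2 big_distrl; apply: eq_bigr => i _; rewrite -muln2. Qed.

Lemma sum_sym m (G : 'I_m -> 'I_m -> nat) : (forall i, G i i = 0) ->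
  \sum_(i < m) \sum_(j < m) G i j = \sum_(i < m) \sum_(j < m) (i < j) * (G i j + G j i).
Proof.
move=> G0.
transitivity (\sum_(i < m) \sum_(j < m) (i < j) * G i j + \sum_(i < m) \sum_(j < m) (j < i) * G i j).
  rewrite -big_split; apply: eq_bigr => i _; rewrite -big_split; apply: eq_bigr => j _ /=.
  by case: ltngtP => [||/ord_inj ->]; rewrite ?mul1n ?mul0n ?addn0 ?add0n ?G0.
rewrite [X in _ + X]exchange_big -big_split; apply: eq_bigr => i _.
by rewrite -big_split; apply: eq_bigr => j _ /=; rewrite mulnDr.
Qed.

(** Koszul signs are multiplicative: a pair of blocks inverted both by s and,
    afterwards, by r is counted twice on the one side and not at all on the
    other. *)
Lemma odd_kinvM m (s r : 'S_m.+1) V :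
  odd (kinv (s * r)%g V) = odd (kinv s V) (+) odd (kinv r (fun j => V (s^-1%g j))).
Proof.
suff [Z eZ] : exists Z, kinv s V + kinv r (fun j => V (s^-1%g j)) = kinv (s * r)%g V + Z.*2.
  by rewrite -oddD eZ oddD odd_double addbF.
exists (\sum_(i < m.+1) \sum_(j < m.+1) ((i < j) && (s j < s i) && (r (s i) < r (s j))) * (V i * V j)).
have -> : kinv r (fun j => V (s^-1%g j)) =
    \sum_(i < m.+1) \sum_(j < m.+1) ((s i < s j) && (r (s j) < r (s i))) * (V i * V j).
  rewrite kinvE (reindex_inj (@perm_inj _ s)) /=; apply: eq_bigr => i _.
  by rewrite (reindex_inj (@perm_inj _ s)) /=; apply: eq_bigr => j _; rewrite !permK.
rewrite sum_sym => [|i]; last by rewrite ltnn.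
rewrite !kinvE double_sum -!big_split; apply: eq_bigr => i _ /=.
rewrite double_sum -!big_split; apply: eq_bigr => j _ /=; rewrite !permM.
rewrite [V j * V i]mulnC; move: (V i * V j) => v.
case: (ltnP i j) => [ij|_]; rewrite ?mul0n ?mul1n //=.
have sij : s i != s j by rewrite (inj_eq perm_inj) -val_eqE /= neq_ltn ij.
have rij : r (s i) != r (s j) by rewrite (inj_eq perm_inj).
move: sij rij; rewrite -!val_eqE /=.
by case: (ltngtP (s i) (s j)) => //= _ _; case: ltngtP => //= _ _; rewrite ?mul0n ?mul1n ?addn0 ?add0n ?addnn //=.
Qed.

Lemma odd_sum_add (I : finType) (F G H : I -> nat) :
  (forall a, odd (F a) = odd (G a) (+) odd (H a)) ->
  odd (\sum_a F a) = odd (\sum_a G a) (+) odd (\sum_a H a).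
Proof.
move=> h; have om := big_morph odd oddD (erefl (odd 0)).
by rewrite !om -big_split /=; apply: eq_bigr.
Qed.

(** Removing a suspension from block i changes the exponent by the total degree
    of the blocks that precede i in exactly one of the two orders. *)
Lemma odd_kinv_shrink m (s : 'S_m.+1) (i : 'I_m.+1) (V W : 'I_m.+1 -> nat) : V i = (W i).+1 -> (forall a, a != i -> V a = W a) ->
  odd (kinv s V) = odd (kinv s W) (+) odd (\sum_(a < m.+1 | s a < s i) V a) (+) odd (\sum_(a < m.+1 | a < i) V a).
Proof.
move=> Vi Va.
pose h (a : 'I_m.+1) : nat := ((a < i) && (s i < s a)) || ((i < a) && (s a < s i)).
have VE a : V a = W a + (a == i).
  by case: eqP => [->|/eqP /Va ->]; rewrite ?Vi ?addn1 ?addn0.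
have -> : kinv s V = kinv s W + \sum_(a < m.+1) h a * V a.
  have -> : \sum_(a < m.+1) h a * V a = \sum_(a < m.+1) ((i < a) && (s a < s i)) * V a + \sum_(a < m.+1) ((a < i) && (s i < s a)) * V a.
    rewrite -big_split; apply: eq_bigr => a _; rewrite /h /= -mulnDl; congr (_ * _).
    by case: (ltngtP a i) => //=; rewrite ?orbF ?addn0.
  have delta (F : 'I_m.+1 -> nat) : \sum_(a < m.+1) (a == i) * F a = F i.
    rewrite (bigD1 i) //= eqxx mul1n big1 ?addn0 // => a /negPf ->; by rewrite mul0n.
  rewrite !kinvE.
  transitivity (\sum_(i0 < m.+1) \sum_(j < m.+1) (((i0 < j) && (s j < s i0)) * (W i0 * W j) +
     ((i0 == i) * (((i0 < j) && (s j < s i0)) * V j) + (j == i) * (((i0 < j) && (s j < s i0)) * V i0)))).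
    apply: eq_bigr => a _; apply: eq_bigr => b _; rewrite !VE.
    case: (boolP (a < b)) => ab /=; last by rewrite !mul0n !muln0.
    have : ~~ ((a == i) && (b == i)).
      by apply/negP => /andP[/eqP ea /eqP eb]; rewrite ea eb ltnn in ab.
    by case: (s b < s a); case: (a == i); case: (b == i) => //= _; lia.
  under eq_bigr do rewrite big_split /= big_split /=.
  rewrite big_split /= big_split /=; congr (_ + (_ + _)).
    under eq_bigr => a _ do rewrite -big_distrr /=.
    by rewrite delta.
  by apply: eq_bigr => a _; rewrite delta.
rewrite oddD -addbA; congr (_ (+) _); rewrite [\sum_(a < m.+1 | s a < _) _]big_mkcond [\sum_(a < m.+1 | a < _) _]big_mkcond.
apply: odd_sum_add => a; rewrite /h; case: (ltngtP a i) => [||/ord_inj ->]; last by rewrite ltnn mul0n.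
- move=> ai; have : s a != s i by rewrite (inj_eq perm_inj) -val_eqE /= neq_ltn ai.
  by rewrite -val_eqE /=; case: ltngtP => //= _ _; rewrite ?mul1n ?mul0n ?addbb.
- move=> ai; have : s a != s i by rewrite (inj_eq perm_inj) -val_eqE /= neq_ltn ai orbT.
  by rewrite -val_eqE /=; case: ltngtP => //= _ _; rewrite ?mul1n ?mul0n ?addbF.
Qed.

Lemma sum_slots m n (i : 'I_m.+1) (F : 'I_(m + n).+1 -> nat) :
  \sum_j F j = \sum_(a < m.+1 | a != i) F (unslot i (inl a)) + \sum_(b < n.+1) F (unslot i (inr b)).
Proof.
rewrite (reindex_onto (unslot i) (@slot m n i)) /=; last by move=> j _; apply: slotK.
rewrite big_sumType /=; congr (_ + _).
  apply: eq_bigl => a; apply/eqP/idP => [/slot_neq//|ai]; exact: unslotlK.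
by apply: eq_bigl => b; rewrite unslotrK eqxx.
Qed.

(** In the partial composite of two permutations the blocks of t move together,
    as one block whose degree is the sum of their degrees. *)
Lemma kinv_pcomp m n (i : 'I_m.+1) (s : 'S_m.+1) (t : 'S_n.+1) V V' W (U : 'I_(m + n).+1 -> nat) :
  (forall a, a != i -> U (unslot i (inl a)) = V a) -> (forall b, U (unslot i (inr b)) = V' b) ->
  (forall a, a != i -> W a = V a) -> W i = \sum_b V' b ->
  kinv (pcomp i s t) U = kinv s W + kinv t V'.
Proof.
move=> U1 U2 W1 W2; rewrite !kinvE (sum_slots i).
have ltll a a' : a != i -> a' != i -> (unslot (n := n) i (inl a) < unslot (n := n) i (inl a')) = (a < a').
  move=> ai a'i; rewrite !unslotl; move: ai a'i; rewrite -!val_eqE /=.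
  by do ?case: ifP; lia.
have ltlr a (b : 'I_n.+1) : a != i -> (unslot (n := n) i (inl a) < unslot i (inr b)) = (a < i).
  move=> ai; rewrite unslotl unslotr; move: ai; rewrite -!val_eqE /=.
  by have := ltn_ord b; do ?case: ifP; lia.
have ltrl a (b : 'I_n.+1) : a != i -> (unslot i (inr b) < unslot (n := n) i (inl a)) = (i < a).
  move=> ai; rewrite unslotl unslotr; move: ai; rewrite -!val_eqE /=.
  by have := ltn_ord b; do ?case: ifP; lia.
have ltrr (b b' : 'I_n.+1) (k : 'I_m.+1) : (unslot k (inr b) < unslot k (inr b')) = (b < b').
  by rewrite !unslotr ltn_add2l.
have ltll' a a' : a != i -> a' != i -> (unslot (n := n) (s i) (inl (s a)) < unslot (n := n) (s i) (inl (s a'))) = (s a < s a').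
  move=> ai a'i; have {}ai : s a != s i by rewrite (inj_eq perm_inj).
  have {}a'i : s a' != s i by rewrite (inj_eq perm_inj).
  rewrite !unslotl; move: ai a'i; rewrite -!val_eqE /=.
  by do ?case: ifP; lia.
have ltlr' a (b : 'I_n.+1) : a != i -> (unslot (n := n) (s i) (inl (s a)) < unslot (s i) (inr b)) = (s a < s i).
  move=> ai; have {}ai : s a != s i by rewrite (inj_eq perm_inj).
  rewrite unslotl unslotr; move: ai; rewrite -!val_eqE /=.
  by have := ltn_ord b; do ?case: ifP; lia.
have ltrl' a (b : 'I_n.+1) : a != i -> (unslot (s i) (inr b) < unslot (n := n) (s i) (inl (s a))) = (s i < s a).
  move=> ai; have {}ai : s a != s i by rewrite (inj_eq perm_inj).
  rewrite unslotl unslotr; move: ai; rewrite -!val_eqE /=.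
  by have := ltn_ord b; do ?case: ifP; lia.
rewrite [in RHS](bigD1 i) //= [X in _ = X + _]addnC -addnA; congr (_ + _).
  apply: eq_bigr => a ai; rewrite (sum_slots i) [in RHS](bigD1 i) //= [in RHS]addnC; congr (_ + _).
    by apply: eq_bigr => a' a'i; rewrite !pcompl // ltll // ltll' // !U1 // !W1.
  rewrite W1 // W2 !big_distrr /=; apply: eq_bigr => b _.
  by rewrite pcompl // pcompr ltlr // ltrl' // U1 // U2.
rewrite [in RHS](bigD1 i) //= ltnn mul0n add0n.
transitivity (\sum_(b < n.+1) (\sum_(a < m.+1 | a != i) ((i < a) && (s a < s i)) * (V' b * W a) +
   \sum_(b' < n.+1) ((b < b') && (t b' < t b)) * (V' b * V' b'))).
  apply: eq_bigr => b _; rewrite (sum_slots i); congr (_ + _).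
    by apply: eq_bigr => a ai; rewrite pcompl // pcompr ltrl // ltlr' // U1 // U2 W1.
  by apply: eq_bigr => b' _; rewrite !pcompr !ltrr !U2.
rewrite big_split /=; congr (_ + _).
rewrite exchange_big; apply: eq_bigr => a ai /=.
by rewrite W2 big_distrl big_distrr.
Qed.

End KoszulSigns.

(** * From the bar construction to marked trees *)

Section Bridge.
Variables (E : choiceType) (R : free_ns E 2 -> Prop) (A : Type) (p : nat).
Local Notation Q := (quot_ns (P := free_ns E) R).
Local Notation P := (regular_operad Q).
Local Notation dtr := (dtree (fun m => P m) A).
Local Notation dchain := {freeg dtr / int}.
Local Notation cell := (cell E A).
Local Notation chain := {freeg cell / int}.
Local Notation hi := p.+1.
Local Notation tw := (@tw E A p).
Local Notation dd := (@dd E A p).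
Local Notation K := (@rel_ideal E A p R).
Local Notation asml := (@asml E A p _).
Let Ksub := rel_subg A p R.

Local Open Scope quotient_scope.
(** Names for the projection of the free operad on its quotient, and for a choice
    of representatives. *)
Definition pi_ n (x : free_ns E n) : Q n := \pi_(Quotient.quot (@ideal (free_ns E) R n)) x.
Definition rep n (x : Q n) : free_ns E n := repr x.

Lemma pi_rep n (x : Q n) : pi_ (rep x) = x.
Proof. exact: reprK. Qed.

Lemma pi_ideal n (x y : free_ns E n) : pi_ x = pi_ y -> in_ideal R (x - y).
Proof.
move=> h; apply/asboolP; change (x - y \in @ideal (free_ns E) R n).
by rewrite Quotient.idealrBE; apply/eqP.
Qed.

Lemma pi_eq n (x y : free_ns E n) : in_ideal R (x - y) -> pi_ x = pi_ y.
Proof. exact: quot_pi0. Qed.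

Lemma rep_pi n (x : free_ns E n) : in_ideal R (rep (pi_ x) - x).
Proof. by apply: pi_ideal; rewrite pi_rep. Qed.

Lemma piB n (x y : free_ns E n) : pi_ (x - y) = pi_ x - pi_ y.
Proof. exact: quot_piB. Qed.

Lemma pi0 n : pi_ (0 : free_ns E n) = 0.
Proof. by rewrite -(subrr 0) piB subrr. Qed.

Lemma piN n (x : free_ns E n) : pi_ (- x) = - pi_ x.
Proof. by rewrite -sub0r piB pi0 sub0r. Qed.

Lemma piD n (x y : free_ns E n) : pi_ (x + y) = pi_ x + pi_ y.
Proof. by rewrite -[y]opprK piB piN !opprK. Qed.

Lemma rep0 n : in_ideal R (rep (0 : Q n)).
Proof. by have := rep_pi (0 : free_ns E n); rewrite pi0 subr0. Qed.

Lemma repD n (x y : Q n) : in_ideal R (rep (x + y) - rep x - rep y).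
Proof. by rewrite -addrA -opprD; apply: pi_ideal; rewrite piD !pi_rep. Qed.

Definition vert_ m (ch : 'I_m.+1 -> dtr) i := vertices (ch i).

(** From decorated trees to marked trees. A decoration of the regular operad is a
    family of operations of the quotient, indexed by the orders of the inputs;
    each of them is lifted to the free operad and becomes a piece, with the
    subtrees attached in the order in question. The mark of the root is q. An
    operation with a single input is not a piece, and is sent to 0. *)
Fixpoint nc q (t : dtr) : chain :=
  match t with
  | Leaf a => << CL a >>
  | Node m v ch =>
      if m == 0%N then 0 else
      \sum_(s : 'S_m.+1) sn (odd (kinv s (fun i => vertices (ch i))))
         (asml q 0 (fun j => nc hi (ch (s^-1%g (inord j)))) (rep ((v : reg_car Q m) s)))
  end.

Definition kids m (ch : 'I_m.+1 -> dtr) (s : 'S_m.+1) (j : nat) : chain :=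
  nc hi (ch (s^-1%g (inord j))).

Lemma ncE q m (v : P m) ch : (0 < m)%N -> nc q (Node m v ch) =
  \sum_(s : 'S_m.+1) sn (odd (kinv s (vert_ ch))) (asml q 0 (kids ch s) (rep ((v : reg_car Q m) s))).
Proof. by rewrite lt0n /= => /negPf ->. Qed.

Lemma ncE0 q (v : P 0) ch : nc q (Node 0 v ch) = 0.
Proof. by []. Qed.

Lemma asml_lt0 n s k f (x : free_car E n) : (0 < n)%N ->
  tw (asml s k f x) = sn (s == hi) (asml s k (fun i => tw (f i)) x).
Proof.
move=> n0; elim/freeg_basis_ind: x => [t||x y hx hy].
- by rewrite !asmlU tw_asm (eqP (bt_valP t)) -lt0n n0 andbT.
- by rewrite !asml0 tw0 sn0.
- by rewrite !asmlB twB hx hy snB.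
Qed.

Lemma asml_sn n s k f (c : nat -> bool) (x : free_car E n) :
  asml s k (fun i => sn (c i) (f i)) x =
  sn (odd (\sum_(i < n.+1) c (k + i)%N)) (asml s k f x).
Proof.
elim/freeg_basis_ind: x => [t||x y hx hy].
- by rewrite !asmlU asm_sn (eqP (bt_valP t)).
- by rewrite !asml0 sn0.
- by rewrite !asmlB hx hy snB.
Qed.

Lemma odd_sum_odd (I : finType) (F : I -> nat) : odd (\sum_i odd (F i))%N = odd (\sum_i F i)%N.
Proof.
have om := big_morph odd oddD (erefl (odd 0)).
by rewrite !om; apply: eq_bigr => i _; rewrite oddb.
Qed.

Lemma sn_sum (M : zmodType) (I : finType) b (F : I -> M) : sn b (\sum_i F i) = \sum_i sn b (F i).
Proof. by case: b => //=; rewrite sumrN. Qed.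

Lemma sum_perm m (s : 'S_m) (F : 'I_m -> nat) : (\sum_i F (s^-1%g i) = \sum_i F i)%N.
Proof.
by rewrite [RHS](reindex_inj (@perm_inj _ s^-1%g)).
Qed.

(** The root counts as cut here, so the number of cut edges is the number of
    vertices of t. *)
Lemma tw_nc t : tw (nc hi t) = sn (odd (vertices t)) (nc hi t).
Proof.
elim: t => [a|m v ch IH]; first by rewrite twU.
case: m v ch IH => [|m] v ch IH; first by rewrite ncE0 tw0 sn0.
rewrite ncE // (raddf_sum tw) sn_sum; apply: eq_bigr => s _ /=.
rewrite raddf_sn /= asml_lt0 // eqxx [RHS]snC; congr (sn _ _).
rewrite (_ : (fun i => _) = fun i => sn (odd (vert_ ch (s^-1%g (inord i)))) (kids ch s i)); last first.
  by apply/funext => i; rewrite IH.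
rewrite asml_sn sn_sn; congr (sn _ _); rewrite addTb.
congr (~~ _); rewrite (eq_bigr (fun i => odd (vert_ ch (s^-1%g i)) : nat)) => [|i _]; last first.
  by rewrite (inord_val i).
by rewrite odd_sum_odd (sum_perm s (vert_ ch)).
Qed.

Lemma nc_add q m (u v : P m) ch :
  K (nc q (Node m (u + v) ch) - nc q (Node m u ch) - nc q (Node m v ch)).
Proof.
case: m u v ch => [|m] u v ch; first by rewrite !ncE0 !subr0; apply: rel0.
rewrite !ncE // -!sumrB; apply: (subg_sum Ksub) => s _.
rewrite -!snB -!asmlB; apply: (subg_sn Ksub); apply: asml_ideal.
by rewrite ffunE; apply: repD.
Qed.

Lemma nc_tens q m (x : free_ns E m) (s : 'S_m.+1) ch : (0 < m)%N ->
  K (nc q (Node m (reg_tens (pi_ x) s : P m) ch) - sn (odd (kinv s (vert_ ch))) (asml q 0 (kids ch s) x)).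
Proof.
move=> m0; rewrite ncE // (bigD1 s) //= ffunE eqxx addrAC; apply: (subgD Ksub).
  rewrite -snB -asmlB; apply: (subg_sn Ksub); apply: asml_ideal; exact: rep_pi.
apply: (subg_sum Ksub) => r /negPf rs; apply: (subg_sn Ksub); rewrite ffunE rs.
by apply: asml_ideal; apply: rep0.
Qed.

Lemma reg_actE n (t s : 'S_n.+1) (x : reg_car Q n) : reg_act t x (t * s)%g = x s.
Proof.
rewrite /reg_act sum_ffunE (bigD1 s) //= ffunE eqxx big1 ?addr0 // => r rs.
by rewrite ffunE (inj_eq (mulgI t)) eq_sym (negPf rs).
Qed.

Lemma nc_act q m (s : 'S_m.+1) (v : P m) ch :
  nc q (Node m (op_act s v) ch) =
  sn (odd (kinv s (vert_ ch))) (nc q (Node m v (fun j => ch (s^-1%g j)))).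
Proof.
case: m s v ch => [|m] s v ch; first by rewrite !ncE0 sn0.
rewrite !ncE // sn_sum (reindex_inj (mulgI s)) /=; apply: eq_bigr => r _.
rewrite sn_sn odd_kinvM reg_actE; congr (sn _ _); apply: asml_ext => j _.
by rewrite /kids invMg permM.
Qed.

(** The dependence of a Koszul sign on the degree of the block i alone. *)
Lemma odd_kinv_at m (s : 'S_m.+1) (i : 'I_m.+1) (V : 'I_m.+1 -> nat) :
  odd (kinv s V) = odd (kinv s (fun a => if a == i then 0%N else V a)) (+)
   (odd (V i) && odd (\sum_(a < m.+1 | (s a < s i)%N) V a + \sum_(a < m.+1 | (a < i)%N) V a)%N).
Proof.
have [n] : exists n, V i = n by exists (V i).
elim: n V => [|n IHn] V Vi.
  rewrite Vi addbF; congr odd; apply: eq_kinv => a; by case: eqP => // ->.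
pose W a := if a == i then n else V a.
rewrite (@odd_kinv_shrink _ s i V W); last first.
- by move=> a /negPf ai; rewrite /W ai.
- by rewrite /W eqxx.
rewrite (IHn W); last by rewrite /W eqxx.
rewrite {2}/W eqxx Vi.
have e1 : (\sum_(a < m.+1 | (s a < s i)%N) W a = \sum_(a < m.+1 | (s a < s i)%N) V a)%N.
  by apply: eq_bigr => a h; rewrite /W; case: eqP h => // ->; rewrite ltnn.
have e2 : (\sum_(a < m.+1 | (a < i)%N) W a = \sum_(a < m.+1 | (a < i)%N) V a)%N.
  by apply: eq_bigr => a h; rewrite /W; case: eqP h => // ->; rewrite ltnn.
rewrite e1 e2 -!addbA; congr (_ (+) _).
  by congr odd; apply: eq_kinv => a; rewrite /W; case: eqP.
by rewrite /= oddD; case: (odd n); case: (odd _); case: (odd _).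
Qed.

(** The sign of permuting the other subtrees; [crossed] tells whether the subtree
    i moves past an odd degree, for which [tw] accounts then. *)
Definition inner_verts m (ch : 'I_m.+1 -> dtr) i : 'I_m.+1 -> nat :=
  fun a => if a == i then 0%N else vert_ ch a.
Definition crossed m (ch : 'I_m.+1 -> dtr) (s : 'S_m.+1) i : bool :=
  odd (\sum_(a < m.+1 | (s a < s i)%N) vert_ ch a + \sum_(a < m.+1 | (a < i)%N) vert_ ch a)%N.

Lemma kids_upd m (ch : 'I_m.+1 -> dtr) s i u j : (j <= m)%N ->
  kids (upd ch i u) s j = updf (kids ch s) (s i) (nc hi u) j.
Proof.
move=> hj; rewrite /kids /updf /upd.
have -> : (j == s i :> nat) = (s^-1%g (inord j) == i).
  rewrite -(inj_eq (@perm_inj _ s)) permKV -val_eqE /= inordK //.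
by case: eqP.
Qed.

Definition tw_if (c : bool) (x : chain) := if c then tw x else x.
Lemma tw_ifB c x y : tw_if c (x - y) = tw_if c x - tw_if c y.
Proof. by case: c; rewrite //= twB. Qed.
Lemma tw_if0 c : tw_if c 0 = 0.
Proof. by case: c; rewrite //= tw0. Qed.

Lemma perm_le m (s : 'S_m.+1) i : (0 <= s i <= 0 + m)%N.
Proof. by rewrite /= add0n -ltnS. Qed.

Lemma nc_ctx q m (v : P m) (ch : 'I_m.+1 -> dtr) i (x : dchain) : (0 < m)%N ->
  fglift (nc q) (fglift (fun u => << Node m v (upd ch i u) >> : dchain) x) =
  \sum_(s : 'S_m.+1) sn (odd (kinv s (inner_verts ch i)))
    (asml q 0 (updf (kids ch s) (s i) (tw_if (crossed ch s i) (fglift (nc hi) x)))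
      (rep ((v : reg_car Q m) s))).
Proof.
move=> m0; elim/freeg_basis_ind: x => [u||x y hx hy]; first last.
- rewrite !fgliftB hx hy -sumrB; apply: eq_bigr => s _.
  by rewrite -snB tw_ifB asml_updB ?perm_le.
- rewrite !fglift0 big1 // => s _; rewrite tw_if0 asml_upd0 ?sn0 ?perm_le //.
rewrite !fgliftU ncE //; apply: eq_bigr => s _.
rewrite (@odd_kinv_at _ s i) -sn_sn; congr (sn _ _).
  by congr odd; apply: eq_kinv => a; rewrite /inner_verts /vert_ /upd; case: eqP.
rewrite (_ : tw_if _ _ = sn (odd (vertices u) && crossed ch s i) (nc hi u)); last first.
  by case: (crossed _ _ _); rewrite /= ?andbT ?andbF //= tw_nc.
rewrite asml_upd_sn ?perm_le //; congr (sn _ _).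
  rewrite {1}/vert_ /upd eqxx; congr (_ && odd (_ + _)%N);
    by apply: eq_bigr => a; rewrite /vert_; case: eqP => // ->; rewrite ltnn.
by apply: asml_ext => j hj; apply: kids_upd; lia.
Qed.

(** The null chains are sent to relations: additivity holds up to the ideal, and
    the action of a permutation reindexes the sum over the orders. *)
Lemma nc_null (x : dchain) : bar_null x -> forall q, K (fglift (nc q) x).
Proof.
elim=> {x} [m u v ch|m s v ch|m v ch i x _ IH||x y _ hx _ hy] q.
- by rewrite !fgliftB !fgliftU; apply: nc_add.
- rewrite fgliftB fgliftU liftU nc_act /koszul_sign scale_sign.
  by rewrite subrr; apply: rel0.
- case: m v ch i => [|m] v ch i.
    rewrite (_ : fglift _ _ = 0); first exact: rel0.
    by elim/freeg_basis_ind: x {IH} => [u||x y hx hy]; rewrite ?fgliftU ?fglift0 ?fgliftB ?hx ?hy ?subr0.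
  rewrite nc_ctx //; apply: (subg_sum Ksub) => s _; apply: (subg_sn Ksub).
  apply: asml_updK; first exact: perm_le.
  by rewrite /tw_if; case: ifP => _; [apply: rel_tw|]; apply: IH.
- by rewrite fglift0; apply: rel0.
- by rewrite fgliftB; apply: relB.
Qed.

(** A leaf has no root edge that could be uncut, hence the distinction. *)
Definition nlo (t : dtr) : chain := if t is Node _ _ _ then nc p t else 0.

Lemma kids_plug m n (i : 'I_m.+1) (ch : 'I_m.+1 -> dtr) (ch' : 'I_n.+1 -> dtr)
    (s : 'S_m.+1) (t : 'S_n.+1) (x : free_car E m) (y : free_car E n) q : (0 < m)%N ->
  asml q 0 (kids (plug i ch ch') (pcomp i s t)) (free_comp (s i) x y) =
  asml q 0 (updf (kids ch s) (s i) (asml p 0 (kids ch' t) y)) x.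
Proof.
move=> m0; rewrite asml_graft gtn_eqF //; apply: asml_ext => j; rewrite !add0n /= => hj.
have outer a : a != i -> kids (plug i ch ch') (pcomp i s t) (unslot (n := n) (s i) (inl (s a))) = kids ch s (s a).
  move=> ai; rewrite /kids !inord_val permK -(pcompl s t ai) permK /plug.
  by rewrite unslotlK.
have hsi := ltn_ord (s i).
pose a := s^-1%g (inord j); have sa : s a = j :> nat by rewrite permKV inordK.
rewrite /updf -sa; case: ltngtP => h.
- have ai : a != i by apply: contraTneq h => ->; rewrite ltnn.
  by rewrite -(outer a ai); congr kids; rewrite unslotl h.
- have ai : a != i by apply: contraTneq h => ->; rewrite ltnn.
  by rewrite -(outer a ai); congr kids; rewrite unslotl ltnNge ltnW.
- rewrite -[(s i : nat)]addn0 asml_shift; apply: asml_ext => b; rewrite /= add0n => hb.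
  have -> : (s i + b)%N = unslot (s i) (inr (inord b : 'I_n.+1)) by rewrite unslotr inordK.
  rewrite /kids inord_val -[inord b](permKV t) -(pcompr i _ s t) permK /plug unslotrK.
  by rewrite !permKV.
Qed.

Lemma nc_sum q m (I : Type) (r : seq I) (v : I -> P m) ch :
  K (nc q (Node m (\sum_(i <- r) v i) ch) - \sum_(i <- r) nc q (Node m (v i) ch)).
Proof.
elim: r => [|i r IH].
  rewrite !big_nil subr0; have := nc_add q (0 : P m) 0 ch.
  by rewrite addr0 subrr sub0r => /(subgN Ksub); rewrite opprK.
rewrite !big_cons; have := subgD Ksub (nc_add q (v i) (\sum_(j <- r) v j) ch) IH.
set a := nc _ _; set b := nc _ _; set c := nc _ _; set d := \sum_(j <- r) _.
by rewrite (_ : a - b - c + (c - d) = a - (b + d)) //; zmod.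
Qed.

Definition shrunk m (ch : 'I_m.+1 -> dtr) i : 'I_m.+1 -> nat :=
  fun a => if a == i then (vertices (ch i)).-1 else vert_ ch a.

(** Contracting an edge composes the decorations; in the regular operad the order
    of the composite is the composite of the two orders, and the piece of the
    composite is the piece of w grafted, along an uncut edge, on that of v. *)
Lemma nc_contract q m (v : P m) (ch : 'I_m.+1 -> dtr) i n (w : P n) (ch' : 'I_n.+1 -> dtr) :
  (0 < m)%N -> (0 < n)%N -> ch i = Node n w ch' ->
  K (nc q (Node (m + n) (op_comp i v w) (plug i ch ch')) -
    \sum_(s : 'S_m.+1) sn (odd (kinv s (shrunk ch i)))
      (asml q 0 (updf (kids ch s) (s i) (nc p (Node n w ch'))) (rep ((v : reg_car Q m) s)))).
Proof.
move=> m0 n0 e.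
pose term (s : 'S_m.+1) (t : 'S_n.+1) : P (m + n) := reg_tens (ns_comp (s i) ((v : reg_car Q m) s) ((w : reg_car Q n) t)) (pcomp i s t).
have -> : op_comp i v w = \sum_(s : 'S_m.+1) \sum_(t : 'S_n.+1) term s t by [].
apply: (subg_trans Ksub (nc_sum _ _ _ _)); rewrite -sumrB; apply: (subg_sum Ksub) => s _.
apply: (subg_trans Ksub (nc_sum _ _ _ _)).
rewrite ncE // asml_upd_sum ?perm_le // sn_sum -sumrB; apply: (subg_sum Ksub) => t _.
have mn0 : (0 < m + n)%N by rewrite addn_gt0 m0.
have := nc_tens q (free_comp (s i) (rep ((v : reg_car Q m) s)) (rep ((w : reg_car Q n) t))) (pcomp i s t) (plug i ch ch') mn0.
rewrite kids_plug // (@kinv_pcomp m n i s t (vert_ ch) (vert_ ch') (shrunk ch i)).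
- by rewrite asml_upd_sn ?perm_le // sn_sn oddD.
- by move=> a ai; rewrite /vert_ /plug unslotlK.
- by move=> b; rewrite /vert_ /plug unslotrK.
- by move=> a /negPf ai; rewrite /shrunk ai.
- by rewrite /shrunk eqxx e.
Qed.

Lemma asml_dd n s k f (x : free_car E n) : (0 < n)%N -> dd (asml s k f x) =
  (if s == hi then asml p k f x else 0) +
  sn (s == hi) (\sum_(j < n.+1) asml s k (dder p f (k + j)%N) x).
Proof.
move=> n0; elim/freeg_basis_ind: x => [t||x y hx hy].
- rewrite !asmlU dd_asm (eqP (bt_valP t)) //; congr (_ + sn _ _).
  by apply: eq_bigr => j _; rewrite asmlU.
- rewrite !asml0 dd0 if_same add0r big1 ?sn0 // => j _; exact: asml0.
- rewrite !asmlB ddB hx hy (_ : \sum_(j < n.+1) asml s k (dder p f (k + j)%N) (x - y) =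
    \sum_(j < n.+1) asml s k (dder p f (k + j)%N) x - \sum_(j < n.+1) asml s k (dder p f (k + j)%N) y).
    by rewrite snB; case: ifP => _; zmod.
  by rewrite -sumrB; apply: eq_bigr => j _; rewrite asmlB.
Qed.

Lemma dder_kids q m (ch : 'I_m.+1 -> dtr) s i (x : free_car E m) :
  asml q 0 (dder p (kids ch s) (s i)) x =
  sn (odd (\sum_(a < m.+1 | (s a < s i)%N) vert_ ch a)%N)
    (asml q 0 (updf (kids ch s) (s i) (dd (nc hi (ch i)))) x).
Proof.
pose c j := (j < s i)%N && odd (vert_ ch (s^-1%g (inord j))).
transitivity (asml q 0 (fun j => sn (c j) (updf (kids ch s) (s i) (dd (nc hi (ch i))) j)) x).
  apply: asml_ext => j _; rewrite /dder /updf /c; case: ltngtP => //= h.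
    by rewrite /kids tw_nc.
  by rewrite h /kids inord_val permK.
rewrite asml_sn; congr (sn _ _); rewrite [in RHS]big_mkcond /=.
transitivity (odd (\sum_(j < m.+1) (if (j < s i)%N then vert_ ch (s^-1%g j) else 0%N))%N); last first.
  rewrite -(sum_perm s (fun a => if (s a < s i)%N then vert_ ch a else 0%N)).
  by congr odd; apply: eq_bigr => j _; rewrite permKV.
rewrite -(odd_sum_odd (fun j : 'I_m.+1 => if (j < s i)%N then vert_ ch (s^-1%g j) else 0%N)).
congr odd; apply: eq_bigr => j _; rewrite /c add0n (inord_val j).
by case: (j < s i)%N.
Qed.

Lemma bar_d_vertices (t : dtr) : span_of (fun u => (vertices u).+1 = vertices t) (bar_d t).
Proof.
have hS (Pr : dtr -> Prop) := subg_span_of Pr.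
elim: t => [a|m v ch IH] /=; first exact: in_span0.
apply: (subg_sum (hS _)) => i _; rewrite scale_sign; apply: (subg_sn (hS _)); apply: (subgD (hS _)).
  rewrite /contract; case e: (ch i) => [a|n w ch']; first exact: in_span0.
  apply: span_ofU => /=; congr _.+1.
  rewrite (sum_slots i) [in RHS](bigD1 i) //= e /= addnC addSn; congr (_ + _)%N.+1.
    by apply: eq_bigr => b _; rewrite /plug unslotrK.
  by apply: eq_bigr => a ai; rewrite /plug unslotlK.
apply: (span_of_lift (hS _)) (IH i) => u hu; apply: span_ofU => /=; congr _.+1.
rewrite (bigD1 i) //= [in RHS](bigD1 i) //= /upd eqxx -hu addSn; congr (_ + _)%N.+1.
by apply: eq_bigr => a /negPf ->.
Qed.

Lemma tw_bar_d (t : dtr) :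
  tw (fglift (nc hi) (bar_d t)) = sn (odd (vertices t).-1) (fglift (nc hi) (bar_d t)).
Proof.
move: (bar_d_vertices t); apply: (span_of_ind (G := fun x => tw (fglift (nc hi) x) = sn (odd (vertices t).-1) (fglift (nc hi) x))).
  split=> [|x y hx hy]; first by rewrite fglift0 tw0 sn0.
  by rewrite fgliftB twB hx hy snB.
by move=> u <-; rewrite fgliftU tw_nc.
Qed.

Lemma odd_kinv_shrunk m (s : 'S_m.+1) (ch : 'I_m.+1 -> dtr) i : (0 < vertices (ch i))%N ->
  odd (kinv s (vert_ ch)) = odd (kinv s (shrunk ch i)) (+)
    odd (\sum_(a < m.+1 | (s a < s i)%N) vert_ ch a)%N (+) odd (\sum_(a < m.+1 | (a < i)%N) vert_ ch a)%N.
Proof.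
move=> h; apply: odd_kinv_shrink; first by rewrite /shrunk eqxx prednK.
by move=> a /negPf ai; rewrite /shrunk ai.
Qed.

Lemma odd_kinv_inner m (s : 'S_m.+1) (ch : 'I_m.+1 -> dtr) i :
  odd (kinv s (shrunk ch i)) =
  odd (kinv s (inner_verts ch i)) (+) (odd (vertices (ch i)).-1 && crossed ch s i).
Proof.
rewrite (@odd_kinv_at _ s i); congr (odd _ (+) (_ && odd (_ + _)%N)).
- by apply: eq_kinv => a; rewrite /inner_verts /shrunk; case: eqP.
- by rewrite /shrunk eqxx.
- by apply: eq_bigr => a; rewrite /shrunk; case: eqP => // ->; rewrite ltnn.
- by apply: eq_bigr => a; rewrite /shrunk; case: eqP => // ->; rewrite ltnn.
Qed.

(** The part of the differential that concerns the subtree i: its root edge is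
    uncut, which is a contraction, or an edge inside of it is. *)
Lemma nc_edge q m (v : P m) (ch : 'I_m.+1 -> dtr) i : (0 < m)%N -> reduced (ch i) ->
  K (dd (nc hi (ch i)) - (nlo (ch i) + fglift (nc hi) (bar_d (ch i)))) ->
  K (\sum_(s : 'S_m.+1) sn (odd (kinv s (vert_ ch)))
       (asml q 0 (dder p (kids ch s) (s i)) (rep ((v : reg_car Q m) s))) -
     sn (odd (\sum_(a < m.+1 | (a < i)%N) vert_ ch a)%N)
       (fglift (nc q) (contract v ch i) +
        fglift (nc q) (fglift (fun u => << Node m v (upd ch i u) >> : dchain) (bar_d (ch i))))).
Proof.
move=> m0 red hK; rewrite nc_ctx //.
under eq_bigr => s _ do rewrite dder_kids sn_sn.
move: hK; case e: (ch i) red => [a|n w ch'] red.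
  move=> _; rewrite /contract e fglift0 add0r.
  rewrite big1 => [|s _]; last by rewrite ddU asml_upd0 ?sn0 ?perm_le.
  rewrite [X in sn _ X]big1 => [|s _]; last by rewrite /= fglift0 tw_if0 asml_upd0 ?sn0 ?perm_le.
  by rewrite sn0 subr0; apply: rel0.
move=> hK.
have n0 : (0 < n)%N by case/andP: red.
have V0 : (0 < vertices (ch i))%N by rewrite e.
rewrite /contract e fgliftU; set S_i := odd (\sum_(a < m.+1 | (a < i)%N) _)%N.
set Lo := nc p (Node n w ch'); set B := fglift (nc hi) (bar_d (Node n w ch')).
pose tot := \sum_(s : 'S_m.+1) sn (odd (kinv s (shrunk ch i)))
  (asml q 0 (updf (kids ch s) (s i) (Lo + B)) (rep ((v : reg_car Q m) s))).
have h1 : K (\sum_(s : 'S_m.+1) sn (odd (kinv s (vert_ ch)) (+)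
      odd (\sum_(a < m.+1 | (s a < s i)%N) vert_ ch a)%N)
      (asml q 0 (updf (kids ch s) (s i) (dd (nc hi (Node n w ch')))) (rep ((v : reg_car Q m) s)))
    - sn S_i tot).
  rewrite sn_sum -sumrB; apply: (subg_sum Ksub) => s _.
  rewrite (odd_kinv_shrunk s V0) sn_sn -/S_i.
  rewrite (_ : _ (+) _ (+) _ (+) _ = S_i (+) odd (kinv s (shrunk ch i))); last first.
    by case: (odd (kinv _ _)); case: S_i; case: (odd _).
  rewrite -snB -asml_updB ?perm_le //; apply: (subg_sn Ksub); apply: asml_updK => //.
  exact: perm_le.
apply: (subg_trans Ksub h1); rewrite -snB; apply: (subg_sn Ksub).
have h2 := nc_contract q v m0 n0 e.
rewrite opprD addrA; apply: (subg_eq Ksub (y := 0)); last exact: rel0.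
have -> : tot = \sum_(s : 'S_m.+1) sn (odd (kinv s (shrunk ch i)))
  (asml q 0 (updf (kids ch s) (s i) Lo) (rep ((v : reg_car Q m) s))) +
  \sum_(s : 'S_m.+1) sn (odd (kinv s (inner_verts ch i)))
    (asml q 0 (updf (kids ch s) (s i) (tw_if (crossed ch s i) B)) (rep ((v : reg_car Q m) s))).
  rewrite -big_split; apply: eq_bigr => s _ /=.
  rewrite asml_updD ?perm_le // snD; congr (_ + _).
  rewrite odd_kinv_inner -sn_sn; congr (sn _ _).
  rewrite (_ : tw_if _ _ = sn (odd (vertices (ch i)).-1 && crossed ch s i) B).
    by rewrite asml_upd_sn ?perm_le.
  by rewrite /B e; case: (crossed _ _ _); rewrite ?andbT ?andbF; [exact: tw_bar_d | by []].
rewrite subr0; have := subgN Ksub h2; rewrite opprB.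
by set a := \sum_(s : _) _; set b := nc _ _; set c := \sum_(s : _) _; rewrite (_ : a + c - b - c = a - b) //; zmod.
Qed.

Lemma nc_bar_dE q m (v : P m) (ch : 'I_m.+1 -> dtr) : fglift (nc q) (bar_d (Node m v ch)) =
  - \sum_(i < m.+1) sn (odd (\sum_(a < m.+1 | (a < i)%N) vert_ ch a)%N)
       (fglift (nc q) (contract v ch i) +
        fglift (nc q) (fglift (fun u => << Node m v (upd ch i u) >> : dchain) (bar_d (ch i)))).
Proof.
rewrite /= (raddf_sum (fglift (nc q))) -sumrN; apply: eq_bigr => i _ /=.
rewrite scale_sign (raddf_sn (fglift (nc q))) /= -fgliftD.
by case: (odd _); rewrite /= ?opprK.
Qed.

(** The differentials correspond up to an overall sign; the additional term is
    present when the root edge is itself a cut edge of the complex, as it is in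
    the induction for subtrees. *)
Theorem nc_bar_d (t : dtr) : reduced t -> forall q,
  K (dd (nc q t) - ((if q == hi then nlo t else 0) + sn (q == hi) (- fglift (nc q) (bar_d t)))).
Proof.
elim: t => [a|m v ch IH].
  by move=> _ q; rewrite /= ddU fglift0 oppr0 sn0 if_same addr0 subrr; apply: rel0.
case/andP=> m0 /forallP red q.
have edge i : K (dd (nc hi (ch i)) - (nlo (ch i) + fglift (nc hi) (bar_d (ch i)))).
  by have := IH i (red i) hi; rewrite eqxx /= opprK.
rewrite nc_bar_dE opprK [nc q _]ncE // (raddf_sum dd).
under eq_bigr => s _ do rewrite /= dd_sn asml_dd // snD.
rewrite big_split /= opprD addrACA; apply: (subgD Ksub).
  rewrite (_ : _ - _ = 0); first exact: rel0.
  apply/eqP; rewrite subr_eq0; apply/eqP; rewrite (gtn_eqF m0); case: (q == hi) => //.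
  by rewrite big1 // => s _; rewrite sn0.
under eq_bigr => s _ do rewrite snC.
rewrite -sn_sum -snB; apply: (subg_sn Ksub).
have -> : \sum_(s : 'S_m.+1) sn (odd (kinv s (vert_ ch)))
     (\sum_(j < m.+1) asml q 0 (dder p (kids ch s) (0 + j)%N) (rep ((v : reg_car Q m) s))) =
  \sum_(i < m.+1) \sum_(s : 'S_m.+1) sn (odd (kinv s (vert_ ch)))
     (asml q 0 (dder p (kids ch s) (s i)) (rep ((v : reg_car Q m) s))).
  rewrite exchange_big; apply: eq_bigr => s _ /=.
  by rewrite (reindex_inj (@perm_inj _ s)) sn_sum.
rewrite -sumrB; apply: (subg_sum Ksub) => i _.
exact: nc_edge.
Qed.

End Bridge.

(** * From marked trees to the bar construction *)

Section FromTrees.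
Variables (E : choiceType) (R : free_ns E 2 -> Prop) (A : Type) (a0 : A) (p : nat).
Local Notation Q := (quot_ns (P := free_ns E) R).
Local Notation P := (regular_operad Q).
Local Notation dtr := (dtree (fun m => P m) A).
Local Notation dchain := {freeg dtr / int}.
Local Notation cell := (cell E A).
Local Notation chain := {freeg cell / int}.
Local Notation hi := p.+1.
Local Notation tw := (@tw E A p).
Local Notation dd := (@dd E A p).
Local Notation K := (@rel_ideal E A p R).
Local Notation asml := (@asml E A p _).
Local Notation nc := (@nc E R A p).
Local Notation null := (@bar_null P A).
Let Ksub := rel_subg A p R.

Lemma null_subg : subg null.
Proof. by split; [apply: bar_null0 | apply: bar_nullB]. Qed.

(** The class of a tree in the regular operad, for the planar order of
    its inputs. *)
Definition dec m (t : btree E) : P m :=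
  if insub t is Some t' then reg_tens (pi_ R (<< t' >> : free_ns E m)) 1%g else 0.

Lemma decE m (t : bt_of E m) : dec m t = reg_tens (pi_ R (<< t >> : free_ns E m)) 1%g.
Proof. by rewrite /dec valK. Qed.

Definition mkn m (t : btree E) (ks : seq dtr) : dtr :=
  Node m (dec m t) (fun i => nth (Leaf a0) ks i).

(** The piece at the root and the decorated trees that hang from it. If the root
    edge is cut, the piece is empty and the whole tree hangs from it. *)
Fixpoint opn (t : cell) : btree E * seq dtr :=
  match t with
  | CL a => (BLeaf E, [:: Leaf a])
  | CN s e l r =>
      let b := BNode e (opn l).1 (opn r).1 in let ks := (opn l).2 ++ (opn r).2 in
      if s == p then (b, ks) else (BLeaf E, [:: mkn (size ks).-1 b ks])
  end.

(** The decorated tree of a marked tree; its root is a vertex of its own, whatever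
    the mark of the root edge is. *)
Definition sec (t : cell) : dtr :=
  match t with
  | CL a => Leaf a
  | CN s e l r =>
      let ks := (opn l).2 ++ (opn r).2 in
      mkn (size ks).-1 (BNode e (opn l).1 (opn r).1) ks
  end.

Definition secl (x : chain) : dchain := fglift (fun t => << sec t >> : dchain) x.

Lemma size_opn t : size (opn t).2 = (bt_size (opn t).1).+1.
Proof.
by elim: t => //= s e l hl r hr; case: ifP => _ //=; rewrite size_cat hl hr addSn addnS.
Qed.

(** ** Relations are sent to null chains *)

(** The family of trees G extends the relator u to the ideal in arity n. *)
Definition fam_ideal (u : free_ns E 2) (G : bt_of E 2 -> btree E) n : Prop :=
  exists h : forall t, bt_size (G t) == n,
    in_ideal R (fglift (fun t => << BtOf (h t) >> : free_car E n) u : free_ns E n).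

Lemma fam_base u : R u -> fam_ideal u (fun t => t) 2.
Proof.
move=> hu; exists (fun t => bt_valP t).
rewrite (_ : fglift _ _ = u); first exact: in_ideal_gen.
rewrite -[RHS]fglift_id; congr fglift; apply/funext => t; congr (<< _ >>).
exact: val_inj.
Qed.

Lemma fam_graftl u G n i v : fam_ideal u G n -> (i <= n)%N ->
  fam_ideal u (fun t => bt_graft (G t) i v) (n + bt_size v)%N.
Proof.
move=> [h hI] hi.
have h' t : bt_size (bt_graft (G t) i v) == (n + bt_size v)%N by rewrite bt_graft_size (eqP (h t)).
exists h'; pose i' : 'I_n.+1 := inord i; pose v' : free_ns E _ := << BtOf (eqxx (bt_size v)) >>.
rewrite (_ : fglift _ u = ns_comp i' (fglift (fun t => << BtOf (h t) >> : free_car E n) u : free_ns E n) v').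
  exact: in_ideal_compl.
elim/freeg_basis_ind: u {hI} => [t||x y hx hy].
- rewrite !fgliftU /= free_compU; congr (<< _ >>); apply: val_inj => /=.
  by rewrite inordK.
- by rewrite !fglift0 /= free_comp0l.
- by rewrite !fgliftB /= free_compBl hx hy.
Qed.

Lemma fam_graftr u G n i v : fam_ideal u G n -> (i <= bt_size v)%N ->
  fam_ideal u (fun t => bt_graft v i (G t)) (bt_size v + n)%N.
Proof.
move=> [h hI] hi.
have h' t : bt_size (bt_graft v i (G t)) == (bt_size v + n)%N by rewrite bt_graft_size (eqP (h t)).
exists h'; pose i' : 'I_(bt_size v).+1 := inord i; pose v' : free_ns E _ := << BtOf (eqxx (bt_size v)) >>.
rewrite (_ : fglift _ u = ns_comp i' v' (fglift (fun t => << BtOf (h t) >> : free_car E n) u : free_ns E n)).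
  exact: in_ideal_compr.
elim/freeg_basis_ind: u {hI} => [t||x y hx hy].
- rewrite !fgliftU /= free_compU; congr (<< _ >>); apply: val_inj => /=.
  by rewrite inordK.
- by rewrite !fglift0 /= free_comp0r.
- by rewrite !fgliftB /= free_compBr hx hy.
Qed.

Lemma null_node0 m (ch : 'I_m.+1 -> dtr) : null << Node m (0 : P m) ch >>.
Proof.
have := @bar_null_add P A m 0 0 ch; rewrite addr0 subrr sub0r => /(subgN null_subg).
by rewrite opprK.
Qed.

Lemma null_nodeB m (v w : P m) (ch : 'I_m.+1 -> dtr) :
  null (<< Node m (v - w) ch >> - (<< Node m v ch >> - << Node m w ch >>)).
Proof.
have := @bar_null_add P A m (v - w) w ch; rewrite subrK => /(subgN null_subg).
set a := << Node _ v _ >>; set b := << Node _ (v - w) _ >>; set c := << Node _ w _ >>.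
by rewrite (_ : - (a - b - c) = b - (a - c)) //; zmod.
Qed.

Lemma reg_tensB n (x y : Q n) (s : 'S_n.+1) : reg_tens (x - y) s = reg_tens x s - reg_tens y s.
Proof. by apply/ffunP => r; rewrite !ffunE; case: eqP => _; rewrite ?subr0. Qed.

Lemma null_fam u G m (ks : seq dtr) : fam_ideal u G m ->
  null (fglift (fun t => << mkn m (G t) ks >> : dchain) u).
Proof.
move=> [h hI]; pose ch (i : 'I_m.+1) := nth (Leaf a0) ks i.
pose v (u : free_car E 2) : free_ns E m := fglift (fun t => << BtOf (h t) >> : free_car E m) u.
suff H w : null (fglift (fun t => << mkn m (G t) ks >> : dchain) w -
    << Node m (reg_tens (pi_ R (v w)) 1%g : P m) ch >>).
  apply: (subg_eq null_subg (H u)).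
  have -> : pi_ R (v u) = 0 by rewrite -(pi0 R); apply: pi_eq; rewrite subr0.
  by rewrite reg_tens0; apply: null_node0.
elim/freeg_basis_ind: w => [t||x y hx hy].
- by rewrite /v !fgliftU /mkn -(decE (BtOf (h t))) subrr; apply: bar_null0.
- by rewrite /v !fglift0 sub0r pi0 reg_tens0; apply: (subgN null_subg); apply: null_node0.
- have -> : v (x - y) = v x - v y by apply: fgliftB.
  rewrite fgliftB piB reg_tensB.
  apply: (subg_trans null_subg (subgBB null_subg hx hy)).
  exact: (subg_sym null_subg (null_nodeB _ _ _)).
Qed.

Definition sub3 (t ta tb tc : btree E) := bt_graft (bt_graft (bt_graft t 2 tc) 1 tb) 0 ta.

Lemma fam_sub3 u ta tb tc : R u ->
  fam_ideal u (fun t => sub3 t ta tb tc) (2 + bt_size tc + bt_size tb + bt_size ta)%N.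
Proof. by move=> hu; do 3![apply: fam_graftl => //]; apply: fam_base. Qed.

(** The decorated tree obtained when the marked tree t is joined to an input of a
    larger piece T0. It makes [null_rel] a statement about all places where a
    relation may occur: either inside the piece of the root or below a cut
    edge. *)
Definition wrap T0 i (ks1 ks2 : seq dtr) (t : cell) : dchain :=
  << mkn (bt_size T0 + bt_size (opn t).1)%N (bt_graft T0 i (opn t).1) (ks1 ++ (opn t).2 ++ ks2) >>.

Lemma secE s e l r : << sec (CN s e l r) >> = wrap (BNode e (BLeaf E) (opn r).1) 0 [::] (opn r).2 l.
Proof.
rewrite /wrap /= size_cat !size_opn addnS add0n; congr (<< mkn _ _ _ >>).
by rewrite addSn addnC.
Qed.

Lemma secE' s e l r : << sec (CN s e l r) >> =
  wrap (BNode e (opn l).1 (BLeaf E)) (bt_size (opn l).1).+1 (opn l).2 [::] r.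
Proof.
rewrite /wrap /= size_cat !size_opn addnS addn0 ltnn cats0; congr (<< mkn _ _ _ >>).
Qed.

Lemma wrap_l T0 i ks1 ks2 e l r : (i <= bt_size T0)%N ->
  wrap T0 i ks1 ks2 (CN p e l r) =
  wrap (bt_graft T0 i (BNode e (BLeaf E) (opn r).1)) i ks1 ((opn r).2 ++ ks2) l.
Proof.
move=> hi; rewrite /wrap /= eqxx /= -!catA; congr (<< mkn _ _ _ >>).
  by rewrite bt_graft_size /=; lia.
by have := @bt_graftA E T0 i (BNode e (BLeaf E) (opn r).1) 0 (opn l).1 hi isT; rewrite /= addn0.
Qed.

Lemma wrap_r T0 i ks1 ks2 e l r : (i <= bt_size T0)%N ->
  wrap T0 i ks1 ks2 (CN p e l r) =
  wrap (bt_graft T0 i (BNode e (opn l).1 (BLeaf E))) (i + (bt_size (opn l).1).+1)%N (ks1 ++ (opn l).2) ks2 r.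
Proof.
move=> hi; rewrite /wrap /= eqxx /= -!catA; congr (<< mkn _ _ _ >>).
  by rewrite bt_graft_size /=; lia.
by rewrite -bt_graftA //= ?addn0 // ltnn.
Qed.

Definition is_cut (t : cell) := if t is CN s _ _ _ then s != p else false.

Lemma wrap_cut T0 i ks1 ks2 t : is_cut t -> (i <= bt_size T0)%N -> size ks1 = i ->
  wrap T0 i ks1 ks2 t =
  << Node (bt_size T0) (dec (bt_size T0) T0)
      (upd (fun j => nth (Leaf a0) (ks1 ++ Leaf a0 :: ks2) j) (inord i) (sec t)) >>.
Proof.
case: t => //= s e l r /negPf sp hi hs.
rewrite /wrap /= sp /= addn0 bt_graft1r /mkn; congr (<< Node _ _ _ >>).
apply/funext => j; rewrite /upd -val_eqE /= inordK // !nth_cat hs.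
case: ltngtP => [//|h|->]; last by rewrite subnn.
by have : (0 < j - i)%N; [rewrite subn_gt0 | case: (j - i)%N].
Qed.

Lemma fglift_ndl (M : lmodType int) (f : cell -> M) s e x r :
  fglift f (nd s e x << r >>) = fglift (fun l => f (CN s e l r)) x.
Proof.
elim/freeg_basis_ind: x => [l||x y hx hy].
- by rewrite ndU !fgliftU.
- by rewrite nd0l !fglift0.
- by rewrite ndBl !fgliftB hx hy.
Qed.

Lemma fglift_ndr (M : lmodType int) (f : cell -> M) s e l x :
  fglift f (nd s e << l >> x) = fglift (fun r => f (CN s e l r)) x.
Proof.
elim/freeg_basis_ind: x => [r||x y hx hy].
- by rewrite ndU !fgliftU.
- by rewrite nd0r !fglift0.
- by rewrite ndBr !fgliftB hx hy.
Qed.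

Lemma fglift_comp (K1 K2 : choiceType) (M : lmodType int) (f : K2 -> M) (g : K1 -> {freeg K2 / int}) x :
  fglift f (fglift g x) = fglift (fun k => fglift f (g k)) x.
Proof.
elim/freeg_basis_ind: x => [k||x y hx hy].
- by rewrite !fgliftU.
- by rewrite !fglift0.
- by rewrite !fgliftB hx hy.
Qed.

Lemma null_ctx_wrap T0 i ks1 ks2 (I : choiceType) (c : I -> cell) x :
  (forall k, is_cut (c k)) -> (i <= bt_size T0)%N -> size ks1 = i ->
  null (fglift (fun k => << sec (c k) >> : dchain) x) ->
  null (fglift (fun k => wrap T0 i ks1 ks2 (c k)) x).
Proof.
move=> hc hi hs hn.
pose ctx u : dchain := << Node (bt_size T0) (dec (bt_size T0) T0)
  (upd (fun j => nth (Leaf a0) (ks1 ++ Leaf a0 :: ks2) j) (inord i) u) >>.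
rewrite (_ : fglift _ x = fglift ctx (fglift (fun k => << sec (c k) >> : dchain) x)).
  exact: bar_null_ctx.
rewrite fglift_comp; congr fglift; apply/funext => k; rewrite fgliftU.
exact: wrap_cut.
Qed.

Lemma null_rel x : K x -> null (secl x) /\
  forall T0 i ks1 ks2, (i <= bt_size T0)%N -> size ks1 = i -> null (fglift (wrap T0 i ks1 ks2) x).
Proof.
elim=> {x} [s u a b c hu|s e x r _ [_ hx]|s e l x _ [_ hx]||x y _ [hx hx'] _ [hy hy']].
- pose ks := (opn a).2 ++ (opn b).2 ++ (opn c).2.
  pose M := (2 + bt_size (opn c).1 + bt_size (opn b).1 + bt_size (opn a).1)%N.
  have secg : secl (graft_rel p s u << a >> << b >> << c >>) =
      fglift (fun t : bt_of E 2 => << mkn M (sub3 t (opn a).1 (opn b).1 (opn c).1) ks >> : dchain) u.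
    rewrite /secl /graft_rel fglift_comp; congr fglift; apply/funext => t.
    case: (bt2P t) => e e' /=; rewrite !ndU fgliftU /= eqxx /= /ks ?catA; congr (<< mkn _ _ _ >>);
      by rewrite !size_cat !size_opn /M; lia.
  have nsec : null (secl (graft_rel p s u << a >> << b >> << c >>)).
    by rewrite secg; apply: null_fam; apply: fam_sub3.
  split=> // T0 i ks1 ks2 hi hs; case: (eqVneq s p) => [->|sp].
    rewrite (_ : fglift _ _ = fglift (fun t : bt_of E 2 => << mkn (bt_size T0 + M)%N
       (bt_graft T0 i (sub3 t (opn a).1 (opn b).1 (opn c).1)) (ks1 ++ ks ++ ks2) >> : dchain) u).
      by apply: null_fam; apply: fam_graftr => //; apply: fam_sub3.
    rewrite /graft_rel fglift_comp; congr fglift; apply/funext => t.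
    case: (bt2P t) => e e' /=; rewrite !ndU fgliftU /wrap /= eqxx /= /ks -?catA; congr (<< mkn _ _ _ >>);
      by congr (_ + _)%N; rewrite /M; move: (bt_size (opn a).1) (bt_size (opn b).1) (bt_size (opn c).1) => ? ? ?; lia.
  pose g (t : bt_of E 2) : cell := match bt_val t with
    | BNode e (BNode e' _ _) BLeaf => CN s e (CN p e' a b) c
    | BNode e BLeaf (BNode e' _ _) => CN s e a (CN p e' b c) | _ => CL a0 end.
  have gE (M' : lmodType int) (f : cell -> M') :
      fglift f (graft_rel p s u << a >> << b >> << c >>) = fglift (fun t => f (g t)) u.
    rewrite /graft_rel fglift_comp; congr fglift; apply/funext => t.
    by rewrite /g; case: (bt2P t) => e e' /=; rewrite !ndU fgliftU.
  move: nsec; rewrite /secl !gE; apply: null_ctx_wrap => // t.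
  by rewrite /g; case: (bt2P t).
- split=> [|T0 i ks1 ks2 hi hs].
    rewrite /secl fglift_ndl.
    rewrite (_ : (fun l => _) = wrap (BNode e (BLeaf E) (opn r).1) 0 [::] (opn r).2); first exact: hx.
    by apply/funext => l; apply: secE.
  rewrite fglift_ndl; case: (eqVneq s p) => [->|sp].
    rewrite (_ : (fun l => _) = wrap (bt_graft T0 i (BNode e (BLeaf E) (opn r).1)) i ks1 ((opn r).2 ++ ks2)).
      by apply: hx => //; rewrite bt_graft_size; lia.
    by apply/funext => l; apply: wrap_l.
  apply: (@null_ctx_wrap T0 i ks1 ks2 _ (fun l => CN s e l r)) => //.
  rewrite (_ : (fun l => _) = wrap (BNode e (BLeaf E) (opn r).1) 0 [::] (opn r).2); first exact: hx.
  by apply/funext => l; apply: secE.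
- split=> [|T0 i ks1 ks2 hi hs].
    rewrite /secl fglift_ndr.
    rewrite (_ : (fun r => _) = wrap (BNode e (opn l).1 (BLeaf E)) (bt_size (opn l).1).+1 (opn l).2 [::]).
      by apply: hx; rewrite /= ?addn0 // size_opn.
    by apply/funext => r; apply: secE'.
  rewrite fglift_ndr; case: (eqVneq s p) => [->|sp].
    rewrite (_ : (fun r => _) = wrap (bt_graft T0 i (BNode e (opn l).1 (BLeaf E))) (i + (bt_size (opn l).1).+1)%N (ks1 ++ (opn l).2) ks2).
      apply: hx => //; first by rewrite bt_graft_size /=; lia.
      by rewrite size_cat size_opn hs.
    by apply/funext => r; apply: wrap_r.
  apply: (@null_ctx_wrap T0 i ks1 ks2 _ (fun r => CN s e l r)) => //.
  rewrite (_ : (fun r => _) = wrap (BNode e (opn l).1 (BLeaf E)) (bt_size (opn l).1).+1 (opn l).2 [::]).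
    by apply: hx; rewrite /= ?addn0 // size_opn.
  by apply/funext => r; apply: secE'.
- split=> [|T0 i ks1 ks2 _ _]; rewrite /secl fglift0; exact: bar_null0.
- split=> [|T0 i ks1 ks2 hi hs]; rewrite /secl fgliftB; apply: bar_nullB; by [|apply: hx'|apply: hy'].
Qed.

(** ** The two passages are inverse to each other *)

Fixpoint lo_hi (t : cell) : bool :=
  if t is CN s _ l r then [&& (s == p) || (s == hi), lo_hi l & lo_hi r] else true.

(** The shape of the marked trees that come from the bar construction. *)
Definition topped q (t : cell) : bool :=
  if t is CN s _ l r then [&& s == q, lo_hi l & lo_hi r] else true.

Definition kid_at (ks : seq dtr) (j : nat) : chain := nc hi (nth (Leaf a0) ks j).

Lemma nc_mkn q m (b : bt_of E m) (ks : seq dtr) : (0 < m)%N ->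
  K (nc q (mkn m b ks) - asm p q b 0 (kid_at ks)).
Proof.
move=> m0; rewrite /mkn decE.
have := @nc_tens E R A p q m << b >> 1%g (fun i : 'I_m.+1 => nth (Leaf a0) ks i) m0.
rewrite kinv1 /= asmlU (_ : asm p q b 0 _ = asm p q b 0 (kid_at ks)) //.
apply: asm_ext => j; rewrite (eqP (bt_valP b)) /= add0n => hj.
by rewrite /kids /kid_at invg1 perm1 inordK.
Qed.

(** The representatives chosen by [nc] for the piece of the root may be replaced
    by that piece, up to relations. *)
Lemma nc_block q s e l r :
  K (asm p p (opn l).1 0 (kid_at (opn l).2) - << l >>) ->
  K (asm p p (opn r).1 0 (kid_at (opn r).2) - << r >>) ->
  K (nc q (sec (CN s e l r)) - << CN q e l r >>).
Proof.
move=> hl hr; rewrite /sec.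
set B := BNode _ _ _; set ks := _ ++ _.
have hB : bt_size B == (size ks).-1 by rewrite size_cat !size_opn addSn addnS.
have k0 : (0 < (size ks).-1)%N by rewrite -(eqP hB).
apply: (subg_trans Ksub (nc_mkn q (BtOf hB) ks k0)) => /=.
have e1 : asm p p (opn l).1 0 (kid_at ks) = asm p p (opn l).1 0 (kid_at (opn l).2).
  by apply: asm_ext => j hj; rewrite /kid_at nth_cat size_opn ifT.
have e2 : asm p p (opn r).1 (0 + (bt_size (opn l).1).+1)%N (kid_at ks) = asm p p (opn r).1 0 (kid_at (opn r).2).
  rewrite add0n -[(bt_size _).+1]addn0 asm_shift; apply: asm_ext => j hj.
  by rewrite /kid_at nth_cat size_opn ifN ?addKn // -leqNgt leq_addr.
rewrite e1 e2 -ndU.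
rewrite (_ : _ - _ = nd q e (asm p p (opn l).1 0 (kid_at (opn l).2) - << l >>) (asm p p (opn r).1 0 (kid_at (opn r).2)) +
  nd q e << l >> (asm p p (opn r).1 0 (kid_at (opn r).2) - << r >>)); last by rewrite ndBl ndBr; zmod.
by apply: (subgD Ksub); [apply: rel_nd_l | apply: rel_nd_r].
Qed.

Lemma nc_opn t : lo_hi t -> K (asm p p (opn t).1 0 (kid_at (opn t).2) - << t >>).
Proof.
elim: t => [a|s e l hl r hr]; first by rewrite /= subrr => _; apply: rel0.
move=> /= /and3P[hs /hl kl /hr kr]; case: eqP hs => [->|_] /=; last first.
  by move=> /eqP ->; apply: nc_block kl kr.
move=> _; have := nc_block p p e kl kr; rewrite /sec.
set B := BNode _ _ _; set ks := _ ++ _.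
have hB : bt_size B == (size ks).-1 by rewrite size_cat !size_opn addSn addnS.
have k0 : (0 < (size ks).-1)%N by rewrite -(eqP hB).
have /(subg_sym Ksub) h1 := nc_mkn p (BtOf hB) ks k0.
exact: (subg_trans Ksub h1).
Qed.

Lemma nc_sec q t : topped q t -> K (nc q (sec t) - << t >>).
Proof.
case: t => [a|s e l r]; first by rewrite /= subrr => _; apply: rel0.
by case/and3P=> /eqP -> hl hr; apply: nc_block; apply: nc_opn.
Qed.

Lemma nc_secl q y : span_of (topped q) y -> K (fglift (nc q) (secl y) - y).
Proof.
apply: (span_of_ind (G := fun y => K (fglift (nc q) (secl y) - y))) => [|t ht].
  split=> [|x z hx hz]; first by rewrite /secl !fglift0 subrr; apply: rel0.
  by rewrite /secl !fgliftB; apply: (subgBB Ksub).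
by rewrite /secl !fgliftU; apply: nc_sec.
Qed.

(** Chains that come from marked trees, up to null chains. *)
Definition spanned q (z : dchain) : Prop :=
  exists2 y, span_of (topped q) y & null (z - secl y).

Lemma spanned_subg q : subg (spanned q).
Proof.
split=> [|z z' [y hy hn] [y' hy' hn']].
  by exists 0; [apply: in_span0 | rewrite /secl fglift0 subrr; apply: bar_null0].
exists (y - y'); first exact: in_spanB.
by rewrite /secl fgliftB; apply: (subgBB null_subg).
Qed.

Lemma spanned_null q z z' : null (z - z') -> spanned q z' -> spanned q z.
Proof. by move=> h [y hy hn]; exists y => //; apply: (subg_trans null_subg h hn). Qed.

Lemma spanned_sec q t : topped q t -> spanned q << sec t >>.
Proof.
move=> h; exists << t >>; first exact: span_ofU.
by rewrite /secl fgliftU subrr; apply: bar_null0.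
Qed.

Fixpoint asmc s (b : btree E) k (f : nat -> cell) : cell :=
  match b with
  | BLeaf => f k
  | BNode e l r => CN s e (asmc p l k f) (asmc p r (k + (bt_size l).+1)%N f)
  end.

Lemma lo_hi_asmc b k f : (forall j, lo_hi (f j)) -> lo_hi (asmc p b k f).
Proof. by move=> h; elim: b k => //= e l hl r hr k; rewrite eqxx hl hr. Qed.

Lemma map_iotaD (T : Type) (g : nat -> T) k a b :
  [seq g j | j <- iota k a.+1] ++ [seq g j | j <- iota (k + a.+1) b.+1] =
  [seq g j | j <- iota k (a + b).+2].
Proof. by rewrite -map_cat -iotaD addSn addnS. Qed.

Lemma opn_asmc b k f g : (forall j, opn (f j) = (BLeaf E, [:: g j])) ->
  opn (asmc p b k f) = (b, [seq g j | j <- iota k (bt_size b).+1]).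
Proof.
move=> h; elim: b k => [|e l hl r hr] k /=; first exact: h.
by rewrite eqxx hl hr /=; congr pair; exact: map_iotaD.
Qed.

Lemma opn_cut t : opn (set_root hi t) = (BLeaf E, [:: sec t]).
Proof. by case: t => //= s e l r; rewrite gtn_eqF. Qed.

Lemma lo_hi_cut q t : topped q t -> lo_hi (set_root hi t).
Proof. by case: t => //= s e l r /and3P[_ -> ->]; rewrite eqxx orbT. Qed.

Definition good q (u : dtr) := exists2 c, topped q c & u = sec c.

Lemma good_node q m (b : bt_of E m) (ch : 'I_m.+1 -> dtr) : (0 < m)%N ->
  (forall i, good q (ch i)) ->
  good q (Node m (reg_tens (pi_ R (<< b >> : free_ns E m)) 1%g : P m) ch).
Proof.
move=> m0 hch; have /choice[c hc] : forall i, exists c, topped q c /\ ch i = sec c.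
  by move=> i; have [c h1 h2] := hch i; exists c.
pose f j := set_root hi (c (inord j)).
exists (asmc q b 0 f).
  case: (b) m0 => -[|e l r] //= hb m0; first by move: (hb) m0 => /eqP <-.
  by rewrite eqxx !lo_hi_asmc // => j; apply: lo_hi_cut (proj1 (hc _)).
rewrite -decE; have hb := eqP (bt_valP b).
have opnf j : opn (f j) = (BLeaf E, [:: sec (c (inord j))]) by apply: opn_cut.
case: b hb => -[|e l r] /= ib hb; first by exfalso; move: m0; rewrite -hb.
rewrite (opn_asmc l 0 opnf) (opn_asmc r _ opnf) [(_, _).1]/= [(_, _).2]/=.
have -> : [seq sec (c (inord j)) | j <- iota 0 (bt_size l).+1] ++
    [seq sec (c (inord j)) | j <- iota (0 + (bt_size l).+1) (bt_size r).+1] =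
    [seq sec (c (inord j)) | j <- iota 0 m.+1] by rewrite map_iotaD; congr [seq _ | _ <- iota 0 _.+1].
rewrite size_map size_iota -[m.+1.-1]/m /mkn; congr Node; apply/funext => i.
by rewrite (nth_map 0%N) ?size_iota // nth_iota // add0n inord_val (proj2 (hc _)).
Qed.

Lemma koszul_signE m (s : 'S_m.+1) (ch : 'I_m.+1 -> dtr) u :
  << koszul_sign s ch *g u >> = sn (odd (kinv s (vert_ ch))) << u >> :> dchain.
Proof.
rewrite /koszul_sign -signr_odd -/(kinv s (vert_ ch)).
by case: (odd _); rewrite //= freegUN.
Qed.

Lemma spanned_good_node q m (v : P m) (ch : 'I_m.+1 -> dtr) : (0 < m)%N ->
  (forall i, good q (ch i)) -> spanned q << Node m v ch >>.
Proof.
move=> m0 hch; have Ssub := spanned_subg q.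
elim/(@reg_tens_ind Q m): (v : reg_car Q m) => [x s|x y hx hy]; last first.
  have := @bar_null_add P A m x y ch; rewrite -addrA -opprD => h.
  by apply: (spanned_null h); apply: (subgD Ssub).
have -> : reg_tens x s = op_act (o := P) s (reg_tens x 1%g : P m).
  by rewrite /= reg_act_tens mulg1.
have := @bar_null_act P A m s (reg_tens x 1%g) ch; rewrite koszul_signE => h.
apply: (spanned_null h); apply: (subg_sn Ssub).
rewrite -[x](@pi_rep E R).
elim/freeg_basis_ind: (rep x) => [b||y z hy hz].
- have [c h1 ->] := @good_node q m b (fun j => ch (s^-1%g j)) m0 (fun j => hch _).
  exact: spanned_sec.
- rewrite pi0 reg_tens0; exists 0; first exact: in_span0.
  by rewrite /secl fglift0 subr0; apply: null_node0.
- rewrite piB reg_tensB; apply: (spanned_null (null_nodeB _ _ _)).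
  exact: (subgB Ssub).
Qed.

(** The children are replaced one after another by trees that come from marked
    trees; when all of them do, the decoration is expanded into trees of the free
    operad and orders of the inputs. *)
Lemma spanned_reduced q (t : dtr) : reduced t -> spanned q << t >>.
Proof.
have Ssub := spanned_subg q.
elim: t => [a _|m v ch IH]; first exact: (@spanned_sec q (CL a)).
case/andP=> m0 /forallP red; have {red}IH i : spanned q << ch i >> := IH i (red i).
have [k] : exists k, forall i : 'I_m.+1, (k <= i)%N -> good q (ch i).
  by exists m.+1 => i; rewrite leqNgt ltn_ord.
elim: k ch IH => [|k IHk] ch IH hk; first by apply: spanned_good_node => // i; apply: hk.
case: (ltnP k m.+1) => km; last by apply: IHk => // i; have := ltn_ord i; lia.
pose i0 := Ordinal km; have [y hy hn] := IH i0.
pose ctx u : dchain := << Node m v (upd ch i0 u) >>.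
have hE : << Node m v ch >> = fglift ctx << ch i0 >> :> dchain.
  rewrite fgliftU /ctx; congr (<< Node _ _ _ >>); apply/funext => j; rewrite /upd.
  by case: eqP => [->|].
have := bar_null_ctx (A := A) v ch i0 hn; rewrite fgliftB -/ctx -hE => h.
apply: (spanned_null h); rewrite /secl fglift_comp; move: hy.
apply: (span_of_lift Ssub) => c hc; rewrite fgliftU; apply: IHk => [j|j hj].
  by rewrite /upd; case: eqP => // _; apply: spanned_sec.
rewrite /upd; case: eqP => [_|/eqP ji]; first by exists c.
by apply: hk; rewrite ltn_neqAle hj andbT; move: ji; rewrite -val_eqE eq_sym.
Qed.

(** Injectivity of the passage to marked trees: z comes from a marked chain y, and
    y is congruent to the image of z, so it is a relation, and its decorated trees
    form a null chain. *)
Theorem null_nc q z : span_of (@reduced P A) z -> K (fglift (nc q) z) -> null z.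
Proof.
move=> hz hK; have [y hy hn] : spanned q z.
  by apply: span_of_ind hz => [|t]; [apply: spanned_subg | apply: spanned_reduced].
have h1 := nc_null p hn q; rewrite fgliftB in h1.
have Ky : K y.
  have := subgB Ksub hK (subgD Ksub h1 (nc_secl hy)).
  by set a := fglift (nc q) z; set b := fglift (nc q) (secl y); rewrite (_ : a - (a - b + (b - y)) = y) //; zmod.
exact: (subg_eq null_subg hn (proj1 (null_rel Ky))).
Qed.

End FromTrees.

(** * Koszulness from the exactness of the complex of marked trees *)

Section Statistics.
Variables (E : finType) (R : free_ns E 2 -> Prop) (A : eqType) (a0 : A) (p : nat).
Local Notation Q := (quot_ns (P := free_ns E) R).
Local Notation P := (regular_operad Q).
Local Notation dtr := (dtree (fun m => P m) A).
Local Notation dchain := {freeg dtr / int}.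
Local Notation cell := (cell E A).
Local Notation chain := {freeg cell / int}.
Local Notation hi := p.+1.
Local Notation dd := (@dd E A p).
Local Notation K := (@rel_ideal E A p R).
Local Notation nc := (@nc E R A p).
Local Notation null := (@bar_null P A).
Local Notation secl := (@secl E R A a0 p).
Local Notation sec := (@sec E R A a0 p).
Local Notation opn := (@opn E R A a0 p).
Local Notation lo_hi := (@lo_hi E A p).
Local Notation topped := (@topped E A p).

(** The number of pieces, including that of the root. *)
Definition block_count (c : cell) : nat :=
  if c is CN _ _ l r then (count_state hi l + count_state hi r).+1 else 0.

(** The leaves, the weight and the degree of a decorated tree are read off from
    its marked trees; only the order of the leaves may differ. *)
Definition same_stats q (t : dtr) (c : cell) : Prop :=
  [/\ perm_eq (leaf_seq c) (leaves t), cell_size c = weight t, topped q c &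
      block_count c = vertices t].

Lemma asm_stats (b : btree E) k (f : nat -> chain) (L : nat -> seq A) (w v : nat -> nat) :
  (forall j, span_of (fun c => [/\ perm_eq (leaf_seq c) (L j), cell_size c = w j, lo_hi c & count_state hi c = v j]) (f j)) ->
  span_of (fun c => [/\ perm_eq (leaf_seq c) (flatten [seq L j | j <- iota k (bt_size b).+1]),
    cell_size c = (bt_size b + sumn [seq w j | j <- iota k (bt_size b).+1])%N, lo_hi c &
    count_state hi c = sumn [seq v j | j <- iota k (bt_size b).+1]]) (asm p p b k f).
Proof.
move=> hf; elim: b k => [|e l hl r hr] k /=.
  by apply: span_of_sub (hf k) => c [h1 h2 h3 h4]; split; rewrite ?cats0 ?addn0 ?add0n.
apply: (span_of_nd _ (hl k) (hr (k + (bt_size l).+1)%N)) => cl cr [h1 h2 h3 h4] [k1 k2 k3 k4].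
split=> /=.
- have -> : L k ++ flatten [seq L j | j <- iota k.+1 (bt_size l + bt_size r).+1] =
     flatten [seq L j | j <- iota k (bt_size l + bt_size r).+2] by [].
  by rewrite -map_iotaD flatten_cat; apply: perm_cat.
- have -> : (w k + sumn [seq w j | j <- iota k.+1 (bt_size l + bt_size r).+1])%N =
     sumn [seq w j | j <- iota k (bt_size l + bt_size r).+2] by [].
  by rewrite -map_iotaD sumn_cat h2 k2 /=; lia.
- by rewrite eqxx h3 k3.
- have -> : (v k + sumn [seq v j | j <- iota k.+1 (bt_size l + bt_size r).+1])%N =
     sumn [seq v j | j <- iota k (bt_size l + bt_size r).+2] by [].
  by rewrite -map_iotaD sumn_cat h4 k4 ltn_eqF.
Qed.

Lemma topped_hi c : topped hi c -> lo_hi c /\ count_state hi c = block_count c.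
Proof. by case: c => //= s e l r /and3P[/eqP -> -> ->]; rewrite eqxx orbT. Qed.

Lemma sumn_iota m (F : nat -> nat) : sumn [seq F j | j <- iota 0 m] = (\sum_(i < m) F i)%N.
Proof. by rewrite sumnE big_map -[X in iota 0 X](subn0 m) -/(index_iota 0 m) big_mkord. Qed.

Lemma nc_stats t q : span_of (same_stats q t) (nc q t).
Proof.
elim: t q => [a|m v ch IH] q; first by apply: span_ofU; split.
case: m v ch IH => [|m] v ch IH; first exact: in_span0.
rewrite ncE //; apply: (subg_sum (subg_span_of _)) => s _; apply: (subg_sn (subg_span_of _)).
rewrite /asml; apply: fglift_in => [|[b hb]]; first exact: subg_span_of.
pose F j := ch (s^-1%g (inord j)).
have hf j : span_of (fun c => [/\ perm_eq (leaf_seq c) (leaves (F j)), cell_size c = weight (F j), lo_hi c & count_state hi c = vertices (F j)])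
    (kids p ch s j).
  apply: span_of_sub (IH (s^-1%g (inord j)) hi) => c [h1 h2 h3 h4].
  by have [k1 k2] := topped_hi h3; split=> //; rewrite k2.
have sumF (G : dtr -> nat) : sumn [seq G (F j) | j <- iota 0 m.+2] = (\sum_(i < m.+2) G (ch i))%N.
  rewrite sumn_iota -(sum_perm s (fun i => G (ch i))).
  by apply: eq_bigr => i _; rewrite /F inord_val.
have permF : perm_eq (flatten [seq leaves (F j) | j <- iota 0 m.+2]) (leaves (Node m.+1 v ch)).
  rewrite [leaves (Node _ _ _)]/=; apply: perm_flatten.
  have -> : [seq leaves (F j) | j <- iota 0 m.+2] = [seq leaves (ch i) | i <- [seq s^-1%g i | i <- enum 'I_m.+2]].
    by rewrite -val_enum_ord -!map_comp; apply: eq_map => i /=; rewrite /F inord_val.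
  apply: perm_map; apply: uniq_perm; rewrite ?enum_uniq //.
    by rewrite map_inj_uniq ?enum_uniq //; apply: perm_inj.
  move=> i; rewrite mem_enum inE; apply/mapP; exists (s i); rewrite ?mem_enum //.
  by rewrite permK.
case: b hb => [|e l r] //= /eqP hb.
have e2 (T : Type) (G : nat -> T) : [seq G j | j <- iota 0 (bt_size l).+1] ++ [seq G j | j <- iota (0 + (bt_size l).+1) (bt_size r).+1] = [seq G j | j <- iota 0 m.+2].
  by rewrite map_iotaD hb.
apply: (span_of_nd _ (asm_stats l 0 hf) (asm_stats r (0 + (bt_size l).+1) hf)) => cl cr [h1 h2 h3 h4] [k1 k2 k3 k4].
split.
- apply: perm_trans permF; rewrite -e2 flatten_cat /=; exact: perm_cat.
- by rewrite [RHS]/= -sumF -e2 sumn_cat [LHS]/= h2 k2 -[m.+1]hb; lia.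
- by rewrite /= eqxx h3 k3.
- by rewrite [RHS]/= -sumF -e2 sumn_cat /block_count h4 k4.
Qed.

Lemma nth_ord_map (T : Type) (x0 : T) (ks : seq T) m (U : Type) (G : T -> U) : size ks = m ->
  [seq G (nth x0 ks (i : 'I_m)) | i <- enum 'I_m] = [seq G k | k <- ks].
Proof.
move=> <-; rewrite -[in RHS](mkseq_nth x0 ks) /mkseq -map_comp -val_enum_ord -map_comp.
exact: eq_map.
Qed.

Lemma sum_nth_ord (T : Type) (x0 : T) (ks : seq T) m (G : T -> nat) : size ks = m ->
  (\sum_(i < m) G (nth x0 ks i) = sumn [seq G k | k <- ks])%N.
Proof. by move=> h; rewrite -(nth_ord_map x0 G h) sumnE big_map big_enum. Qed.

Lemma mkn_stats m (b : btree E) (ks : seq dtr) : size ks = m.+1 ->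
  [/\ leaves (@mkn E R A a0 m b ks) = flatten [seq leaves k | k <- ks],
      weight (@mkn E R A a0 m b ks) = (m + sumn [seq weight k | k <- ks])%N,
      vertices (@mkn E R A a0 m b ks) = (sumn [seq vertices k | k <- ks]).+1 &
      reduced (@mkn E R A a0 m b ks) = (0 < m)%N && all (@reduced P A) ks].
Proof.
move=> hs; split=> /=.
- by rewrite (nth_ord_map (Leaf a0) (@leaves P A) hs).
- by rewrite (sum_nth_ord (Leaf a0) (@weight P A) hs).
- by rewrite (sum_nth_ord (Leaf a0) (@vertices P A) hs).
- congr (_ && _); apply/forallP/allP => [h k /(nthP (Leaf a0))[i hi <-]|h i].
    by rewrite hs in hi; apply: (h (Ordinal hi)).
  by apply: h; apply: mem_nth; rewrite hs.
Qed.

Lemma opn_stats c : lo_hi c ->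
  [/\ flatten [seq leaves k | k <- (opn c).2] = leaf_seq c,
      (bt_size (opn c).1 + sumn [seq weight k | k <- (opn c).2])%N = cell_size c,
      sumn [seq vertices k | k <- (opn c).2] = count_state hi c &
      all (@reduced P A) (opn c).2].
Proof.
elim: c => [a|s e l hl r hr] // /and3P[hs /hl[l1 l2 l3 l4] /hr[r1 r2 r3 r4]].
set ks := (opn l).2 ++ (opn r).2.
have e1 : flatten [seq leaves k | k <- ks] = leaf_seq l ++ leaf_seq r.
  by rewrite map_cat flatten_cat l1 r1.
have e2 : sumn [seq weight k | k <- ks] = (sumn [seq weight k | k <- (opn l).2] + sumn [seq weight k | k <- (opn r).2])%N.
  by rewrite map_cat sumn_cat.
have e3 : sumn [seq vertices k | k <- ks] = (count_state hi l + count_state hi r)%N.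
  by rewrite map_cat sumn_cat l3 r3.
have e4 : all (@reduced P A) ks by rewrite all_cat l4 r4.
have hk : size ks = (bt_size (opn l).1 + bt_size (opn r).1).+2.
  by rewrite size_cat !size_opn addSn addnS.
have -> : opn (CN s e l r) = if s == p then (BNode e (opn l).1 (opn r).1, ks)
    else (BLeaf E, [:: mkn a0 (size ks).-1 (BNode e (opn l).1 (opn r).1) ks]) by [].
have -> : leaf_seq (CN s e l r) = leaf_seq l ++ leaf_seq r by [].
have -> : cell_size (CN s e l r) = (cell_size l + cell_size r).+1 by [].
have -> : count_state hi (CN s e l r) = ((s == hi) + (count_state hi l + count_state hi r))%N by [].
rewrite hk; case: eqP hs => [->|_].
  by move=> _; rewrite ltn_eqF //; split=> //; rewrite e2 -l2 -r2 [LHS]/= addSn addnACA.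
move=> /eqP ->; rewrite eqxx.
have [m1 m2 m3 m4] := mkn_stats (BNode e (opn l).1 (opn r).1) hk.
have sumn1 k : sumn [:: k] = k by rewrite /= addn0.
have flat1 (T : Type) (x : seq T) : flatten [:: x] = x by rewrite /= cats0.
rewrite [(_, _).2]/= [(_, _).1]/= !map_cons ![map _ [::]]/= !sumn1 flat1 m1 m2 m3 e1 e3; split=> //.
  by rewrite add0n e2 -l2 -r2 addSn addnACA.
by rewrite /all -/all m4 e4.
Qed.

Lemma sec_stats q c : topped q c ->
  [/\ leaves (sec c) = leaf_seq c, weight (sec c) = cell_size c,
      vertices (sec c) = block_count c & reduced (sec c)].
Proof.
case: c => [a|s e l r] // /and3P[_ /opn_stats[l1 l2 l3 l4] /opn_stats[r1 r2 r3 r4]].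
have hk : size ((opn l).2 ++ (opn r).2) = (bt_size (opn l).1 + bt_size (opn r).1).+2.
  by rewrite size_cat !size_opn addSn addnS.
have -> : sec (CN s e l r) = mkn a0 (size ((opn l).2 ++ (opn r).2)).-1 (BNode e (opn l).1 (opn r).1) ((opn l).2 ++ (opn r).2) by [].
have [m1 m2 m3 m4] := mkn_stats (BNode e (opn l).1 (opn r).1) hk.
rewrite hk m1 m2 m3 m4 !map_cat flatten_cat !sumn_cat all_cat l1 r1 l3 r3 l4 r4.
by split=> //; rewrite [cell_size _]/= -l2 -r2 addSn addnACA.
Qed.

Lemma bar_d_reduced (t : dtr) : reduced t -> span_of (@reduced P A) (bar_d t).
Proof.
have hS := subg_span_of (@reduced P A : dtr -> Prop).
elim: t => [a|m v ch IH] /=; first by move=> _; apply: in_span0.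
case/andP=> m0 /forallP red.
apply: (subg_sum hS) => i _; rewrite scale_sign; apply: (subg_sn hS); apply: (subgD hS).
  rewrite /contract; case e: (ch i) (red i) => [a|n w ch']; first by move=> _; apply: in_span0.
  case/andP=> n0 /forallP red'; apply: span_ofU => /=; rewrite addn_gt0 m0 /=.
  by apply/forallP => j; rewrite /plug; case: slotP.
apply: (span_of_lift hS) (IH i (red i)) => u hu; apply: span_ofU => /=; rewrite m0 /=.
by apply/forallP => j; rewrite /upd; case: eqP.
Qed.

Lemma lo_hi_counts c : (forall q, q != p -> q != hi -> count_state q c = 0%N) -> lo_hi c.
Proof.
elim: c => //= s e l hl r hr h.
apply/and3P; split.
- apply: contraT; rewrite negb_or => /andP[h1 h2]; have := h s h1 h2; rewrite eqxx; lia.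
- by apply: hl => q h1 h2; have := h q h1 h2; lia.
- by apply: hr => q h1 h2; have := h q h1 h2; lia.
Qed.

Lemma counts_lo_hi c : lo_hi c ->
  (forall q, q != p -> q != hi -> count_state q c = 0%N) /\
  cell_size c = (count_state p c + count_state hi c)%N.
Proof.
elim: c => //= s e l hl r hr /and3P[hs /hl[l1 l2] /hr[r1 r2]]; split=> [q q1 q2|].
  rewrite l1 // r1 //; case/orP: hs => /eqP ->; by rewrite eq_sym ?(negPf q1) ?(negPf q2).
rewrite l2 r2; case/orP: hs => /eqP ->; rewrite eqxx; first by rewrite ltn_eqF //; lia.
by rewrite gtn_eqF //; lia.
Qed.

(** The root of the bar construction is not an edge that can be contracted, so
    its mark q is passive and the additional term of [nc_bar_d] disappears. *)
Lemma nc_bar_diff q x : q != hi -> span_of (@reduced P A) x ->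
  K (dd (fglift (nc q) x) + fglift (nc q) (bar_diff x)).
Proof.
move=> /negPf qh; apply: (span_of_ind (G := fun x => K (dd (fglift (nc q) x) + fglift (nc q) (bar_diff x)))) => [|t red].
  split=> [|y z hy hz]; first by rewrite /bar_diff !fglift0 dd0 addr0; apply: rel0.
  rewrite /bar_diff !fgliftB ddB opprD || rewrite /bar_diff !fgliftB ddB.
  rewrite (_ : _ - _ + (_ - _) = (dd (fglift (nc q) y) + fglift (nc q) (fglift (@bar_d P A) y)) -
     (dd (fglift (nc q) z) + fglift (nc q) (fglift (@bar_d P A) z))); last by zmod.
  exact: relB.
have := nc_bar_d p red q; rewrite qh add0r /= opprK /bar_diff !fgliftU; exact.
Qed.

End Statistics.

Section Criterion.
Variables (E : finType) (R : free_ns E 2 -> Prop) (p : nat).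
Hypothesis exact_cells : forall n (L : seq 'I_n.+1 -> Prop) (t0 : cell E 'I_n.+1) j x,
  root_state t0 = Some p.+2 -> (forall q, (q < p)%N -> count_state q t0 = 0%N) ->
  span_of (fun t => cell_class p L t0 t /\ count_state p t = j.+1) x ->
  rel_ideal p R (dd p x) ->
  exists2 y, span_of (fun t => cell_class p L t0 t /\ count_state p t = j) y &
    rel_ideal p R (x - dd p y).

(** A cycle x of the bar construction gives a cycle of marked trees with k - 1
    cut internal edges, hence w - k uncut ones, and there is at least one, since
    k is not w. A chain bounding it comes back to the bar construction, where it
    bounds x up to null chains, by injectivity. *)
Theorem koszul_cells : koszul (regular_operad (quot_ns (P := free_ns E) R)).
Proof.
move=> n; change (forall w k : nat, k != w -> bar_acyclic (regular_operad (quot_ns (P := free_ns E) R)) n w k).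
move=> w k kw x hx hnull; set P := regular_operad _ in x hx hnull *.
pose A : eqType := 'I_n.+1; pose q := p.+2; pose a0 : A := ord0.
have qh : q != p.+1 by rewrite gtn_eqF.
have hxs : span_of (fun t : dtree (fun m => P m) A => [/\ reduced t, perm_eq (leaves t) (enum 'I_n.+1), weight t = w & vertices t = k]) x.
  by apply/span_of_dom.
have hred : span_of (@reduced P A) x by apply: span_of_sub hxs => t [].
pose X := fglift (@nc E R A p q) x.
have hX : span_of (fun c : cell E A => [/\ perm_eq (leaf_seq c) (enum 'I_n.+1), cell_size c = w, topped p q c & block_count p c = k]) X.
  apply: (span_of_lift (subg_span_of _)) hxs => t [_ h1 h2 h3].
  apply: span_of_sub (nc_stats p t q) => c [k1 k2 k3 k4].
  by split=> //; rewrite ?k2 ?k4 //; apply: perm_trans k1 h1.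
have KX : rel_ideal p R (dd p X).
  have := subgB (rel_subg A p R) (nc_bar_diff qh hred) (nc_null p hnull q).
  by rewrite addrK.
(* The class of trees to be considered is read off from one tree of X, so the
   case X = 0 is apart. *)
have done0 : X = 0 -> exists2 y, bar_chain (P := P) (n := n) w k.+1 y & bar_null (x - bar_diff y).
  move=> X0; exists 0; first by move=> t; rewrite dom0.
  rewrite /bar_diff fglift0 subr0; apply: (@null_nc E R A a0 p q) => //.
  by rewrite -/X X0; apply: rel0.
case E1: (dom X) => [|t0 ts]; first by apply: done0; apply/eqP; rewrite -dom_eq0 E1.
move/span_of_dom: (hX) => hX'; have := hX' t0; rewrite E1 mem_head => /(_ isT) [_ h2 h3 h4].
have : root_state t0 = Some q /\ (forall q', q' != p -> q' != p.+1 -> count_state q' t0 = (q == q')) /\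
    (count_state p t0 + k = w)%N.
  case: (t0) h2 h3 h4 => [a|s e l r] /=; first by move=> w0 _ k0; case/eqP: kw; rewrite -w0 -k0.
  move=> h2 /and3P[/eqP -> /counts_lo_hi[l1 l2] /counts_lo_hi[r1 r2]] h4; split=> //; split.
    by move=> q' q1 q2; rewrite (l1 _ q1 q2) (r1 _ q1 q2) !addn0.
  by rewrite gtn_eqF // -h2 -h4 l2 r2 add0n addnS addnACA.
case=> rt [ct0 cp0].
pose L : seq A -> Prop := fun s => perm_eq s (enum 'I_n.+1).
have [j hj] : exists j, count_state p t0 = j.+1.
  by exists (count_state p t0).-1; move: kw; rewrite -cp0; case: (count_state p t0) => //; rewrite eqxx.
have hXc : span_of (fun c => cell_class p L t0 c /\ count_state p c = j.+1) X.
  apply: span_of_sub hX => c [g1 g2 g3 g4].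
  case: c g1 g2 g3 g4 => [a|s e l r] g1 /=; first by move=> w0 _ k0; case/eqP: kw; rewrite -w0 -k0.
  move=> g2 /and3P[/eqP es /counts_lo_hi[l1 l2] /counts_lo_hi[r1 r2]] g4; split; first split=> //=.
  - by rewrite rt es.
  - by move=> q' q1 q2; rewrite ct0 // (l1 _ q1 q2) (r1 _ q1 q2) es !addn0.
  - rewrite es gtn_eqF // add0n; move: hj cp0 g2 g4; rewrite l2 r2.
    move: (count_state p l) (count_state p r) (count_state p.+1 l) (count_state p.+1 r) (count_state p t0); lia.
have [|Y hY KY] := exact_cells rt _ hXc KX.
  by move=> q' hq'; rewrite ct0 ?[q == q']gtn_eqF // -?ltn_neqAle ?neq_ltn; rewrite /q; lia.
have hY' : span_of (fun c : cell E A => [/\ perm_eq (leaf_seq c) (enum 'I_n.+1), cell_size c = w, topped p q c & block_count p c = k.+1]) Y.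
  apply: span_of_sub hY => c [[c1 c2 c3] c4].
  case: c c1 c2 c3 c4 => [a|s e l r] c1; first by rewrite rt.
  move=> /= c2 c3 c4; have es : s = q by move: c2; rewrite rt => -[].
  have c5 q' : q' != p -> q' != p.+1 -> (count_state q' l = 0 /\ count_state q' r = 0)%N.
    by move=> q1 q2; have := c3 q' q1 q2; rewrite ct0 // es; lia.
  have ll : lo_hi p l by apply: lo_hi_counts => q' q1 q2; case: (c5 q' q1 q2).
  have lr : lo_hi p r by apply: lo_hi_counts => q' q1 q2; case: (c5 q' q1 q2).
  have cw : (cell_size l + cell_size r).+1 = w.
    have := hX' t0; rewrite E1 mem_head => /(_ isT) [/perm_size d1 <- _ _].
    by move/perm_size: c1; rewrite -d1 !size_leaf_seq => -[].
  split=> //; first by rewrite es eqxx ll lr.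
  have [_ l2] := counts_lo_hi ll; have [_ r2] := counts_lo_hi lr.
  move: c4 cp0 hj cw; rewrite es gtn_eqF // add0n /= l2 r2.
  move: (count_state p l) (count_state p r) (count_state p.+1 l) (count_state p.+1 r) (count_state p t0); lia.
have hYt : span_of (topped p q) Y by apply: span_of_sub hY' => c [].
pose Z := @secl E R A a0 p Y.
have hZ : span_of (fun t : dtree (fun m => P m) A => [/\ reduced t, perm_eq (leaves t) (enum 'I_n.+1), weight t = w & vertices t = k.+1]) Z.
  apply: (span_of_lift (subg_span_of _)) hY' => c [d1 d2 d3 d4].
  by have [m1 m2 m3 m4] := @sec_stats E R A a0 p q c d3; apply: span_ofU; split; rewrite ?m1 ?m2 ?m3.
have hZr : span_of (@reduced P A) Z by apply: span_of_sub hZ => t [].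
exists (- Z).
  apply/(span_of_dom (fun t : dtree (fun m => P m) A => [/\ reduced t, perm_eq (leaves t) (enum 'I_n.+1), weight t = w & vertices t = k.+1])).
  exact: in_spanN.
have bN : bar_diff (- Z) = - bar_diff Z by apply: (raddfN (fglift (@bar_d P A))).
rewrite bN opprK; apply: (@null_nc E R A a0 p q).
  apply: in_spanD => //; apply: (span_of_lift (subg_span_of _)) hZr => t.
  exact: bar_d_reduced.
have Ksub := rel_subg A p R.
have k1 := nc_bar_diff qh hZr; have k2 := nc_secl (q := q) R a0 hYt.
have k3 := rel_dd k2; rewrite ddB in k3.
rewrite fgliftD -/X; rewrite (_ : X + _ = (X - dd p Y) + (dd p (fglift (@nc E R A p q) Z) + fglift (@nc E R A p q) (bar_diff Z)) -
  (dd p (fglift (@nc E R A p q) Z) - dd p Y)); last by zmod.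
by apply: (subgB Ksub) => //; apply: (subgD Ksub).
Qed.

End Criterion.

(** * Masks for the powers *)

Local Notation masks I := ({set I} * {set I} * {set I})%type.

(** The generators are the pairs (L, R) of sets of coordinates that cover all of
    them. *)
Definition mask_system (E I : finType) (lm rm : E -> {set I}) (mk : {set I} -> {set I} -> E) :=
  [/\ forall e, lm e :|: rm e = setT,
      forall L R, L :|: R = setT -> lm (mk L R) = L,
      forall L R, L :|: R = setT -> rm (mk L R) = R &
      forall e, mk (lm e) (rm e) = e].

Definition white_masked (Q : quadratic_data) : Prop :=
  exists (I : finType) (lm rm : generators Q -> {set I}) (mk : {set I} -> {set I} -> generators Q),
  [/\ mask_system lm rm mk,
      forall u, u \in relators Q -> masks_of lm rm u = 0 &
      forall t t' : bt_of (generators Q) 2, tree_masks lm rm t = tree_masks lm rm t' ->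
        << t >> - << t' >> \in relators Q].

Definition black_masked (Q : quadratic_data) : Prop :=
  exists (I : finType) (lm rm : generators Q -> {set I}) (mk : {set I} -> {set I} -> generators Q),
  [/\ mask_system lm rm mk,
      forall u, u \in relators Q -> in_span (fun v => exists S, v = dual_rel lm rm S) u &
      forall S, dual_rel lm rm S \in relators Q].

Theorem white_koszul Q : white_masked Q -> koszul (quadratic_operad Q).
Proof.
case=> I [lm [rm [mk [[h1 h2 h3 h4] R_masks R_same]]]].
apply: (@koszul_cells _ _ 0) => n L t0 j x root _.
by apply: (white_exact h1 h2 h3 h4 (ord0 : 'I_n.+1) R_masks R_same); rewrite /inert root.
Qed.

Theorem black_koszul Q : black_masked Q -> koszul (quadratic_operad Q).
Proof.
case=> I [lm [rm [mk [[h1 h2 h3 h4] R_dual dual_R]]]].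
apply: (@koszul_cells _ _ 1) => n L t0 j x root low.
apply: (black_exact h1 h2 h3 h4 (ord0 : 'I_n.+1) R_dual dual_R); first by rewrite /inert root.
by rewrite /no0 low.
Qed.

(** ** The product of two mask systems *)

(** The sets of coordinates of a product are pairs of such sets; hence its masks
    are pairs of masks. *)
Section Join.
Variables I I' : finType.

Definition join (S : {set I}) (S' : {set I'}) : {set I + I'} :=
  [set i | match i with inl k => k \in S | inr k => k \in S' end].
Definition part1 (S : {set I + I'}) : {set I} := [set k | inl k \in S].
Definition part2 (S : {set I + I'}) : {set I'} := [set k | inr k \in S].

Lemma part1_join S S' : part1 (join S S') = S.
Proof. by apply/setP => k; rewrite !inE. Qed.
Lemma part2_join S S' : part2 (join S S') = S'.
Proof. by apply/setP => k; rewrite !inE. Qed.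
Lemma join_parts S : join (part1 S) (part2 S) = S.
Proof. by apply/setP => -[] k; rewrite !inE. Qed.
Lemma joinI S T S' T' : join (S :&: T) (S' :&: T') = join S S' :&: join T T'.
Proof. by apply/setP => -[] k; rewrite !inE. Qed.
Lemma joinU S T S' T' : join (S :|: T) (S' :|: T') = join S S' :|: join T T'.
Proof. by apply/setP => -[] k; rewrite !inE. Qed.
Lemma joinT : join setT setT = setT.
Proof. by apply/setP => -[] k; rewrite !inE. Qed.

Lemma partsT L R : L :|: R = setT ->
  part1 L :|: part1 R = setT /\ part2 L :|: part2 R = setT.
Proof.
by move/setP => h; split; apply/setP => k;
  [have := h (inl k) | have := h (inr k)]; rewrite !inE.
Qed.

Definition join3 (S : masks I) (S' : masks I') : masks (I + I')%type :=
  (join S.1.1 S'.1.1, join S.1.2 S'.1.2, join S.2 S'.2).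

Lemma join3_inj S T S' T' : join3 S S' = join3 T T' -> S = T /\ S' = T'.
Proof.
have inj (X Y : {set I}) (X' Y' : {set I'}) : join X X' = join Y Y' -> X = Y /\ X' = Y'.
  by move=> h; split; [rewrite -(part1_join X X') h part1_join | rewrite -(part2_join X X') h part2_join].
case: S T S' T' => [[a b] c] [[a' b'] c'] [[d e] f] [[d' e'] f'] [/= h1 h2 h3].
by case: (inj _ _ _ _ h1) (inj _ _ _ _ h2) (inj _ _ _ _ h3) => -> -> [-> ->] [-> ->].
Qed.

Lemma join3_parts (S : masks (I + I')%type) : exists T T', S = join3 T T'.
Proof.
case: S => [[a b] c].
exists (part1 a, part1 b, part1 c), (part2 a, part2 b, part2 c).
by rewrite /join3 /= !join_parts.
Qed.

End Join.

Section MaskProduct.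
Variables (E E' I I' : finType).
Variables (lm rm : E -> {set I}) (mk : {set I} -> {set I} -> E).
Variables (lm' rm' : E' -> {set I'}) (mk' : {set I'} -> {set I'} -> E').

Definition lm2 (e : E * E') := join (lm e.1) (lm' e.2).
Definition rm2 (e : E * E') := join (rm e.1) (rm' e.2).
Definition mk2 (L R : {set I + I'}) := (mk (part1 L) (part1 R), mk' (part2 L) (part2 R)).

Lemma mask_system2 : mask_system lm rm mk -> mask_system lm' rm' mk' ->
  mask_system lm2 rm2 mk2.
Proof.
case=> h1 h2 h3 h4 [k1 k2 k3 k4]; rewrite /lm2 /rm2 /mk2; split=> [e|L R /partsT[p1 p2]|L R /partsT[p1 p2]|[e e']] /=.
- by rewrite -joinU h1 k1 joinT.
- by rewrite h2 // k2 // join_parts.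
- by rewrite h3 // k3 // join_parts.
- by rewrite !part1_join !part2_join h4 k4.
Qed.

Lemma left_masks2 e f : left_masks lm2 rm2 e f =
  join3 (left_masks lm rm e.1 f.1) (left_masks lm' rm' e.2 f.2).
Proof. by rewrite /left_masks /join3 /= !joinI. Qed.

Lemma right_masks2 e f : right_masks lm2 rm2 e f =
  join3 (right_masks lm rm e.1 f.1) (right_masks lm' rm' e.2 f.2).
Proof. by rewrite /right_masks /join3 /= !joinI. Qed.

Lemma tree_masks2 (t : bt_of (E * E')%type 2) : tree_masks lm2 rm2 t =
  join3 (tree_masks lm rm (bt_of_map fst t)) (tree_masks lm' rm' (bt_of_map snd t)).
Proof. by rewrite /=; case: (bt2P t) => e f /=; rewrite ?left_masks2 ?right_masks2. Qed.

End MaskProduct.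

(** The universal property of the tensor product. *)
Lemma tens_fglift (E E' : finType) (M : lmodType int) (g : bt_of E 2 -> bt_of E' 2 -> M) x y :
  fglift (fun tu => g tu.1 tu.2) (tens x y) = fglift (fun t => fglift (g t) y) x.
Proof.
rewrite /tens (fglift_map (fglift (fun tu => g tu.1 tu.2))); congr fglift; apply/funext => t.
rewrite (fglift_map (fglift (fun tu => g tu.1 tu.2))); congr fglift; apply/funext => u.
by rewrite /= fgliftU.
Qed.

Section TensB.
Variables E E' : finType.
Implicit Types (x : free_ns E 2) (y : free_ns E' 2).

Lemma tensU (t : bt_of E 2) (u : bt_of E' 2) : tens << t >> << u >> = << (t, u) >>.
Proof. by rewrite /tens !fgliftU. Qed.

Lemma tensBl x x' y : tens (x - x') y = tens x y - tens x' y.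
Proof. exact: fgliftB. Qed.

Lemma tensBr x y y' : tens x (y - y') = tens x y - tens x y'.
Proof. by rewrite /tens -fglift_sub; congr fglift; apply/funext => t; rewrite fgliftB. Qed.

Lemma PhiB (x y : free_ns (E * E')%type 2) : Phi (x - y) = Phi x - Phi y.
Proof. exact: fgliftB. Qed.

Lemma PsiB (x y : tensor3 E E') : Psi (x - y) = Psi x - Psi y.
Proof. exact: fgliftB. Qed.

End TensB.

(** ** White products *)

Lemma fglift_masks (E I : finType) (lm rm : E -> {set I}) (M : lmodType int) (G : masks I -> M) x :
  fglift (fun t : bt_of E 2 => G (tree_masks lm rm t)) x = fglift G (masks_of lm rm x).
Proof.
rewrite /masks_of (fglift_map (fglift G)); congr fglift; apply/funext => t.
by rewrite /= fgliftU.
Qed.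

(** The masks of a composite of pairs are pairs of masks, and the vanishing of
    masks on R (x) F + F (x) S is clear. Conversely two pairs of composites with
    equal masks differ by one relator in each component. *)
Lemma white_masked_prod P Q : white_masked P -> white_masked Q -> white_masked (white P Q).
Proof.
case=> I [lm [rm [mk [hm R_masks R_same]]]] [I' [lm' [rm' [mk' [hm' S_masks S_same]]]]].
exists (I + I')%type, (lm2 lm lm'), (rm2 rm rm'), (mk2 mk mk'); split.
- exact: mask_system2.
- move=> u hu.
  pose ev (tu : bt_of (generators P) 2 * bt_of (generators Q) 2) : {freeg (masks (I + I')%type) / int} :=
    << join3 (tree_masks lm rm tu.1) (tree_masks lm' rm' tu.2) >>.
  have -> : masks_of (lm2 lm lm') (rm2 rm rm') u = fglift ev (Phi u).
    rewrite /Phi (fglift_map (fglift ev)); congr fglift; apply/funext => t.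
    by rewrite /= fgliftU /ev -tree_masks2.
  move: hu => /asboolP; elim=> {u} [_ [x [y [hxy ->]]]||x y _ hx _ hy].
  + rewrite (tens_fglift (fun t u => << join3 (tree_masks lm rm t) (tree_masks lm' rm' u) >>)).
    case/orP: hxy => [/R_masks hx|/S_masks hy].
      pose G S := fglift (fun u : bt_of (generators Q) 2 => << join3 S (tree_masks lm' rm' u) >> : {freeg (masks (I + I')%type) / int}) y.
      by rewrite (fglift_masks lm rm G) hx fglift0.
    apply: fglift_eq0 => t.
    pose G S := << join3 (tree_masks lm rm t) S >> : {freeg (masks (I + I')%type) / int}.
    by rewrite (fglift_masks lm' rm' G) hy fglift0.
  + exact: fglift0.
  + by rewrite fgliftB hx hy subr0.
- move=> t t'; rewrite !tree_masks2 => /join3_inj [e1 e2].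
  rewrite unfold_in /= unfold_in PhiB /Phi !fgliftU.
  set t1 := bt_of_map fst t; set t2 := bt_of_map snd t.
  set u1 := bt_of_map fst t' in e1 *; set u2 := bt_of_map snd t' in e2 *.
  apply/asboolP.
  rewrite (_ : _ - _ = tens (<< t1 >> - << u1 >>) << t2 >> + tens << u1 >> (<< t2 >> - << u2 >>)).
    apply: in_spanD; apply: in_span_gen.
      by exists (<< t1 >> - << u1 >>), << t2 >>; rewrite R_same.
    by exists << u1 >>, (<< t2 >> - << u2 >>); rewrite S_same ?orbT.
  by rewrite tensBl tensBr !tensU addrA subrK.
Qed.

(** ** Black products *)

Lemma sum_pairs (E E' : finType) (M : zmodType) (P : pred (E * E)) (P' : pred (E' * E'))
    (F : (E * E') * (E * E') -> M) :
  \sum_(ee | P ee) \sum_(ff | P' ff) F ((ee.1, ff.1), (ee.2, ff.2)) =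
  \sum_(gg : (E * E') * (E * E') | P (gg.1.1, gg.2.1) && P' (gg.1.2, gg.2.2)) F gg.
Proof.
rewrite pair_big /=.
pose h (z : (E * E) * (E' * E')) := ((z.1.1, z.2.1), (z.1.2, z.2.2)).
pose k (z : (E * E') * (E * E')) := ((z.1.1, z.2.1), (z.1.2, z.2.2)).
have hk : cancel h k by case=> -[a b] [c d].
have kh : cancel k h by case=> -[a b] [c d].
rewrite [RHS](reindex h) /=; last by exists k => z _.
by apply: eq_big => -[[a b] [c d]].
Qed.

(** The map Psi sends the product of two dual relators to the dual relator of the
    pair of masks: mixed products of left and right combs vanish, and the two
    signs of the right combs combine with the sign of Psi into one. *)
Lemma black_masked_prod P Q : black_masked P -> black_masked Q -> black_masked (black P Q).
Proof.
case=> I [lm [rm [mk [hm R_dual dual_R]]]] [I' [lm' [rm' [mk' [hm' S_dual dual_S]]]]].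
exists (I + I')%type, (lm2 lm lm'), (rm2 rm rm'), (mk2 mk mk').
have dual2 S S' : Psi (tens (dual_rel lm rm S) (dual_rel lm' rm' S')) =
    dual_rel (lm2 lm lm') (rm2 rm rm') (join3 S S').
  have tensSum (F : generators P * generators P -> bt_of (generators P) 2)
      (G : generators Q * generators Q -> bt_of (generators Q) 2) p q :
      Psi (tens (\sum_(ee | p ee) << F ee >>) (\sum_(ff | q ff) << G ff >>)) =
      \sum_(ee | p ee) \sum_(ff | q ff) (Psi_basis (F ee) (G ff)).
    rewrite /Psi (tens_fglift (fun t u => Psi_basis t u : {freeg _ / int})) fglift_sum.
    by apply: eq_bigr => ee _; rewrite fgliftU fglift_sum; apply: eq_bigr => ff _; rewrite fgliftU.
  rewrite /dual_rel tensBl !tensBr !PsiB !tensSum.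
  rewrite [X in _ - X - _]big1 ?subr0 => [|ee _]; last by apply: big1.
  rewrite [X in _ - (X - _)]big1 ?sub0r ?opprK => [|ee _]; last by apply: big1.
  congr (_ + _).
    pose F (gg : (generators P * generators Q) * (generators P * generators Q)) :=
      << bt2l gg.1 gg.2 >> : free_ns (generators P * generators Q)%type 2.
    rewrite (eq_bigl (fun gg : (generators P * generators Q) * (generators P * generators Q) =>
      (left_masks lm rm gg.1.1 gg.2.1 == S) && (left_masks lm' rm' gg.1.2 gg.2.2 == S'))); last first.
      move=> gg; rewrite left_masks2; apply/eqP/andP => [/join3_inj [-> ->] //|[/eqP -> /eqP -> //]].
    apply: etrans (sum_pairs (fun ee => left_masks lm rm ee.1 ee.2 == S) (fun ff => left_masks lm' rm' ff.1 ff.2 == S') F).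
    apply: eq_bigr => ee _; apply: eq_bigr => ff _.
    by rewrite /= /comp1 /= free_compU; congr (<< _ >>); apply: val_inj.
  pose F (gg : (generators P * generators Q) * (generators P * generators Q)) :=
    << bt2r gg.1 gg.2 >> : free_ns (generators P * generators Q)%type 2.
  rewrite (eq_bigl (fun gg : (generators P * generators Q) * (generators P * generators Q) =>
    (right_masks lm rm gg.1.1 gg.2.1 == S) && (right_masks lm' rm' gg.1.2 gg.2.2 == S'))); last first.
    move=> gg; rewrite right_masks2; apply/eqP/andP => [/join3_inj [-> ->] //|[/eqP -> /eqP -> //]].
  rewrite -[RHS]/(- \sum_(gg | _) F gg).
  rewrite -(sum_pairs (fun ee => right_masks lm rm ee.1 ee.2 == S) (fun ff => right_masks lm' rm' ff.1 ff.2 == S') F).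
  rewrite -sumrN; apply: eq_bigr => ee _; rewrite -sumrN; apply: eq_bigr => ff _.
  by rewrite /= /comp2 /= free_compU; congr (- << _ >>); apply: val_inj.
split.
- exact: mask_system2.
- move=> u /asboolP; elim=> {u} [_ [x [y [/R_dual hx /S_dual hy ->]]]||x y _ hx _ hy]; last 2 first.
  + exact: in_span0.
  + exact: in_spanB.
  elim: hx => {x} [_ [S ->]||x x' _ hx _ hx']; last 2 first.
  + by rewrite -(subrr 0) tensBl subrr /Psi fglift0; apply: in_span0.
  + by rewrite tensBl PsiB; apply: in_spanB.
  elim: hy => {y} [_ [S' ->]||y y' _ hy _ hy'].
  + by rewrite dual2; apply: in_span_gen; eexists.
  + by rewrite -(subrr 0) tensBr subrr /Psi fglift0; apply: in_span0.
  + by rewrite tensBr PsiB; apply: in_spanB.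
- move=> S; have [T [T' ->]] := join3_parts S; rewrite -dual2.
  by apply/asboolP/in_span_gen; exists (dual_rel lm rm T), (dual_rel lm' rm' T').
Qed.

(** ** The three operations *)

(** With one coordinate, the operations 0, 1 and 2 select the left input, the
    right input and both: these are -|, |- and the middle product of Trias, and
    the operations of TriDend that correspond to them. *)
Definition tri_lm (e : 'I_3) : {set unit} := [set _ | val e != 1%N].
Definition tri_rm (e : 'I_3) : {set unit} := [set _ | val e != 0%N].
Definition tri_mk (L R : {set unit}) : 'I_3 :=
  inord (if tt \in L then if tt \in R then 2 else 0 else 1).

Lemma tri_eq (S T : {set unit}) : (tt \in S) = (tt \in T) -> S = T.
Proof. by move=> h; apply/setP => -[]. Qed.

Lemma tri_mask_system : mask_system tri_lm tri_rm tri_mk.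
Proof.
split.
- by move=> [[|[|[|//]]] he]; apply: tri_eq; rewrite !inE.
- move=> L R /setP/(_ tt); rewrite !inE => h; apply: tri_eq; rewrite inE /tri_mk /= inordK; last by case: (tt \in L); case: (tt \in R).
  by move: h; case: (tt \in L); case: (tt \in R).
- move=> L R /setP/(_ tt); rewrite !inE => h; apply: tri_eq; rewrite inE /tri_mk /= inordK; last by case: (tt \in L); case: (tt \in R).
  by move: h; case: (tt \in L); case: (tt \in R).
- by move=> [[|[|[|//]]] he]; apply: val_inj; rewrite /tri_mk !inE /= inordK.
Qed.

Local Notation op k := (inord k : 'I_3).
Local Notation left2 i j := (<< bt2l (op i) (op j) >> : free_ns 'I_3 2).
Local Notation right2 i j := (<< bt2r (op i) (op j) >> : free_ns 'I_3 2).

Lemma comp1_op i j : comp1 (tri_op i) (tri_op j) = left2 i j.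
Proof. by rewrite /comp1 /= free_compU; congr (<< _ >>); apply: val_inj. Qed.

Lemma comp2_op i j : comp2 (tri_op i) (tri_op j) = right2 i j.
Proof. by rewrite /comp2 /= free_compU; congr (<< _ >>); apply: val_inj. Qed.

Lemma ord3 (i : 'I_3) : [\/ i = op 0, i = op 1 | i = op 2].
Proof.
by case: i => [[|[|[|//]]] hi]; [constructor 1|constructor 2|constructor 3]; apply: val_inj; rewrite /= inordK.
Qed.

Lemma bt2_split (E : finType) (t : bt_of E 2) :
  exists e f, t = bt2l e f \/ t = bt2r e f.
Proof.
have := bt2P t; case E1: (bt_val t) / => [e f|e f]; exists e, f; [left|right]; exact: val_inj.
Qed.

(** The representative of a mask in Trias is its standard comb; the eleven
    relators connect the eighteen composites to the seven representatives. *)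
Definition tri_rep (S : masks unit) : free_ns 'I_3 2 :=
  << bt2r (std_root tri_mk S) (std_child tri_mk S) >>.

Lemma Trias_white : white_masked Trias.
Proof.
exists unit, tri_lm, tri_rm, tri_mk; split; first exact: tri_mask_system.
  move=> u /asboolP; elim=> {u} [u|| x y _ hx _ hy]; last 2 first.
  + exact: fglift0.
  + by rewrite /masks_of fgliftB -/(masks_of _ _ x) -/(masks_of _ _ y) hx hy subr0.
  rewrite /Trias_relations !comp1_op !comp2_op !inE.
  have masksB t t' : tree_masks tri_lm tri_rm (bt_val t) = tree_masks tri_lm tri_rm (bt_val t') ->
     masks_of tri_lm tri_rm (<< t >> - << t' >>) = 0.
    by rewrite /masks_of fgliftB !fgliftU => ->; rewrite subrr.
  by do ![case/orP | move/eqP ->]; apply: masksB; congr (_, _, _); apply: tri_eq;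
     rewrite !inE /= !inordK.
have repL (i j a b : nat) : (i < 3)%N -> (j < 3)%N ->
    op (if (i != 1) && (j != 1) then if (i != 1) && (j != 0) || (i != 0) then 2 else 0 else 1)%N = op a ->
    op (if (i != 1) && (j != 0) || ~~ ((i != 1) && (j != 0) || (i != 0)) then if (i != 0) then 2 else 0 else 1)%N = op b ->
    tri_rep (tree_masks tri_lm tri_rm (bt2l (op i) (op j))) = right2 a b.
  move=> hi hj; rewrite -[tree_masks _ _ _]/(left_masks tri_lm tri_rm (op i) (op j)).
  by rewrite /tri_rep /std_root /std_child /tri_mk /left_masks !inE /= !inordK // => -> ->.
have repR (i j a b : nat) : (i < 3)%N -> (j < 3)%N ->
    op (if (i != 1) then if (i != 0) && (j != 1) || (i != 0) && (j != 0) then 2 else 0 else 1)%N = op a ->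
    op (if (i != 0) && (j != 1) || ~~ ((i != 0) && (j != 1) || (i != 0) && (j != 0)) then if (i != 0) && (j != 0) then 2 else 0 else 1)%N = op b ->
    tri_rep (tree_masks tri_lm tri_rm (bt2r (op i) (op j))) = right2 a b.
  move=> hi hj; rewrite -[tree_masks _ _ _]/(right_masks tri_lm tri_rm (op i) (op j)).
  by rewrite /tri_rep /std_root /std_child /tri_mk /right_masks !inE /= !inordK // => -> ->.
have : all (fun x => x \in relators Trias) Trias_relations.
  by apply/allP => x hx; apply/asboolP/in_span_gen.
rewrite /Trias_relations !comp1_op !comp2_op /all.
case/and5P=> h0 h1 h2 h3 /and5P[h4 h5 h6 h7 /and4P[h8 h9 h10 _]].
have subR : subg (fun x => x \in relators Trias).
  by split=> [|x y]; [apply: rpred0 | apply: rpredB].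
have relT := subg_trans subR; have relC := subg_sym subR.
have rel0 (x : free_ns 'I_3 2) : x - x \in relators Trias by rewrite subrr; apply: (proj1 subR).
suff rep t : << t >> - tri_rep (tree_masks tri_lm tri_rm (bt_val t)) \in relators Trias.
  by move=> t t' e; apply: relT (rep t) _; rewrite e; apply: relC (rep t').
have [e [f [->|->]]] := bt2_split t; case: (ord3 e) => ->; case: (ord3 f) => ->.
- by rewrite (repL 0 0 0 0).
- by rewrite (repL 0 1 1 0).
- by rewrite (repL 0 2 2 0).
- by rewrite (repL 1 0 1 1) //; apply: relT h4 (relT _ _ _ h5 h6).
- by rewrite (repL 1 1 1 1) //; apply: relT h5 h6.
- by rewrite (repL 1 2 1 1).
- by rewrite (repL 2 0 2 1).
- by rewrite (repL 2 1 1 2).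
- by rewrite (repL 2 2 2 2).
- by rewrite (repR 0 0 0 0).
- by rewrite (repR 0 1 0 0) //; apply: relC.
- by rewrite (repR 0 2 0 0) //; apply: relC; apply: relT h1 h2.
- by rewrite (repR 1 0 1 0).
- by rewrite (repR 1 1 1 1).
- by rewrite (repR 1 2 1 2).
- by rewrite (repR 2 0 2 0).
- by rewrite (repR 2 1 2 1).
- by rewrite (repR 2 2 2 2).
Qed.

Definition bset (b : bool) : {set unit} := [set _ | b].

Lemma bset_mem (S : {set unit}) : bset (tt \in S) = S.
Proof. by apply: tri_eq; rewrite inE. Qed.

Lemma bset_eq a b : (bset a == bset b) = (a == b).
Proof. by apply/eqP/eqP => [/setP/(_ tt)|->//]; rewrite !inE. Qed.

Lemma tri_left_masks (e f : 'I_3) a b c :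
  (left_masks tri_lm tri_rm e f == (bset a, bset b, bset c)) =
  [&& (e != 1%N :> nat) && (f != 1%N :> nat) == a, (e != 1%N :> nat) && (f != 0%N :> nat) == b &
      (e != 0%N :> nat) == c].
Proof.
have -> : left_masks tri_lm tri_rm e f = (bset ((e != 1%N :> nat) && (f != 1%N :> nat)),
    bset ((e != 1%N :> nat) && (f != 0%N :> nat)), bset (e != 0%N :> nat)).
  by congr (_, _, _); apply: tri_eq; rewrite !inE.
by rewrite !xpair_eqE !bset_eq andbA.
Qed.

Lemma tri_right_masks (e f : 'I_3) a b c :
  (right_masks tri_lm tri_rm e f == (bset a, bset b, bset c)) =
  [&& (e != 1%N :> nat) == a, (e != 0%N :> nat) && (f != 1%N :> nat) == b &
      (e != 0%N :> nat) && (f != 0%N :> nat) == c].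
Proof.
have -> : right_masks tri_lm tri_rm e f = (bset (e != 1%N :> nat),
    bset ((e != 0%N :> nat) && (f != 1%N :> nat)), bset ((e != 0%N :> nat) && (f != 0%N :> nat))).
  by congr (_, _, _); apply: tri_eq; rewrite !inE.
by rewrite !xpair_eqE !bset_eq andbA.
Qed.

Lemma sum_ord3 (M : zmodType) (F : 'I_3 -> M) : \sum_i F i = F (op 0) + F (op 1) + F (op 2).
Proof.
rewrite !big_ord_recl big_ord0 addr0 addrA.
by congr (F _ + F _ + F _); apply: val_inj; rewrite /= inordK.
Qed.

Lemma tri_dual_rel a b c : dual_rel tri_lm tri_rm (bset a, bset b, bset c) =
  \sum_(e : 'I_3) \sum_(f : 'I_3)
    ((if [&& (e != 1%N :> nat) && (f != 1%N :> nat) == a, (e != 1%N :> nat) && (f != 0%N :> nat) == b &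
         (e != 0%N :> nat) == c] then << bt2l e f >> else 0) -
     (if [&& (e != 1%N :> nat) == a, (e != 0%N :> nat) && (f != 1%N :> nat) == b &
         (e != 0%N :> nat) && (f != 0%N :> nat) == c] then << bt2r e f >> else 0)).
Proof.
rewrite /dual_rel big_mkcond [X in _ - X]big_mkcond pair_bigA -sumrB.
by apply: eq_bigr => ee _; rewrite tri_left_masks tri_right_masks.
Qed.

(** The seven relators of TriDend are the dual relators of the nonempty masks, in
    the order in which [relE] lists them; the empty mask does not occur. *)
Lemma TriDend_black : black_masked TriDend.
Proof.
exists unit, tri_lm, tri_rm, tri_mk.
pose D a b c := dual_rel tri_lm tri_rm (bset a, bset b, bset c).
have D0 : D false false false = 0.
  by rewrite /D tri_dual_rel !sum_ord3 !inordK //= !subr0 !addr0.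
have relE : TriDend_relations = [:: D true false false; D false true false; D false false true;
    D false true true; D true false true; D true true false; D true true true].
  rewrite /D !tri_dual_rel !sum_ord3 !inordK //= !(subr0, sub0r, addr0, add0r).
  have comp1D (x y z : free_ns 'I_3 1) : comp1 x (y + z) = comp1 x y + comp1 x z by exact: ns_compDr.
  have comp2D (x y z : free_ns 'I_3 1) : comp2 x (y + z) = comp2 x y + comp2 x z by exact: ns_compDr.
  rewrite /TriDend_relations !(comp1D, comp2D) !comp1_op !comp2_op.
  congr [:: _; _; _; _; _; _; _]; zmod.
have relN k : (k < 7)%N -> nth 0 TriDend_relations k \in relators TriDend.
  by move=> hk; apply/asboolP/in_span_gen/mem_nth.
rewrite relE in relN.
have DR a b c : D a b c \in relators TriDend.
  case: a; case: b; case: c; [exact: (relN 6) | exact: (relN 5) | exact: (relN 4) | exact: (relN 0) |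
    exact: (relN 3) | exact: (relN 1) | exact: (relN 2) | by rewrite D0; apply: rpred0].
split; first exact: tri_mask_system.
  move=> u /asboolP; elim=> {u} [u||x y _ hx _ hy]; last 2 first.
  - exact: in_span0.
  - exact: in_spanB.
  rewrite relE => /(nthP 0)[k hk <-]; apply: in_span_gen.
  by move: k hk; do 7 ![case=> [_|]; first by eexists]; case.
by move=> [[a b] c]; rewrite -(bset_mem a) -(bset_mem b) -(bset_mem c); apply: DR.
Qed.

Theorem theorem54 (n : nat) (hn : (1 <= n)%N) :
  koszul (quadratic_operad (white_power Trias n)) /\
  koszul (quadratic_operad (black_power TriDend n)).
Proof.
split; [apply: white_koszul | apply: black_koszul]; rewrite /white_power /black_power; elim: n.-1 => [|m ih].
- exact: Trias_white.
- exact: white_masked_prod Trias_white ih.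
- exact: TriDend_black.
- exact: black_masked_prod TriDend_black ih.
Qed.
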